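(* With $S_1,S_2$ as in the context, $$S_1(q)=\frac{(q^4;q^4)_\infty}{(q^3;q^3)_\infty (q^6;q^{12})_\infty} \left(2\frac{(-q^4;q^4)_\infty^2}{(q^{24},q^{96};q^{120})_\infty} +q\frac{(-q^2;q^4)_\infty^2}{(q^{12},-q^{18};-q^{30})_\infty} \right),$$ $$S_2(q)=\frac{(q^4;q^4)_\infty}{(q^3;q^3)_\infty (q^6;q^{12})_\infty} \left(\frac{(-q^2;q^4)_\infty^2}{(-q^6,q^{24};-q^{30})_\infty} +2q^5\frac{(-q^4;q^4)_\infty^2}{(q^{48},q^{72};q^{120})_\infty} \right).$$
   Context: Let $|q|<1$ and use standard $q$-Pochhammer notation $(a;q)_n=\prod_{k=0}^{n-1}(1-aq^k)$, $(a;q)_\infty=\prod_{k\ge0}(1-aq^k)$, $(a_1,\dots,a_m;q)_\infty=(a_1;q)_\infty\cdots(a_m;q)_\infty$ (also with base $-q^{30}$ in place of $q$). Define $$S_1(q)=\sum_{i,j\geq 0}\frac{q^{\frac{1}{2}i^2-ij+2j^2-\frac{1}{2}i+2j}}{(q^3;q^3)_i(q^3;q^3)_j},\qquad S_2(q)=\sum_{i,j\geq 0}\frac{q^{\frac{1}{2}i^2-ij+2j^2+\frac{3}{2}i}}{(q^3;q^3)_i (q^3;q^3)_j}.$$ *)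

(* Defs.v *)
From Stdlib Require Import Reals ZArith.
From Coquelicot Require Import Coquelicot.

Open Scope C_scope.

Definition zpow (q : C) (z : Z) : C :=
  if (0 <=? z)%Z then pow_n q (Z.to_nat z) else Cinv (pow_n q (Z.to_nat (- z))).

Fixpoint qpoch (a q : C) (n : nat) : C :=
  match n with
  | O => 1
  | S m => qpoch a q m * (1 - a * pow_n q m)
  end.

Definition qpoch_inf (a q : C) : C := @lim (CompleteNormedModule.CompleteSpace _ C_CompleteNormedModule) (filtermap (qpoch a q) eventually).

Definition CSeries (u : nat -> C) : C := @lim (CompleteNormedModule.CompleteSpace _ C_CompleteNormedModule) (filtermap (sum_n u) eventually).

(* double series sum_{i,j >= 0} u i j, summed as an iterated series
   (the series in question are absolutely convergent for |q| < 1) *)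
Definition CSeries2 (u : nat -> nat -> C) : C :=
  CSeries (fun i => CSeries (fun j => u i j)).

Definition e1 (i j : nat) : Z :=
  let zi := Z.of_nat i in let zj := Z.of_nat j in
  ((zi * zi - zi) / 2 - zi * zj + 2 * zj * zj + 2 * zj)%Z.

Definition e2 (i j : nat) : Z :=
  let zi := Z.of_nat i in let zj := Z.of_nat j in
  ((zi * zi + 3 * zi) / 2 - zi * zj + 2 * zj * zj)%Z.

Definition S1 (q : C) : C :=
  CSeries2 (fun i j => zpow q (e1 i j) /
    (qpoch (pow_n q 3) (pow_n q 3) i * qpoch (pow_n q 3) (pow_n q 3) j)).

Definition S2 (q : C) : C :=
  CSeries2 (fun i j => zpow q (e2 i j) /
    (qpoch (pow_n q 3) (pow_n q 3) i * qpoch (pow_n q 3) (pow_n q 3) j)).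

(* Main.v *)
Require Import Defs.
From Stdlib Require Import Reals ZArith Lia Lra List FinFun FunctionalExtensionality ClassicalEpsilon.
From Coquelicot Require Import Coquelicot.
Import ListNotations.
Open Scope C_scope.

(** Write [Q = q^3] and [x = q^6].  The exponents of both double series split as a
quadratic in [i - j] plus [3 j (j + 1) / 2].  Expanding [1 / (Q; Q)_i] according to
[1 / (z; Q)_inf = (-z; Q)_inf / (z^2; Q^2)_inf] makes the sum over [j] an instance of
Cauchy's identity [sum_j Q^(j^2 + j m) / ((Q; Q)_j (Q; Q)_(j + m)) = 1 / (Q; Q)_inf].
What remains is a sum of [q^(2 (m + k / 2)^2 + ...) / (x; x)_k] over [m] in Z and [k >= 0];
splitting [k] by parity and translating [m] factors it into Gauss theta functions times
the four series [sum_r x^(r^2 + a r) / (x; x)_(2 r + b)].  These are Rogers's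
identities modulo 20.  They follow from Bailey pairs for [1 / (x; x)_(2 r + b)], which
count lattice paths in a strip of width one by the reflection principle, together
with the quintuple product, itself obtained by multiplying two triple products. *)

(** Both sides of the theorem are values of a total [lim], so nothing can be computed before
    convergence is known, and almost every step is a change of summation variables. Sums are
    therefore taken unconditionally over [Z] and its powers: with 1/(q;q)_n set to 0 for n < 0,
    shifts, reflections and linear substitutions create no boundary terms, and convergence mostly
    reduces to bounding a quadratic exponent below by |n| - K.

    The constants have a common origin. A strip of width one has its barriers 3 apart, so the Bailey
    pairs live at n - 3j and n + 3j up to shifts, with leading exponent 6j^2. Summing them adds
    (3j)^2, and 15j^2 is the shape of the quintuple product in base x^10 at z = x^k. The series
    correspond to k = 1, 2, 3, 4: even k gives base x^20 = q^120, odd k gives base -x^5 = -q^30.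

    The point q = 0 is treated apart, because the exponent laws for integer powers need q
    nonzero. *)

(** * Limits of complex sequences *)

Definition clim (u : nat -> C) (l : C) : Prop :=
  forall eps : R, (0 < eps)%R ->
  exists N : nat, forall n : nat, (N <= n)%nat -> (Cmod (u n - l) < eps)%R.

Lemma Cmod_sub_sym (a b : C) : Cmod (a - b) = Cmod (b - a).
Proof. rewrite <- (Cmod_opp (b - a)); f_equal; ring. Qed.

Lemma Cmod_sub_triangle (a b c : C) : (Cmod (a - c) <= Cmod (a - b) + Cmod (b - c))%R.
Proof. replace (a - c) with ((a - b) + (b - c)) by ring; apply Cmod_triangle. Qed.

Lemma eq_of_Cmod_small (a b : C) :
  (forall eps : R, (0 < eps)%R -> (Cmod (a - b) < eps)%R) -> a = b.
Proof.
  intros H.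
  assert (Hz : a - b = 0).
  { apply Cmod_eq_0.
    destruct (Req_dec (Cmod (a - b)) 0) as [E|E]; [exact E|].
    pose proof (Cmod_ge_0 (a - b)); specialize (H (Cmod (a - b))); lra. }
  replace a with ((a - b) + b) by ring; rewrite Hz; ring.
Qed.

Lemma clim_unique (u : nat -> C) (a b : C) : clim u a -> clim u b -> a = b.
Proof.
  intros Ha Hb; apply eq_of_Cmod_small; intros eps He.
  destruct (Ha (eps / 2)%R) as [N HN]; [lra|].
  destruct (Hb (eps / 2)%R) as [M HM]; [lra|].
  specialize (HN (max N M) ltac:(lia)); specialize (HM (max N M) ltac:(lia)).
  pose proof (Cmod_sub_triangle a (u (max N M)) b).
  rewrite (Cmod_sub_sym a (u _)) in H; lra.
Qed.

Lemma clim_ext (u v : nat -> C) (l : C) : (forall n, u n = v n) -> clim u l -> clim v l.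
Proof.
  intros E H eps He; destruct (H eps He) as [N HN]; exists N; intros n Hn.
  rewrite <- E; auto.
Qed.

Lemma clim_const (c : C) : clim (fun _ => c) c.
Proof.
  intros eps He; exists O; intros n _.
  replace (c - c) with (RtoC 0) by ring; rewrite Cmod_0; exact He.
Qed.

Lemma clim_subseq (u : nat -> C) (l : C) (f : nat -> nat) :
  (forall n, (n <= f n)%nat) -> clim u l -> clim (fun n => u (f n)) l.
Proof.
  intros Hf H eps He; destruct (H eps He) as [N HN]; exists N; intros n Hn.
  apply HN; specialize (Hf n); lia.
Qed.

Lemma clim_0_squeeze (u : nat -> C) (b : nat -> R) (l : C) :
  (forall n, (Cmod (u n - l) <= b n)%R) -> is_lim_seq b 0 -> clim u l.
Proof.
  intros H Hb eps He.
  apply is_lim_seq_spec in Hb; destruct (Hb (mkposreal eps He)) as [N HN].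
  exists N; intros n Hn; specialize (HN n Hn); simpl in HN.
  rewrite Rminus_0_r in HN; apply Rabs_def2 in HN; specialize (H n); lra.
Qed.

Lemma clim_plus (u v : nat -> C) (a b : C) :
  clim u a -> clim v b -> clim (fun n => u n + v n) (a + b).
Proof.
  intros Hu Hv eps He.
  destruct (Hu (eps / 2)%R) as [N HN]; [lra|].
  destruct (Hv (eps / 2)%R) as [M HM]; [lra|].
  exists (max N M); intros n Hn.
  specialize (HN n ltac:(lia)); specialize (HM n ltac:(lia)).
  replace (u n + v n - (a + b)) with ((u n - a) + (v n - b)) by ring.
  pose proof (Cmod_triangle (u n - a) (v n - b)); lra.
Qed.

Lemma clim_scal (u : nat -> C) (a c : C) : clim u a -> clim (fun n => c * u n) (c * a).
Proof.
  intros H eps He; pose proof (Cmod_ge_0 c) as Hc.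
  destruct (H (eps / (Cmod c + 1))%R) as [N HN]; [apply Rdiv_lt_0_compat; lra|].
  exists N; intros n Hn; specialize (HN n Hn).
  replace (c * u n - c * a) with (c * (u n - a)) by ring; rewrite Cmod_mult.
  apply (Rmult_lt_compat_r (Cmod c + 1)) in HN; [|lra].
  unfold Rdiv in HN; rewrite Rmult_assoc, Rinv_l, Rmult_1_r in HN by lra.
  pose proof (Cmod_ge_0 (u n - a)); nra.
Qed.

Lemma clim_mult (u v : nat -> C) (a b : C) :
  clim u a -> clim v b -> clim (fun n => u n * v n) (a * b).
Proof.
  intros Hu Hv.
  apply clim_ext with (fun n => (u n - a) * (v n - b) + (a * v n + b * u n - a * b)).
  { intros n; ring. }
  replace (a * b) with (0 + (a * b + b * a - a * b)) by ring.
  apply clim_plus.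
  - intros eps He.
    destruct (Hu 1%R ltac:(lra)) as [N HN]; destruct (Hv eps He) as [M HM].
    exists (max N M); intros n Hn.
    specialize (HN n ltac:(lia)); specialize (HM n ltac:(lia)).
    replace ((u n - a) * (v n - b) - 0) with ((u n - a) * (v n - b)) by ring.
    rewrite Cmod_mult.
    pose proof (Cmod_ge_0 (u n - a)); pose proof (Cmod_ge_0 (v n - b)); nra.
  - apply clim_plus; [apply clim_plus; apply clim_scal; assumption|].
    replace (- (a * b)) with (- (a * b) * 1) by ring.
    apply clim_ext with (fun _ => - (a * b) * 1); [intros; ring|apply clim_const].
Qed.

Lemma clim_filterlim (u : nat -> C) (l : C) :
  clim u l -> forall eps : posreal, eventually (fun n => @ball C_UniformSpace l eps (u n)).
Proof.
  intros H eps; destruct (H eps (cond_pos eps)) as [N HN]; exists N; intros n Hn.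
  specialize (HN n Hn).
  pose proof (Rmax_Cmod (u n - l)) as Hm.
  pose proof (Rmax_l (Rabs (fst (u n - l))) (Rabs (snd (u n - l)))).
  pose proof (Rmax_r (Rabs (fst (u n - l))) (Rabs (snd (u n - l)))).
  split; unfold ball; simpl; unfold AbsRing_ball; simpl; unfold abs, minus, plus, opp; simpl.
  - simpl in *; unfold Rminus in *; lra.
  - simpl in *; unfold Rminus in *; lra.
Qed.

(** The bridge from the total [lim] to actual limits. On a proper Cauchy filter, [lim] is specified
    only through balls, and the balls of [C] are boxes, so its value is pinned down coordinate by
    coordinate. *)
Lemma lim_clim (u : nat -> C) (l : C) :
  clim u l ->
  @lim (CompleteNormedModule.CompleteSpace _ C_CompleteNormedModule) (filtermap u eventually) = l.
Proof.
  intros H; pose proof (clim_filterlim u l H) as Hb.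
  set (L := lim _).
  assert (HL : forall eps : posreal, eventually (fun n => @ball C_UniformSpace L eps (u n))).
  { intros eps.
    apply (complete_cauchy (T := CompleteNormedModule.CompleteSpace _ C_CompleteNormedModule)
             (filtermap u eventually)).
    - apply filtermap_proper_filter, eventually_filter.
    - intros e; exists l; exact (Hb e). }
  clearbody L; change (CompleteSpace.sort _) with C in L.
  assert (Hs : forall eps : R, (0 < eps)%R ->
    (Rabs (fst L - fst l) < eps)%R /\ (Rabs (snd L - snd l) < eps)%R).
  { intros eps He.
    assert (He2 : (0 < eps / 2)%R) by lra.
    destruct (HL (mkposreal _ He2)) as [N HN]; destruct (Hb (mkposreal _ He2)) as [M HM].
    specialize (HN (max N M) ltac:(lia)); specialize (HM (max N M) ltac:(lia)).
    unfold ball in HN, HM; simpl in HN, HM.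
    destruct HN as [A1 A2]; destruct HM as [B1 B2].
    unfold ball in A1, A2, B1, B2; simpl in A1, A2, B1, B2.
    unfold AbsRing_ball, abs, minus, plus, opp in A1, A2, B1, B2; simpl in A1, A2, B1, B2.
    apply Rabs_def2 in A1; apply Rabs_def2 in A2; apply Rabs_def2 in B1; apply Rabs_def2 in B2.
    split; apply Rabs_def1; lra. }
  apply injective_projections.
  - destruct (Req_dec (fst L) (fst l)) as [E|E]; [exact E|exfalso].
    destruct (Hs (Rabs (fst L - fst l))) as [A _]; [apply Rabs_pos_lt; lra|lra].
  - destruct (Req_dec (snd L) (snd l)) as [E|E]; [exact E|exfalso].
    destruct (Hs (Rabs (snd L - snd l))) as [_ A]; [apply Rabs_pos_lt; lra|lra].
Qed.

(** * Unconditional sums *)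

Fixpoint lsum {T : Type} (f : T -> C) (l : list T) : C :=
  match l with
  | [] => 0
  | t :: l' => f t + lsum f l'
  end.

Fixpoint asum {T : Type} (f : T -> C) (l : list T) : R :=
  match l with
  | [] => 0%R
  | t :: l' => (Cmod (f t) + asum f l')%R
  end.

(** Convergence along the directed set of finite subsets, encoded as duplicate-free lists. No
    enumeration of [T] is chosen, so every bijection of index types preserves sums. *)
Definition has_sum {T : Type} (f : T -> C) (s : C) : Prop :=
  forall eps : R, (0 < eps)%R ->
  exists F0 : list T, forall F : list T, NoDup F -> incl F0 F -> (Cmod (lsum f F - s) < eps)%R.

Definition summable {T : Type} (f : T -> C) : Prop :=
  exists M : R, forall F : list T, NoDup F -> (asum f F <= M)%R.

(** Classical decidability, so that [nodup] can build finite subsets of an arbitrary type. *)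
Definition ceq_dec {T : Type} (x y : T) : {x = y} + {x <> y} :=
  excluded_middle_informative (x = y).

Lemma lsum_ext {T : Type} (f g : T -> C) (l : list T) :
  (forall t, In t l -> f t = g t) -> lsum f l = lsum g l.
Proof.
  induction l as [|a l IH]; intros H; simpl; [reflexivity|].
  rewrite H, IH; auto with datatypes.
Qed.

Lemma lsum_app {T : Type} (f : T -> C) (l m : list T) : lsum f (l ++ m) = lsum f l + lsum f m.
Proof. induction l as [|a l IH]; simpl; [ring|rewrite IH; ring]. Qed.

Lemma lsum_map {T U : Type} (f : T -> C) (e : U -> T) (l : list U) :
  lsum f (map e l) = lsum (fun u => f (e u)) l.
Proof. induction l as [|a l IH]; simpl; [|rewrite IH]; reflexivity. Qed.

Lemma lsum_plus {T : Type} (f g : T -> C) (l : list T) :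
  lsum (fun t => f t + g t) l = lsum f l + lsum g l.
Proof. induction l as [|a l IH]; simpl; [ring|rewrite IH; ring]. Qed.

Lemma lsum_scal {T : Type} (c : C) (f : T -> C) (l : list T) :
  lsum (fun t => c * f t) l = c * lsum f l.
Proof. induction l as [|a l IH]; simpl; [ring|rewrite IH; ring]. Qed.

Lemma lsum_list_prod {A B : Type} (f : A * B -> C) (l : list A) (m : list B) :
  lsum f (list_prod l m) = lsum (fun a => lsum (fun b => f (a, b)) m) l.
Proof.
  induction l as [|a l IH]; simpl; [reflexivity|].
  rewrite lsum_app, IH, lsum_map; reflexivity.
Qed.

Lemma lsum_exchange {A B : Type} (f : A -> B -> C) (l : list A) (m : list B) :
  lsum (fun a => lsum (fun b => f a b) m) l = lsum (fun b => lsum (fun a => f a b) l) m.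
Proof.
  induction l as [|a l IH]; simpl.
  - induction m as [|b m IHm]; simpl; [|rewrite <- IHm]; ring.
  - rewrite IH, <- lsum_plus; reflexivity.
Qed.

Lemma Cmod_lsum {T : Type} (f : T -> C) (l : list T) : (Cmod (lsum f l) <= asum f l)%R.
Proof.
  induction l as [|a l IH]; simpl; [rewrite Cmod_0; lra|].
  pose proof (Cmod_triangle (f a) (lsum f l)); lra.
Qed.

Lemma asum_nonneg {T : Type} (f : T -> C) (l : list T) : (0 <= asum f l)%R.
Proof. induction l as [|a l IH]; simpl; [lra|]. pose proof (Cmod_ge_0 (f a)); lra. Qed.

Lemma asum_app {T : Type} (f : T -> C) (l m : list T) :
  asum f (l ++ m) = (asum f l + asum f m)%R.
Proof. induction l as [|a l IH]; simpl; [lra|rewrite IH; lra]. Qed.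

Lemma asum_map {T U : Type} (f : T -> C) (e : U -> T) (l : list U) :
  asum f (map e l) = asum (fun u => f (e u)) l.
Proof. induction l as [|a l IH]; simpl; [|rewrite IH]; reflexivity. Qed.

Lemma asum_incl {T : Type} (f : T -> C) (l m : list T) :
  NoDup l -> incl l m -> (asum f l <= asum f m)%R.
Proof.
  revert m; induction l as [|a l IH]; intros m Hl Hi; simpl; [apply asum_nonneg|].
  destruct (in_split a m) as [m1 [m2 E]]; [apply Hi; left; reflexivity|]; subst m.
  inversion Hl as [|? ? Hna Hl']; subst.
  specialize (IH (m1 ++ m2) Hl').
  rewrite asum_app in *; simpl.
  cut (asum f l <= asum f m1 + asum f m2)%R; [lra|].
  apply IH; intros t Ht.
  assert (Ht' : In t (m1 ++ a :: m2)) by (apply Hi; right; exact Ht).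
  apply in_app_or in Ht'; apply in_or_app; destruct Ht' as [|[|]]; auto.
  subst; contradiction.
Qed.

Lemma NoDup_list_prod {A B : Type} (l : list A) (m : list B) :
  NoDup l -> NoDup m -> NoDup (list_prod l m).
Proof.
  intros Hl Hm; induction Hl as [|a l Ha Hl IH]; simpl; [constructor|].
  apply NoDup_app; auto.
  - apply FinFun.Injective_map_NoDup; auto; intros x y E; congruence.
  - intros [x y] H1 H2.
    apply in_map_iff in H1; destruct H1 as [z [E _]]; inversion E; subst.
    apply in_prod_iff in H2; tauto.
Qed.

Lemma has_sum_unique {T : Type} (f : T -> C) (a b : C) : has_sum f a -> has_sum f b -> a = b.
Proof.
  intros Ha Hb; apply eq_of_Cmod_small; intros eps He.
  destruct (Ha (eps / 2)%R) as [N HN]; [lra|].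
  destruct (Hb (eps / 2)%R) as [M HM]; [lra|].
  set (F := nodup ceq_dec (N ++ M)).
  assert (HF : NoDup F) by apply NoDup_nodup.
  specialize (HN F HF); specialize (HM F HF).
  pose proof (Cmod_sub_triangle a (lsum f F) b) as H.
  rewrite (Cmod_sub_sym a (lsum _ _)) in H.
  assert (Cmod (lsum f F - a) < eps / 2)%R
    by (apply HN; intros t Ht; apply nodup_In, in_or_app; auto).
  assert (Cmod (lsum f F - b) < eps / 2)%R
    by (apply HM; intros t Ht; apply nodup_In, in_or_app; auto).
  lra.
Qed.

Lemma has_sum_ext {T : Type} (f g : T -> C) (s : C) :
  (forall t, f t = g t) -> has_sum f s -> has_sum g s.
Proof. intros E H; replace g with f; [exact H|apply functional_extensionality, E]. Qed.

Lemma has_sum_plus {T : Type} (f g : T -> C) (a b : C) :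
  has_sum f a -> has_sum g b -> has_sum (fun t => f t + g t) (a + b).
Proof.
  intros Hf Hg eps He.
  destruct (Hf (eps / 2)%R) as [N HN]; [lra|].
  destruct (Hg (eps / 2)%R) as [M HM]; [lra|].
  exists (N ++ M); intros F HF Hi; apply incl_app_inv in Hi; destruct Hi as [Hi1 Hi2].
  specialize (HN F HF Hi1); specialize (HM F HF Hi2).
  rewrite lsum_plus.
  replace (lsum f F + lsum g F - (a + b)) with ((lsum f F - a) + (lsum g F - b)) by ring.
  pose proof (Cmod_triangle (lsum f F - a) (lsum g F - b)); lra.
Qed.

Lemma has_sum_scal {T : Type} (c : C) (f : T -> C) (a : C) :
  has_sum f a -> has_sum (fun t => c * f t) (c * a).
Proof.
  intros H eps He; pose proof (Cmod_ge_0 c) as Hc.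
  destruct (H (eps / (Cmod c + 1))%R) as [N HN]; [apply Rdiv_lt_0_compat; lra|].
  exists N; intros F HF Hi; specialize (HN F HF Hi).
  rewrite lsum_scal.
  replace (c * lsum f F - c * a) with (c * (lsum f F - a)) by ring; rewrite Cmod_mult.
  apply (Rmult_lt_compat_r (Cmod c + 1)) in HN; [|lra].
  unfold Rdiv in HN; rewrite Rmult_assoc, Rinv_l, Rmult_1_r in HN by lra.
  pose proof (Cmod_ge_0 (lsum f F - a)); nra.
Qed.

Lemma has_sum_0 {T : Type} : has_sum (fun _ : T => 0) 0.
Proof.
  intros eps He; exists []; intros F _ _.
  replace (lsum _ F) with (RtoC 0).
  - replace (RtoC 0 - 0) with (RtoC 0) by ring; rewrite Cmod_0; exact He.
  - induction F as [|a F IH]; simpl; [reflexivity|rewrite <- IH; ring].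
Qed.

Lemma has_sum_lsum {A B : Type} (f : A -> B -> C) (g : A -> C) (l : list A) :
  (forall a, has_sum (f a) (g a)) -> has_sum (fun b => lsum (fun a => f a b) l) (lsum g l).
Proof.
  intros H; induction l as [|a l IH]; simpl; [apply has_sum_0|].
  apply has_sum_plus; auto.
Qed.

Lemma has_sum_bij {T U : Type} (e : U -> T) (d : T -> U) (f : T -> C) (s : C) :
  (forall u, d (e u) = u) -> (forall t, e (d t) = t) ->
  has_sum f s -> has_sum (fun u => f (e u)) s.
Proof.
  intros He Hd H eps Hp; destruct (H eps Hp) as [N HN].
  exists (map d N); intros F HF Hi.
  rewrite <- lsum_map; apply HN.
  - apply FinFun.Injective_map_NoDup; auto; intros x y E.
    rewrite <- (He x), <- (He y), E; reflexivity.
  - intros t Ht; rewrite <- (Hd t); apply in_map, Hi, in_map, Ht.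
Qed.

(** For a finite set [F] of rows, one finite set [G] of columns can be chosen so large that all row
    sums over [F] are accurate together and the rectangle [F] x [G] contains the set on which [f] is
    already close to [s]. *)
Lemma has_sum_fubini {A B : Type} (f : A * B -> C) (g : A -> C) (s : C) :
  has_sum f s -> (forall a, has_sum (fun b => f (a, b)) (g a)) -> has_sum g s.
Proof.
  intros Hf Hg eps He.
  destruct (Hf (eps / 2)%R) as [N HN]; [lra|].
  exists (map fst N); intros F HF Hi.
  destruct (has_sum_lsum (fun a b => f (a, b)) g F Hg (eps / 2)%R) as [M HM]; [lra|].
  set (G := nodup ceq_dec (M ++ map snd N)).
  assert (HG : NoDup G) by apply NoDup_nodup.
  specialize (HM G HG); specialize (HN (list_prod F G) (NoDup_list_prod F G HF HG)).
  rewrite lsum_list_prod, lsum_exchange in HN.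
  pose proof (Cmod_sub_triangle (lsum g F) (lsum (fun b => lsum (fun a => f (a, b)) F) G) s) as H.
  rewrite (Cmod_sub_sym (lsum g F) (lsum _ _)) in H.
  assert (Cmod (lsum (fun b => lsum (fun a => f (a, b)) F) G - lsum g F) < eps / 2)%R.
  { apply HM; intros t Ht; apply nodup_In, in_or_app; auto. }
  assert (Cmod (lsum (fun b => lsum (fun a => f (a, b)) F) G - s) < eps / 2)%R.
  { apply HN; intros [a b] Hab; apply in_prod_iff; split.
    - apply Hi, in_map_iff; exists (a, b); auto.
    - apply nodup_In, in_or_app; right; apply in_map_iff; exists (a, b); auto. }
  lra.
Qed.

(** * Absolute summability *)

Lemma summable_nonneg_sup {T : Type} (g : T -> R) (M : R) :
  (forall t, (0 <= g t)%R) ->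
  (forall F, NoDup F -> (asum (fun t => RtoC (g t)) F <= M)%R) ->
  exists s : C, has_sum (fun t => RtoC (g t)) s.
Proof.
  intros Hg HM.
  assert (HE : forall F, lsum (fun t => RtoC (g t)) F = RtoC (asum (fun t => RtoC (g t)) F)).
  { induction F as [|a F IH]; simpl; [reflexivity|].
    rewrite IH, Cmod_R, Rabs_pos_eq by apply Hg.
    symmetry; apply RtoC_plus. }
  destruct (completeness (fun x => exists F, NoDup F /\ x = asum (fun t => RtoC (g t)) F))
    as [s [Hub Hlub]].
  - exists M; intros x [F [HF Ex]]; subst; auto.
  - exists 0%R, []; split; [constructor|reflexivity].
  - exists (RtoC s); intros eps He.
    assert (HF0 : exists F, NoDup F /\ (s - eps < asum (fun t => RtoC (g t)) F)%R).
    { apply Classical_Prop.NNPP; intros Hn.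
      assert (s <= s - eps)%R; [|lra].
      apply Hlub; intros x [F [HF Ex]]; subst.
      apply Rnot_lt_le; intros Hlt; apply Hn; exists F; auto. }
    destruct HF0 as [F0 [HF0 Hlt]]; exists F0; intros F HF Hi.
    rewrite HE, <- RtoC_minus, Cmod_R.
    pose proof (asum_incl (fun t => RtoC (g t)) F0 F HF0 Hi).
    assert (asum (fun t => RtoC (g t)) F <= s)%R by (apply Hub; exists F; auto).
    apply Rabs_def1; lra.
Qed.

Lemma summable_le {T : Type} (f g : T -> C) (K : R) :
  (0 <= K)%R -> (forall t, (Cmod (f t) <= K * Cmod (g t))%R) -> summable g -> summable f.
Proof.
  intros HK H [M HM]; exists (K * M)%R; intros F HF.
  apply Rle_trans with (K * asum g F)%R; [|apply Rmult_le_compat_l; auto].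
  clear HF; induction F as [|a F IH]; simpl; [lra|].
  specialize (H a); lra.
Qed.

(** The positive and negative parts of the real and imaginary parts are four nonnegative families
    dominated by |f|; each is summed by a least upper bound. *)
Lemma summable_has_sum {T : Type} (f : T -> C) : summable f -> exists s, has_sum f s.
Proof.
  intros Hf.
  assert (Hpart : forall p : C -> R, (forall z, (0 <= p z <= Cmod z)%R) ->
    exists s, has_sum (fun t => RtoC (p (f t))) s).
  { intros p Hp.
    destruct (summable_le (fun t => RtoC (p (f t))) f 1) as [M HM]; auto; [lra| |].
    - intros t; rewrite Cmod_R, Rabs_pos_eq; destruct (Hp (f t)); lra.
    - apply summable_nonneg_sup with M; auto; intros t; apply Hp. }
  assert (Hc : forall z : C, (Rabs (fst z) <= Cmod z)%R /\ (Rabs (snd z) <= Cmod z)%R).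
  { intros z; pose proof (Rmax_Cmod z).
    pose proof (Rmax_l (Rabs (fst z)) (Rabs (snd z))).
    pose proof (Rmax_r (Rabs (fst z)) (Rabs (snd z))); lra. }
  destruct (Hpart (fun z => Rmax 0 (fst z))) as [a Ha].
  { intros z; destruct (Hc z) as [H _]; unfold Rmax; destruct (Rle_dec 0 (fst z)).
    - rewrite Rabs_pos_eq in H; lra.
    - pose proof (Cmod_ge_0 z); lra. }
  destruct (Hpart (fun z => Rmax 0 (- fst z))) as [b Hb].
  { intros z; destruct (Hc z) as [H _]; unfold Rmax; destruct (Rle_dec 0 (- fst z)).
    - rewrite Rabs_left1 in H; lra.
    - pose proof (Cmod_ge_0 z); lra. }
  destruct (Hpart (fun z => Rmax 0 (snd z))) as [c Hcc].
  { intros z; destruct (Hc z) as [_ H]; unfold Rmax; destruct (Rle_dec 0 (snd z)).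
    - rewrite Rabs_pos_eq in H; lra.
    - pose proof (Cmod_ge_0 z); lra. }
  destruct (Hpart (fun z => Rmax 0 (- snd z))) as [d Hd].
  { intros z; destruct (Hc z) as [_ H]; unfold Rmax; destruct (Rle_dec 0 (- snd z)).
    - rewrite Rabs_left1 in H; lra.
    - pose proof (Cmod_ge_0 z); lra. }
  exists ((a + (-1) * b) + Ci * (c + (-1) * d)).
  apply has_sum_ext with (fun t =>
    (RtoC (Rmax 0 (fst (f t))) + (-1) * RtoC (Rmax 0 (- fst (f t)))) +
    Ci * (RtoC (Rmax 0 (snd (f t))) + (-1) * RtoC (Rmax 0 (- snd (f t))))).
  - intros t.
    assert (Hm : forall x, (Rmax 0 x - Rmax 0 (- x))%R = x).
    { intros x; unfold Rmax; destruct (Rle_dec 0 x), (Rle_dec 0 (- x)); lra. }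
    pose proof (Hm (fst (f t))); pose proof (Hm (snd (f t))).
    destruct (f t) as [x y]; simpl in *; apply injective_projections; simpl; lra.
  - repeat first [apply has_sum_plus | apply has_sum_scal]; assumption.
Qed.

Lemma summable_inj {T U : Type} (e : U -> T) (f : T -> C) :
  (forall u v, e u = e v -> u = v) -> summable f -> summable (fun u => f (e u)).
Proof.
  intros He [M HM]; exists M; intros F HF; rewrite <- asum_map.
  apply HM, FinFun.Injective_map_NoDup; auto.
Qed.

Lemma summable_scal {T : Type} (c : C) (f : T -> C) : summable f -> summable (fun t => c * f t).
Proof.
  apply summable_le with (Cmod c); [apply Cmod_ge_0|].
  intros t; rewrite Cmod_mult; lra.
Qed.

(** A finite set of pairs lies in the rectangle spanned by its two projections, and over a rectangle
    the sum of moduli factors. *)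
Lemma summable_mul {A B : Type} (f : A -> C) (g : B -> C) :
  summable f -> summable g -> summable (fun p : A * B => f (fst p) * g (snd p)).
Proof.
  intros [M HM] [N HN]; exists (M * N)%R; intros F HF.
  set (F1 := nodup ceq_dec (map fst F)); set (F2 := nodup ceq_dec (map snd F)).
  assert (H1 : NoDup F1) by apply NoDup_nodup; assert (H2 : NoDup F2) by apply NoDup_nodup.
  apply Rle_trans with (asum (fun p : A * B => f (fst p) * g (snd p)) (list_prod F1 F2)).
  - apply asum_incl; auto; intros [a b] H; apply in_prod_iff; split; apply nodup_In, in_map_iff;
      exists (a, b); auto.
  - apply Rle_trans with (asum f F1 * asum g F2)%R.
    + generalize F1; intros l; induction l as [|a l IH]; simpl; [lra|].
      rewrite asum_app, asum_map; simpl.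
      assert (E : asum (fun u => f a * g u) F2 = (Cmod (f a) * asum g F2)%R).
      { generalize F2; intros m; induction m as [|b m IHm]; simpl; [ring|].
        rewrite IHm, Cmod_mult; ring. }
      rewrite E; lra.
    + apply Rmult_le_compat; auto using asum_nonneg.
Qed.

Lemma has_sum_lim_nat (f : Z -> C) (s : C) :
  (forall n, (n < 0)%Z -> f n = 0) -> has_sum f s -> clim (sum_n (fun n => f (Z.of_nat n))) s.
Proof.
  intros H0 H eps He; destruct (H eps He) as [F0 HF0].
  assert (HN : exists N : nat, forall t, In t F0 -> (- Z.of_nat N <= t <= Z.of_nat N)%Z).
  { clear; induction F0 as [|a F [N HN]]; [exists O; intros t []|].
    exists (max N (Z.to_nat (Z.abs a))); intros t [E|Ht]; [subst; lia|].
    specialize (HN t Ht); lia. }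
  destruct HN as [N HN]; exists N; intros n Hn.
  (* The negative indices contribute only zeros; they are added so that the list contains [F0],
     which may include negative integers. *)
  set (F := map Z.of_nat (seq 0 (S n)) ++ map (fun k => - Z.of_nat k)%Z (seq 1 N)).
  assert (E : lsum f F = sum_n (fun n => f (Z.of_nat n)) n).
  { unfold F; rewrite lsum_app, !lsum_map.
    rewrite (lsum_ext (fun u : nat => f (- Z.of_nat u)%Z) (fun _ => 0) (seq 1 N)).
    2:{ intros t Ht; apply in_seq in Ht; apply H0; lia. }
    assert (E0 : forall l : list nat, lsum (fun _ => 0) l = 0).
    { induction l as [|a l IH]; simpl; [reflexivity|rewrite IH; ring]. }
    rewrite E0; clear -n.
    induction n as [|n IH].
    - rewrite sum_O; simpl; ring.
    - rewrite seq_S, lsum_app, sum_Sn, <- IH; simpl; unfold plus; simpl; ring. }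
  rewrite <- E; apply HF0.
  - apply NoDup_app.
    + apply FinFun.Injective_map_NoDup; [intros x y; apply Nat2Z.inj|apply seq_NoDup].
    + apply FinFun.Injective_map_NoDup; [intros x y; lia|apply seq_NoDup].
    + intros t Ht1 Ht2; apply in_map_iff in Ht1; apply in_map_iff in Ht2.
      destruct Ht1 as [x [E1 _]]; destruct Ht2 as [y [E2 Hy]]; apply in_seq in Hy; lia.
  - intros t Ht; specialize (HN t Ht); apply in_or_app.
    destruct (Z_le_gt_dec 0 t).
    + left; apply in_map_iff; exists (Z.to_nat t); split; [lia|apply in_seq; lia].
    + right; apply in_map_iff; exists (Z.to_nat (- t)); split; [lia|apply in_seq; lia].
Qed.

(** A choice of the sum, unspecified when there is none; this is why most rules below carry
    summability hypotheses. *)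
Definition tsum {T : Type} (f : T -> C) : C := epsilon (inhabits (RtoC 0)) (has_sum f).

Lemma tsum_spec {T : Type} (f : T -> C) : summable f -> has_sum f (tsum f).
Proof. intros H; apply (epsilon_spec (inhabits (RtoC 0)) (has_sum f)), summable_has_sum, H. Qed.

Lemma tsum_eq {T : Type} (f : T -> C) (s : C) : has_sum f s -> tsum f = s.
Proof.
  intros H; apply has_sum_unique with f; auto.
  apply (epsilon_spec (inhabits (RtoC 0)) (has_sum f)); exists s; exact H.
Qed.

Lemma tsum_ext {T : Type} (f g : T -> C) : (forall t, f t = g t) -> tsum f = tsum g.
Proof. intros H; f_equal; apply functional_extensionality, H. Qed.

Lemma tsum_plus {T : Type} (f g : T -> C) :
  summable f -> summable g -> tsum (fun t => f t + g t) = tsum f + tsum g.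
Proof. intros Hf Hg; apply tsum_eq, has_sum_plus; apply tsum_spec; assumption. Qed.

Lemma tsum_scal {T : Type} (c : C) (f : T -> C) :
  summable f -> tsum (fun t => c * f t) = c * tsum f.
Proof. intros Hf; apply tsum_eq, has_sum_scal, tsum_spec, Hf. Qed.

Lemma tsum_bij {T U : Type} (e : U -> T) (d : T -> U) (f : T -> C) :
  (forall u, d (e u) = u) -> (forall t, e (d t) = t) ->
  summable f -> tsum (fun u => f (e u)) = tsum f.
Proof. intros He Hd Hf; apply tsum_eq, (has_sum_bij e d); auto; apply tsum_spec, Hf. Qed.

Lemma summable_pair {A B : Type} (f : A * B -> C) (a : A) :
  summable f -> summable (fun b => f (a, b)).
Proof. apply (summable_inj (fun b : B => (a, b))); intros u v E; congruence. Qed.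

Lemma tsum_fubini {A B : Type} (f : A * B -> C) :
  summable f -> tsum f = tsum (fun a => tsum (fun b => f (a, b))).
Proof.
  intros Hf; symmetry; apply tsum_eq, has_sum_fubini with f; [apply tsum_spec, Hf|].
  intros a; apply tsum_spec, summable_pair, Hf.
Qed.

Lemma tsum_swap {A B : Type} (f : A * B -> C) :
  summable f -> tsum (fun a => tsum (fun b => f (a, b))) = tsum (fun b => tsum (fun a => f (a, b))).
Proof.
  intros Hf; rewrite <- tsum_fubini by exact Hf.
  set (sw := fun p : B * A => (snd p, fst p)).
  rewrite <- (tsum_bij sw (fun p => (snd p, fst p)) f); auto; try (intros [? ?]; reflexivity).
  apply tsum_fubini with (f := fun p => f (sw p)).
  apply summable_inj; auto; intros [? ?] [? ?] E; unfold sw in E; simpl in E; congruence.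
Qed.

Lemma tsum_mul {A B : Type} (f : A -> C) (g : B -> C) :
  summable f -> summable g -> tsum (fun p : A * B => f (fst p) * g (snd p)) = tsum f * tsum g.
Proof.
  intros Hf Hg; rewrite tsum_fubini by (apply summable_mul; assumption); simpl.
  rewrite (tsum_ext _ (fun a => tsum g * f a)).
  - rewrite tsum_scal by exact Hf; ring.
  - intros a; rewrite tsum_scal by exact Hg; ring.
Qed.

(** * Integer powers *)

Lemma pow_n_Cpow (q : C) (n : nat) : pow_n q n = q ^ n.
Proof. induction n as [|n IH]; simpl; [reflexivity|rewrite IH; reflexivity]. Qed.

Lemma zpow_Cpow_def (q : C) (n : Z) :
  zpow q n = if (0 <=? n)%Z then q ^ Z.to_nat n else / q ^ Z.to_nat (- n).
Proof. unfold zpow; destruct (0 <=? n)%Z; rewrite pow_n_Cpow; reflexivity. Qed.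

Lemma zpow_nat (q : C) (n : nat) : zpow q (Z.of_nat n) = q ^ n.
Proof.
  rewrite zpow_Cpow_def, Nat2Z.id.
  destruct (Z.leb_spec 0 (Z.of_nat n)); [reflexivity|lia].
Qed.

Lemma zpow_0_r (q : C) : zpow q 0 = 1.
Proof. exact (zpow_nat q 0). Qed.

Lemma zpow_1_r (q : C) : zpow q 1 = q.
Proof. change 1%Z with (Z.of_nat 1); rewrite zpow_nat; simpl; ring. Qed.

Lemma zpow_succ (q : C) (n : Z) : q <> 0 -> zpow q (n + 1) = q * zpow q n.
Proof.
  intros Hq; rewrite !zpow_Cpow_def.
  destruct (Z.leb_spec 0 (n + 1)), (Z.leb_spec 0 n); try lia.
  - replace (Z.to_nat (n + 1)) with (S (Z.to_nat n)) by lia; reflexivity.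
  - replace (Z.to_nat (n + 1)) with O by lia; replace (Z.to_nat (- n)) with 1%nat by lia.
    simpl; field; exact Hq.
  - replace (Z.to_nat (- n)) with (S (Z.to_nat (- (n + 1)))) by lia.
    rewrite Cpow_S; field; split; [apply Cpow_nz|]; exact Hq.
Qed.

Lemma zpow_add (q : C) (m n : Z) : q <> 0 -> zpow q (m + n) = zpow q m * zpow q n.
Proof.
  intros Hq; revert n; apply Z.bi_induction.
  - intros x y E; rewrite E; reflexivity.
  - rewrite Z.add_0_r, zpow_0_r; ring.
  - intros n; rewrite <- Z.add_1_r, Z.add_assoc, !zpow_succ by exact Hq.
    split; intros H.
    + rewrite H; ring.
    + apply (f_equal (fun z => / q * z)) in H.
      replace (/ q * (q * zpow q (m + n))) with (zpow q (m + n)) in H by (field; exact Hq).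
      rewrite H; field; exact Hq.
Qed.

Lemma zpow_nz (q : C) (n : Z) : q <> 0 -> zpow q n <> 0.
Proof.
  intros Hq H.
  assert (E : zpow q (n + - n) = 1) by (rewrite Z.add_opp_diag_r; apply zpow_0_r).
  rewrite zpow_add, H in E by exact Hq; apply C1_nz; rewrite <- E; ring.
Qed.

Lemma zpow_opp_r (q : C) (n : Z) : q <> 0 -> zpow q (- n) = / zpow q n.
Proof.
  intros Hq.
  assert (E : zpow q (n + - n) = 1) by (rewrite Z.add_opp_diag_r; apply zpow_0_r).
  rewrite zpow_add in E by exact Hq.
  pose proof (zpow_nz q n Hq).
  replace (zpow q (- n)) with (/ zpow q n * (zpow q n * zpow q (- n))) by (field; assumption).
  rewrite E; ring.
Qed.

Lemma zpow_mult_base (a b : C) (n : Z) :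
  a <> 0 -> b <> 0 -> zpow (a * b) n = zpow a n * zpow b n.
Proof.
  intros Ha Hb; rewrite !zpow_Cpow_def; destruct (0 <=? n)%Z; rewrite Cpow_mult_l; [reflexivity|].
  field; split; apply Cpow_nz; assumption.
Qed.

Lemma zpow_zpow (q : C) (m n : Z) : q <> 0 -> zpow (zpow q m) n = zpow q (m * n).
Proof.
  intros Hq; revert n; apply Z.bi_induction.
  - intros x y E; rewrite E; reflexivity.
  - rewrite Z.mul_0_r, !zpow_0_r; reflexivity.
  - intros n; rewrite <- Z.add_1_r, Z.mul_add_distr_l, Z.mul_1_r.
    rewrite zpow_succ, zpow_add by auto using zpow_nz.
    split; intros H; [rewrite H; ring|].
    pose proof (zpow_nz q m Hq) as Hm.
    apply (f_equal (fun z => / zpow q m * z)) in H.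
    replace (/ zpow q m * (zpow q m * zpow (zpow q m) n)) with (zpow (zpow q m) n) in H
      by (field; exact Hm).
    rewrite H; field; exact Hm.
Qed.

Lemma zpow_Cpow (q : C) (m : nat) (n : Z) : q <> 0 -> zpow (q ^ m) n = zpow q (Z.of_nat m * n).
Proof. intros Hq; rewrite <- zpow_nat; apply zpow_zpow, Hq. Qed.

Lemma zpow_1_l (n : Z) : zpow 1 n = 1.
Proof.
  rewrite zpow_Cpow_def, !Cpow_1_l; destruct (0 <=? n)%Z; [reflexivity|].
  field; exact C1_nz.
Qed.

Lemma Cmod_zpow_le (q : C) (m n : Z) :
  q <> 0 -> (Cmod q < 1)%R -> (m <= n)%Z -> (Cmod (zpow q n) <= Cmod (zpow q m))%R.
Proof.
  intros Hq H1 Hmn; replace n with (m + Z.of_nat (Z.to_nat (n - m)))%Z by lia.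
  rewrite zpow_add, zpow_nat, Cmod_mult, Cmod_pow by exact Hq.
  assert (Cmod q ^ Z.to_nat (n - m) <= 1)%R.
  { rewrite <- (pow1 (Z.to_nat (n - m))); apply pow_incr; pose proof (Cmod_ge_0 q); lra. }
  pose proof (Cmod_ge_0 (zpow q m)); nra.
Qed.

Lemma Cmod_Cpow_lt_1 (q : C) (n : nat) : (Cmod q < 1)%R -> (0 < n)%nat -> (Cmod (q ^ n) < 1)%R.
Proof.
  intros H Hn; rewrite Cmod_pow; apply pow_lt_1_compat; [|exact Hn].
  pose proof (Cmod_ge_0 q); lra.
Qed.

(* [|q|^K] tends to [0], so it eventually lies below both [|z|] and [1/|z|]. *)
Lemma Cmod_zpow_base_bound (q z : C) : q <> 0 -> (Cmod q < 1)%R -> z <> 0 ->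
  exists K : Z, (0 <= K)%Z /\ forall n, (Cmod (zpow z n) <= Cmod (zpow q (- (K * Z.abs n))))%R.
Proof.
  intros Hq H1 Hz.
  pose proof (proj1 (Cmod_gt_0 q) Hq) as Hq0; pose proof (proj1 (Cmod_gt_0 z) Hz) as Hz0.
  destruct (pow_lt_1_zero (Cmod q)) with (y := Rmin (Cmod z) (/ Cmod z)) as [K HK].
  { rewrite Rabs_pos_eq; lra. }
  { apply Rmin_glb_lt; [lra|apply Rinv_0_lt_compat; lra]. }
  specialize (HK K (Nat.le_refl K)); rewrite Rabs_pos_eq in HK by (apply pow_le; lra).
  assert (Ha : (Cmod q ^ K <= Cmod z)%R) by (pose proof (Rmin_l (Cmod z) (/ Cmod z)); lra).
  assert (Hb : (Cmod q ^ K <= / Cmod z)%R) by (pose proof (Rmin_r (Cmod z) (/ Cmod z)); lra).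
  assert (HKp : (0 < Cmod q ^ K)%R) by (apply pow_lt; lra).
  exists (Z.of_nat K); split; [lia|]; intros n.
  rewrite zpow_opp_r, <- zpow_Cpow by exact Hq.
  replace (Z.abs n) with (Z.of_nat (Z.abs_nat n)) by lia.
  rewrite zpow_nat, Cmod_inv, Cmod_pow by (apply Cpow_nz, Cpow_nz, Hq).
  rewrite Cmod_pow, <- pow_inv.
  destruct (Z_le_gt_dec 0 n) as [Hn|Hn].
  - replace n with (Z.of_nat (Z.abs_nat n)) at 1 by lia; rewrite zpow_nat, Cmod_pow.
    apply pow_incr; split; [lra|].
    rewrite <- (Rinv_inv (Cmod z)); apply Rinv_le_contravar; lra.
  - replace n with (- Z.of_nat (Z.abs_nat n))%Z at 1 by lia.
    rewrite zpow_opp_r, zpow_nat, Cmod_inv, Cmod_pow, <- pow_inv by auto using Cpow_nz.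
    apply pow_incr; split; [left; apply Rinv_0_lt_compat; lra|].
    apply Rinv_le_contravar; lra.
Qed.

(** * Summability of powers of [q] *)

Lemma geom_seq_bound (r : R) (n : nat) (k : nat) :
  (0 <= r < 1)%R -> (asum (fun j => RtoC (r ^ j)) (seq k n) <= / (1 - r))%R.
Proof.
  intros Hr.
  (* The starting point is generalised because the induction strips the first term, after which the
     bound telescopes. *)
  assert (H : forall k, (asum (fun j => RtoC (r ^ j)) (seq k n) * (1 - r) <= r ^ k)%R).
  { induction n as [|n IH]; intros j; simpl.
    - pose proof (pow_le r j); lra.
    - specialize (IH (S j)); simpl in IH.
      rewrite Cmod_R, Rabs_pos_eq by (apply pow_le; lra); nra. }
  specialize (H k).
  assert (r ^ k <= 1)%R by (rewrite <- (pow1 k); apply pow_incr; lra).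
  apply Rmult_le_reg_r with (1 - r)%R; [lra|]; rewrite Rinv_l; lra.
Qed.

Lemma summable_geom (r : R) : (0 <= r < 1)%R -> summable (fun n : Z => RtoC (r ^ Z.abs_nat n)).
Proof.
  intros Hr; exists (/ (1 - r) + / (1 - r))%R; intros F HF.
  assert (HN : exists N : nat, forall t, In t F -> (- Z.of_nat N < t < Z.of_nat N)%Z).
  { clear; induction F as [|a F [N HN]]; [exists O; intros t []|].
    exists (max N (S (Z.to_nat (Z.abs a)))); intros t [E|Ht]; [subst; lia|].
    specialize (HN t Ht); lia. }
  destruct HN as [N HN].
  apply Rle_trans with
    (asum (fun n : Z => RtoC (r ^ Z.abs_nat n))
      (map Z.of_nat (seq 0 N) ++ map (fun k => - Z.of_nat k)%Z (seq 1 N))).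
  - apply asum_incl; [exact HF|]; intros t Ht; specialize (HN t Ht); apply in_or_app.
    destruct (Z_le_gt_dec 0 t).
    + left; apply in_map_iff; exists (Z.to_nat t); split; [lia|apply in_seq; lia].
    + right; apply in_map_iff; exists (Z.to_nat (- t)); split; [lia|apply in_seq; lia].
  - rewrite asum_app, !asum_map.
    replace (fun u : nat => RtoC (r ^ Z.abs_nat (Z.of_nat u))) with (fun j => RtoC (r ^ j))
      by (apply functional_extensionality; intros j; rewrite Zabs2Nat.id; reflexivity).
    replace (fun u : nat => RtoC (r ^ Z.abs_nat (- Z.of_nat u))) with (fun j => RtoC (r ^ j))
      by (apply functional_extensionality; intros j; do 2 f_equal; lia).
    apply Rplus_le_compat; apply geom_seq_bound, Hr.
Qed.

Section Powers.

Variable q : C.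
Hypothesis q_nz : q <> 0.
Hypothesis q_lt : (Cmod q < 1)%R.

Lemma summable_zpow_abs : summable (fun n : Z => zpow q (Z.abs n)).
Proof using q_lt.
  apply summable_le with (fun n : Z => RtoC (Cmod q ^ Z.abs_nat n)) 1%R; [lra| |].
  - intros n; replace (Z.abs n) with (Z.of_nat (Z.abs_nat n)) by lia.
    rewrite zpow_nat, Cmod_pow, Cmod_R, Rabs_pos_eq; [lra|apply pow_le, Cmod_ge_0].
  - apply summable_geom; pose proof (Cmod_ge_0 q); lra.
Qed.

(** Comparison at the level of exponents: since |q| < 1, a lower bound on [e] is an upper bound on
    the modulus of q^e. The weights used for [w] are |n| and its sums over several variables, whose
    powers factor into geometric series. *)
Lemma summable_dom {T : Type} (w e : T -> Z) (K : Z) (c : T -> C) (B : R) :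
  summable (fun t => zpow q (w t)) -> (forall t, (w t - K <= e t)%Z) ->
  (forall t, (Cmod (c t) <= B)%R) -> summable (fun t => zpow q (e t) * c t).
Proof using q_nz q_lt.
  intros Hw He Hc.
  (* If [T] is empty, [B] may be negative; hence the constant below uses [Rabs B]. *)
  assert (HB : forall t : T, (0 <= B)%R).
  { intros t; pose proof (Hc t); pose proof (Cmod_ge_0 (c t)); lra. }
  apply summable_le with (fun t => zpow q (w t)) (Rabs B * Cmod (zpow q (- K)))%R; auto.
  - apply Rmult_le_pos; [apply Rabs_pos|apply Cmod_ge_0].
  - intros t; rewrite Cmod_mult, Rabs_pos_eq by (apply HB; exact t).
    pose proof (Cmod_zpow_le q _ _ q_nz q_lt (He t)) as H.
    unfold Z.sub in H; rewrite zpow_add, Cmod_mult in H by exact q_nz.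
    specialize (Hc t); pose proof (Cmod_ge_0 (c t)); pose proof (Cmod_ge_0 (zpow q (e t))).
    apply Rle_trans with (Cmod (zpow q (w t)) * Cmod (zpow q (- K)) * B)%R; [|lra].
    apply Rmult_le_compat; auto.
Qed.

Lemma summable_zpow1 (e : Z -> Z) (K : Z) (c : Z -> C) (B : R) :
  (forall n, (Z.abs n - K <= e n)%Z) -> (forall n, (Cmod (c n) <= B)%R) ->
  summable (fun n => zpow q (e n) * c n).
Proof using q_nz q_lt.
  intros He Hc; apply summable_dom with Z.abs K B; auto using summable_zpow_abs.
Qed.

Lemma summable_zpow2 (e : Z * Z -> Z) (K : Z) (c : Z * Z -> C) (B : R) :
  (forall m n, (Z.abs m + Z.abs n - K <= e (m, n))%Z) -> (forall p, (Cmod (c p) <= B)%R) ->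
  summable (fun p => zpow q (e p) * c p).
Proof using q_nz q_lt.
  intros He Hc; apply summable_dom with (fun p : Z * Z => Z.abs (fst p) + Z.abs (snd p))%Z K B;
    auto; [|intros [m n]; apply He].
  replace (fun t : Z * Z => zpow q (Z.abs (fst t) + Z.abs (snd t)))
    with (fun t : Z * Z => zpow q (Z.abs (fst t)) * zpow q (Z.abs (snd t)))
    by (apply functional_extensionality; intros t; rewrite zpow_add by exact q_nz; reflexivity).
  apply (summable_mul (fun m => zpow q (Z.abs m)) (fun n => zpow q (Z.abs n)));
    apply summable_zpow_abs.
Qed.

Lemma summable_zpow3 (e : Z * Z * Z -> Z) (K : Z) (c : Z * Z * Z -> C) (B : R) :
  (forall m n k, (Z.abs m + Z.abs n + Z.abs k - K <= e (m, n, k))%Z) ->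
  (forall p, (Cmod (c p) <= B)%R) ->
  summable (fun p => zpow q (e p) * c p).
Proof using q_nz q_lt.
  intros He Hc.
  apply summable_dom with
    (fun p : Z * Z * Z => Z.abs (fst (fst p)) + Z.abs (snd (fst p)) + Z.abs (snd p))%Z K B;
    auto; [|intros [[m n] k]; apply He].
  replace (fun t : Z * Z * Z => zpow q (Z.abs (fst (fst t)) + Z.abs (snd (fst t)) + Z.abs (snd t)))
    with (fun t : Z * Z * Z =>
            zpow q (Z.abs (fst (fst t)) + Z.abs (snd (fst t))) * 1 * zpow q (Z.abs (snd t)))
    by (apply functional_extensionality; intros t; rewrite (zpow_add q _ (Z.abs (snd t)) q_nz); ring).
  apply (summable_mul (fun m : Z * Z => zpow q (Z.abs (fst m) + Z.abs (snd m)) * 1)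
    (fun n => zpow q (Z.abs n))); [|apply summable_zpow_abs].
  apply (summable_zpow2 (fun m => Z.abs (fst m) + Z.abs (snd m))%Z 0 (fun _ => 1) 1).
  - intros m n; simpl; lia.
  - intros _; rewrite Cmod_1; lra.
Qed.

End Powers.

(** * Point masses and limits of sums *)

Lemma summable_ext {T : Type} (f g : T -> C) : (forall t, f t = g t) -> summable f -> summable g.
Proof. intros E H; replace g with f; [exact H|apply functional_extensionality, E]. Qed.

Lemma has_sum_delta (t0 : Z) (c : C) : has_sum (fun t : Z => if (t =? t0)%Z then c else 0) c.
Proof.
  intros eps He; exists [t0]; intros F HF Hi.
  assert (Hz : forall l, ~ In t0 l -> lsum (fun t : Z => if (t =? t0)%Z then c else 0) l = 0).
  { induction l as [|a l IH]; intros Hn; simpl; [reflexivity|].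
    rewrite IH by (intros H; apply Hn; right; exact H).
    destruct (Z.eqb_spec a t0); [exfalso; apply Hn; left; auto|ring]. }
  destruct (in_split t0 F) as [l1 [l2 E]]; [apply Hi; left; reflexivity|]; subst F.
  apply NoDup_remove_2 in HF.
  rewrite lsum_app; simpl.
  rewrite !Hz by (intros H; apply HF, in_or_app; auto).
  rewrite Z.eqb_refl; replace (0 + (c + 0) - c) with (RtoC 0) by ring; rewrite Cmod_0; exact He.
Qed.

Lemma Cmod_has_sum_le {T : Type} (f : T -> C) (s : C) (M : R) :
  has_sum f s -> (forall F, NoDup F -> (asum f F <= M)%R) -> (Cmod s <= M)%R.
Proof.
  intros H HM; apply Rnot_lt_le; intros Hlt.
  destruct (H (Cmod s - M)%R ltac:(lra)) as [F0 HF0].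
  set (F := nodup ceq_dec F0).
  assert (HF : NoDup F) by apply NoDup_nodup.
  specialize (HF0 F HF ltac:(intros t Ht; apply nodup_In, Ht)).
  specialize (HM F HF); pose proof (Cmod_lsum f F).
  pose proof (Cmod_sub_triangle s (lsum f F) 0) as Ht.
  rewrite (Cmod_sub_sym s (lsum f F)) in Ht.
  replace (s - 0) with s in Ht by ring; replace (lsum f F - 0) with (lsum f F) in Ht by ring; lra.
Qed.

(** A dominated convergence in which every term but the one at k = 0 decays like r^n uniformly. It
    evaluates Cauchy's sum as m tends to infinity and Euler's series as its argument tends to 0. *)
Lemma clim_tsum_head (f : nat -> Z -> C) (c : C) (g : Z -> C) (r : R) :
  (0 <= r < 1)%R -> summable g ->
  (forall n k, k <> 0%Z -> (Cmod (f n k) <= r ^ n * Cmod (g k))%R) ->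
  clim (fun n => f n 0%Z) c -> clim (fun n => tsum (f n)) c.
Proof.
  intros Hr [M HM] Hf Hc.
  set (h := fun n (k : Z) => if (k =? 0)%Z then RtoC 0 else f n k).
  assert (Hh : forall n k, (Cmod (h n k) <= r ^ n * Cmod (g k))%R).
  { intros n k; unfold h; destruct (Z.eqb_spec k 0); [|auto].
    rewrite Cmod_0; apply Rmult_le_pos; [apply pow_le; lra|apply Cmod_ge_0]. }
  assert (Hs : forall n, summable (h n)).
  { intros n; apply summable_le with g (r ^ n)%R; auto; [apply pow_le; lra|exists M; exact HM]. }
  assert (HE : forall n, tsum (f n) = f n 0%Z + tsum (h n)).
  { intros n; apply tsum_eq.
    apply has_sum_ext with (fun k => (if (k =? 0)%Z then f n 0%Z else RtoC 0) + h n k).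
    - intros k; unfold h; destruct (Z.eqb_spec k 0); [subst|]; ring.
    - apply has_sum_plus; [apply has_sum_delta|apply tsum_spec, Hs]. }
  apply clim_ext with (fun n => f n 0%Z + tsum (h n)); [intros n; rewrite HE; reflexivity|].
  replace c with (c + 0) by ring; apply clim_plus; [exact Hc|].
  apply clim_0_squeeze with (fun n => r ^ n * M)%R.
  - intros n; replace (tsum (h n) - 0) with (tsum (h n)) by ring.
    apply Cmod_has_sum_le with (h n); [apply tsum_spec, Hs|].
    intros F HF; apply Rle_trans with (r ^ n * asum g F)%R.
    + clear HF; induction F as [|a F IH]; simpl; [lra|]; specialize (Hh n a); lra.
    + apply Rmult_le_compat_l; [apply pow_le; lra|auto].
  - replace (Finite 0) with (Rbar_mult (Finite 0) (Finite M)) by (simpl; f_equal; ring).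
    apply is_lim_seq_scal_r; apply is_lim_seq_geom; rewrite Rabs_pos_eq; lra.
Qed.

(** * Pochhammer products *)

Lemma qpoch_S (a q : C) (n : nat) : qpoch a q (S n) = qpoch a q n * (1 - a * q ^ n).
Proof. simpl; rewrite pow_n_Cpow; reflexivity. Qed.

Lemma exp_monotone (x y : R) : (x <= y)%R -> (exp x <= exp y)%R.
Proof. intros [H| ->]; [left; apply exp_increasing, H|right; reflexivity]. Qed.

(** The inequality 1 + t <= exp t turns the product of the moduli into the exponential of a
    geometric sum. *)
Lemma qpoch_bounded (a q : C) : (Cmod q < 1)%R -> exists M, forall n, (Cmod (qpoch a q n) <= M)%R.
Proof.
  intros Hq; pose proof (Cmod_ge_0 q); pose proof (Cmod_ge_0 a).
  assert (H1 : forall n, (Cmod (qpoch a q n) <=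
    exp (Cmod a * asum (fun j => RtoC (Cmod q ^ j)) (seq 0 n)))%R).
  { induction n as [|n IH].
    - simpl; rewrite Cmod_1, Rmult_0_r, exp_0; lra.
    - rewrite qpoch_S, seq_S, asum_app, Rmult_plus_distr_l, exp_plus, Cmod_mult.
      apply Rmult_le_compat; auto using Cmod_ge_0.
      simpl; rewrite Rplus_0_r, Cmod_R, Rabs_pos_eq by (apply pow_le; assumption).
      pose proof (exp_ineq1_le (Cmod a * Cmod q ^ n)).
      pose proof (Cmod_triangle 1 (- (a * q ^ n))) as Ht.
      rewrite Cmod_opp, Cmod_mult, Cmod_pow, Cmod_1 in Ht.
      unfold Cminus; lra. }
  exists (exp (Cmod a * / (1 - Cmod q))); intros n.
  apply Rle_trans with (1 := H1 n), exp_monotone.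
  apply Rmult_le_compat_l; [assumption|]; apply geom_seq_bound; lra.
Qed.

(** The increments of the partial products are -(a;q)_n a q^n, absolutely summable because the
    partial products are bounded. The limit thus appears as a telescoping series, without
    logarithms. *)
Lemma clim_qpoch (a q : C) : (Cmod q < 1)%R -> clim (qpoch a q) (qpoch_inf a q).
Proof.
  intros Hq; pose proof (Cmod_ge_0 q).
  destruct (qpoch_bounded a q Hq) as [M HM].
  set (d := fun n : Z => if (n <? 0)%Z then RtoC 0
             else - (qpoch a q (Z.to_nat n) * (a * q ^ Z.to_nat n))).
  assert (Hd : summable d).
  { apply summable_le with (fun n : Z => RtoC (Cmod q ^ Z.abs_nat n)) (M * Cmod a)%R.
    - specialize (HM O); apply Rmult_le_pos; [|apply Cmod_ge_0].
      apply Rle_trans with (2 := HM), Cmod_ge_0.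
    - intros n; rewrite Cmod_R, Rabs_pos_eq by (apply pow_le, Cmod_ge_0).
      specialize (HM (Z.to_nat n)).
      assert (0 <= Cmod q ^ Z.abs_nat n)%R by (apply pow_le, Cmod_ge_0).
      pose proof (Cmod_ge_0 (qpoch a q (Z.to_nat n))); pose proof (Cmod_ge_0 a).
      unfold d; destruct (Z.ltb_spec n 0).
      + rewrite Cmod_0; repeat apply Rmult_le_pos; lra.
      + replace (Z.abs_nat n) with (Z.to_nat n) in * by lia.
        rewrite Cmod_opp, !Cmod_mult, Cmod_pow.
        rewrite <- Rmult_assoc; apply Rmult_le_compat_r; [assumption|].
        apply Rmult_le_compat_r; assumption.
    - apply summable_geom; lra. }
  apply tsum_spec, has_sum_lim_nat in Hd.
  2:{ intros n Hn; unfold d; destruct (Z.ltb_spec n 0); [reflexivity|lia]. }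
  (* [sum_n] includes its last index, so the partial sum up to [n] is the product with [S n]
     factors. *)
  assert (HE : forall n, 1 + sum_n (fun n => d (Z.of_nat n)) n = qpoch a q (S n)).
  { assert (Hdn : forall n : nat, d (Z.of_nat n) = - (qpoch a q n * (a * q ^ n))).
    { intros n; unfold d; rewrite Nat2Z.id.
      destruct (Z.ltb_spec (Z.of_nat n) 0); [lia|reflexivity]. }
    induction n as [|n IH].
    - rewrite sum_O, Hdn, qpoch_S; simpl; ring.
    - rewrite sum_Sn, (qpoch_S a q (S n)), <- IH, Hdn, <- IH; unfold plus; simpl; ring. }
  assert (HL : clim (qpoch a q) (1 + tsum d)).
  { intros eps He.
    destruct (clim_plus _ _ _ _ (clim_const 1) Hd eps He) as [N HN].
    exists (S N); intros n Hn; destruct n as [|n]; [lia|].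
    rewrite <- HE; apply HN; lia. }
  unfold qpoch_inf; rewrite (lim_clim _ _ HL); exact HL.
Qed.

(* [1 - t >= exp (- t / (1 - t))] turns the product into a geometric sum in the exponent. *)
Lemma qpoch_lower (a q : C) : (Cmod q < 1)%R -> (Cmod a < 1)%R ->
  exists c, (0 < c)%R /\ forall n, (c <= Cmod (qpoch a q n))%R.
Proof.
  intros Hq Ha; pose proof (Cmod_ge_0 q); pose proof (Cmod_ge_0 a).
  set (b := (/ (1 - Cmod a))%R).
  assert (Hb : (0 < b)%R) by (apply Rinv_0_lt_compat; lra).
  assert (H1 : forall n, (exp (- (b * asum (fun j => RtoC (Cmod q ^ j)) (seq 0 n)))
    <= Cmod (qpoch a q n))%R).
  { induction n as [|n IH].
    - simpl; rewrite Cmod_1, Rmult_0_r, Ropp_0, exp_0; lra.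
    - rewrite qpoch_S, seq_S, asum_app, Rmult_plus_distr_l, Ropp_plus_distr, exp_plus, Cmod_mult.
      apply Rmult_le_compat; auto; try (left; apply exp_pos).
      simpl; rewrite Rplus_0_r, Cmod_R, Rabs_pos_eq by (apply pow_le; assumption).
      set (t := (Cmod q ^ n)%R).
      assert (Ht : (0 <= t <= 1)%R).
      { split; [apply pow_le; assumption|].
        rewrite <- (pow1 n); apply pow_incr; lra. }
      apply Rle_trans with (1 - Cmod a * t)%R.
      + rewrite exp_Ropp.
        assert (Hp : (0 < 1 - Cmod a * t)%R) by nra.
        rewrite <- (Rinv_inv (1 - Cmod a * t)); apply Rinv_le_contravar.
        * apply Rinv_0_lt_compat; exact Hp.
        * apply Rle_trans with (2 := exp_ineq1_le (b * t)).
          apply Rmult_le_reg_r with (1 - Cmod a * t)%R; [exact Hp|].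
          rewrite Rinv_l by lra.
          assert (Hbb : (b * (1 - Cmod a) = 1)%R) by (unfold b; apply Rinv_l; lra).
          assert (E : ((1 + b * t) * (1 - Cmod a * t)
            = 1 + t * (b * (1 - Cmod a)) - Cmod a * t + b * Cmod a * t * (1 - t))%R) by ring.
          rewrite E, Hbb.
          assert (0 <= b * Cmod a * t * (1 - t))%R by (repeat apply Rmult_le_pos; lra).
          nra.
      + pose proof (Cmod_triangle (1 - a * q ^ n) (a * q ^ n)) as Htr.
        replace (1 - a * q ^ n + a * q ^ n) with (RtoC 1) in Htr by ring.
        rewrite Cmod_1, (Cmod_mult a), Cmod_pow in Htr; fold t in Htr; lra. }
  exists (exp (- (b * / (1 - Cmod q)))); split; [apply exp_pos|]; intros n.
  apply Rle_trans with (2 := H1 n), exp_monotone.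
  apply Ropp_le_contravar, Rmult_le_compat_l; [lra|]; apply geom_seq_bound; lra.
Qed.

Lemma qpoch_nz (a q : C) (n : nat) : (Cmod q < 1)%R -> (Cmod a < 1)%R -> qpoch a q n <> 0.
Proof.
  intros Hq Ha H; destruct (qpoch_lower a q Hq Ha) as [c [Hc Hl]].
  specialize (Hl n); rewrite H, Cmod_0 in Hl; lra.
Qed.

Lemma qpoch_inf_nz (a q : C) : (Cmod q < 1)%R -> (Cmod a < 1)%R -> qpoch_inf a q <> 0.
Proof.
  intros Hq Ha H; destruct (qpoch_lower a q Hq Ha) as [c [Hc Hl]].
  destruct (clim_qpoch a q Hq c Hc) as [N HN].
  specialize (HN N (Nat.le_refl N)); specialize (Hl N).
  rewrite H in HN; replace (qpoch a q N - 0) with (qpoch a q N) in HN by ring; lra.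
Qed.

(** * The reciprocals [1 / (q; q)_n] *)

(* Extending by [0] to negative [n] makes every sum below a sum over all integers. *)
Definition ipoch (q : C) (n : Z) : C :=
  if (n <? 0)%Z then 0 else / qpoch q q (Z.to_nat n).

Lemma ipoch_neg (q : C) (n : Z) : (n < 0)%Z -> ipoch q n = 0.
Proof. intros H; unfold ipoch; destruct (Z.ltb_spec n 0); [reflexivity|lia]. Qed.

Lemma ipoch_0 (q : C) : ipoch q 0 = 1.
Proof. unfold ipoch; simpl; field; exact C1_nz. Qed.

Lemma ipoch_nat (q : C) (n : nat) : ipoch q (Z.of_nat n) = / qpoch q q n.
Proof.
  unfold ipoch; rewrite Nat2Z.id; destruct (Z.ltb_spec (Z.of_nat n) 0); [lia|reflexivity].
Qed.

(** Valid at every integer: at n = 0 the factor on the left and the value at -1 both vanish. All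
    recurrences below come from this rule, with no boundary terms. *)
Lemma ipoch_rec (q : C) (n : Z) : (Cmod q < 1)%R ->
  (1 - zpow q n) * ipoch q n = ipoch q (n - 1).
Proof.
  intros Hq; destruct (Z_lt_le_dec n 0) as [H|H].
  { rewrite !ipoch_neg by lia; ring. }
  destruct (Z.eq_dec n 0) as [->|Hn].
  { rewrite zpow_0_r, (ipoch_neg q (0 - 1)) by lia; ring. }
  replace n with (Z.of_nat (S (Z.to_nat (n - 1)))) at 1 2 by lia.
  replace (n - 1)%Z with (Z.of_nat (Z.to_nat (n - 1))) at 3 by lia.
  rewrite zpow_nat, !ipoch_nat, qpoch_S.
  generalize (Z.to_nat (n - 1)); intros m.
  pose proof (qpoch_nz q q m Hq Hq).
  pose proof (qpoch_nz q q (S m) Hq Hq) as H1; rewrite qpoch_S in H1.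
  assert (1 - q * q ^ m <> 0) by (intros E; apply H1; rewrite E; ring).
  rewrite Cpow_S; field; auto.
Qed.

Lemma ipoch_bound (q : C) : (Cmod q < 1)%R -> exists B, forall n, (Cmod (ipoch q n) <= B)%R.
Proof.
  intros Hq; destruct (qpoch_lower q q Hq Hq) as [c [Hc Hl]].
  exists (/ c)%R; intros n; unfold ipoch; destruct (n <? 0)%Z.
  - rewrite Cmod_0; left; apply Rinv_0_lt_compat, Hc.
  - rewrite Cmod_inv by (apply qpoch_nz; exact Hq); apply Rinv_le_contravar; auto.
Qed.

Lemma clim_inv (u : nat -> C) (l : C) (c : R) : (0 < c)%R -> (forall n, (c <= Cmod (u n))%R) ->
  l <> 0 -> clim u l -> clim (fun n => / u n) (/ l).
Proof.
  intros Hc Hl Hlz H eps He.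
  pose proof (proj1 (Cmod_gt_0 l) Hlz) as Hl0.
  destruct (H (eps * (c * Cmod l))%R) as [N HN]; [repeat apply Rmult_lt_0_compat; lra|].
  exists N; intros n Hn; specialize (HN n Hn); specialize (Hl n).
  assert (Hu : u n <> 0) by (apply Cmod_gt_0; lra).
  replace (/ u n - / l) with (- ((u n - l) * / (u n * l))) by (field; auto).
  rewrite Cmod_opp, Cmod_mult, Cmod_inv, Cmod_mult by (apply Cmult_neq_0; auto).
  apply Rmult_lt_reg_r with (Cmod (u n) * Cmod l)%R; [apply Rmult_lt_0_compat; lra|].
  rewrite Rmult_assoc, Rinv_l, Rmult_1_r by (apply Rgt_not_eq, Rmult_lt_0_compat; lra).
  apply Rlt_le_trans with (1 := HN); apply Rmult_le_compat_l; [lra|].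
  apply Rmult_le_compat_r; lra.
Qed.

Lemma clim_ipoch (q : C) : (Cmod q < 1)%R ->
  clim (fun n => ipoch q (Z.of_nat n)) (/ qpoch_inf q q).
Proof.
  intros Hq; destruct (qpoch_lower q q Hq Hq) as [c [Hc Hl]].
  apply clim_ext with (fun n => / qpoch q q n); [intros n; rewrite ipoch_nat; reflexivity|].
  apply clim_inv with c; auto using qpoch_inf_nz, clim_qpoch.
Qed.

Lemma tsum_shift (f : Z -> C) (a : Z) : summable f -> tsum (fun s => f (s + a)%Z) = tsum f.
Proof.
  apply (tsum_bij (fun s => s + a)%Z (fun s => s - a)%Z); intros; lia.
Qed.

Lemma summable_shift (f : Z -> C) (a : Z) : summable f -> summable (fun s => f (s + a)%Z).
Proof. apply (summable_inj (fun s => s + a)%Z); intros; lia. Qed.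

Definition tri (n : Z) : Z := (n * (n - 1) / 2)%Z.

(** Removes the integer division, so that identities between exponents fall to [lia] once their
    monomials are normalised. *)
Lemma tri_spec (n : Z) : (2 * tri n = n * (n - 1))%Z.
Proof.
  unfold tri; symmetry; apply Z_div_exact_2; [lia|].
  rewrite Zmod_even, Z.even_mul, Z.even_sub; simpl; destruct (Z.even n); reflexivity.
Qed.

Lemma Cmod_mult_le (a b : C) (A B : R) :
  (Cmod a <= A)%R -> (Cmod b <= B)%R -> (Cmod (a * b) <= A * B)%R.
Proof. intros Ha Hb; rewrite Cmod_mult; apply Rmult_le_compat; auto using Cmod_ge_0. Qed.

(** * Cauchy's identity *)

Section Theta.

Variable q : C.
Hypothesis q_nz : q <> 0.
Hypothesis q_lt : (Cmod q < 1)%R.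

Lemma zpow_eq (a b c : Z) : (a = b + c)%Z -> zpow q a = zpow q b * zpow q c.
Proof using q_nz. intros ->; apply zpow_add, q_nz. Qed.

Lemma ipoch_pair_bound : exists B, forall m n, (Cmod (ipoch q m * ipoch q n) <= B)%R.
Proof using q_lt.
  destruct (ipoch_bound q q_lt) as [B HB]; exists (B * B)%R; intros m n; apply Cmod_mult_le; auto.
Qed.

Lemma summable_cauchy (m : Z) :
  summable (fun s => zpow q (s * s + m * s) * (ipoch q s * ipoch q (s + m))).
Proof using q_nz q_lt.
  destruct ipoch_pair_bound as [B HB].
  apply (summable_zpow1 q q_nz q_lt _ ((Z.abs m + 1) * (Z.abs m + 1)) _ B); [|auto].
  intros s; nia.
Qed.

Definition cauchy_sum (m : Z) : C :=
  tsum (fun s => zpow q (s * s + m * s) * (ipoch q s * ipoch q (s + m))).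

(** Both sides are sums of q^(s^2+ms) / ((q;q)_s (q;q)_(s+m+1)). On the right the last sum is first
    shifted by one, which turns it into [tsum g]; [ipoch_rec] then brings every term to these two
    denominators. *)
Lemma cauchy_sum_rec (m : Z) :
  cauchy_sum m + zpow q (m + 1) * cauchy_sum (m + 1)
  = cauchy_sum (m + 1) + zpow q (m + 1) * cauchy_sum (m + 2).
Proof using q_nz q_lt.
  unfold cauchy_sum.
  pose proof (summable_cauchy m) as S0; pose proof (summable_cauchy (m + 1)) as S1.
  pose proof (summable_cauchy (m + 2)) as S2.
  set (g := fun s => zpow q (s * s + m * s) * (ipoch q (s - 1) * ipoch q (s + m + 1))).
  assert (Hg : tsum g = zpow q (m + 1) * tsum (fun s => zpow q (s * s + (m + 2) * s) *
                                              (ipoch q s * ipoch q (s + (m + 2))))).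
  { rewrite <- tsum_scal by exact S2.
    assert (Sg : summable g).
    { destruct ipoch_pair_bound as [B HB].
      apply (summable_zpow1 q q_nz q_lt _ ((Z.abs m + 1) * (Z.abs m + 1)) _ B); [|auto].
      intros s; nia. }
    rewrite <- (tsum_shift g 1 Sg); apply tsum_ext; intros s; unfold g.
    rewrite (zpow_eq ((s + 1) * (s + 1) + m * (s + 1)) (m + 1) (s * s + (m + 2) * s)) by ring.
    replace (s + 1 - 1)%Z with s by ring.
    replace (s + 1 + m + 1)%Z with (s + (m + 2))%Z by ring; ring. }
  rewrite <- Hg, <- tsum_scal, <- tsum_plus by auto using summable_scal.
  rewrite <- tsum_plus.
  - apply tsum_ext; intros s; unfold g.
    rewrite <- (ipoch_rec q s q_lt).
    replace (s + m + 1)%Z with (s + (m + 1))%Z by ring.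
    replace (s + m)%Z with ((s + (m + 1)) - 1)%Z by ring.
    rewrite <- (ipoch_rec q (s + (m + 1)) q_lt).
    rewrite (zpow_eq (s * s + (m + 1) * s) (s * s + m * s) s) by ring.
    rewrite (zpow_eq (s + (m + 1)) s (m + 1)) by ring; ring.
  - exact S1.
  - destruct ipoch_pair_bound as [B HB].
    apply (summable_zpow1 q q_nz q_lt _ ((Z.abs m + 1) * (Z.abs m + 1)) _ B); [|auto].
    intros s; nia.
Qed.

(** For s >= 1 the exponent s^2 + ns is at least n + s, so only the term s = 0 survives, and it is
    1/(q;q)_n. *)
Lemma clim_cauchy_sum : clim (fun n => cauchy_sum (Z.of_nat n)) (/ qpoch_inf q q).
Proof using q_nz q_lt.
  destruct ipoch_pair_bound as [B HB].
  unfold cauchy_sum.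
  apply clim_tsum_head with (g := fun s => zpow q (Z.abs s) * B) (r := Cmod q).
  - pose proof (Cmod_ge_0 q); lra.
  - apply (summable_zpow1 q q_nz q_lt Z.abs 0 (fun _ => RtoC B) (Rabs B)).
    + intros; lia.
    + intros; rewrite Cmod_R; lra.
  - intros n k Hk; destruct (Z_lt_le_dec k 0) as [H|H].
    + rewrite (ipoch_neg q k H).
      replace (_ * (0 * _)) with (RtoC 0) by ring; rewrite Cmod_0.
      apply Rmult_le_pos; [apply pow_le|]; apply Cmod_ge_0.
    + rewrite <- Cmod_pow, <- zpow_nat, <- Cmod_mult, (Cmult_assoc (zpow q (Z.of_nat n))), <- zpow_add by exact q_nz.
      rewrite !Cmod_mult; apply Rmult_le_compat; try apply Rmult_le_pos; auto using Cmod_ge_0.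
      * apply Cmod_zpow_le; auto; nia.
      * rewrite <- Cmod_mult; apply Rle_trans with (1 := HB _ _); rewrite Cmod_R; apply Rle_abs.
  - apply clim_ext with (fun n => ipoch q (Z.of_nat n)); [|apply clim_ipoch, q_lt].
    intros n; rewrite ipoch_0.
    replace (0 * 0 + Z.of_nat n * 0)%Z with 0%Z by ring; rewrite zpow_0_r, Z.add_0_l; ring.
Qed.

(* By the recurrence [d m = cauchy_sum m - cauchy_sum (m + 1)] satisfies
   [d m = - q ^ (m + 1) d (m + 1)], and [d m] tends to [0]. *)
Lemma cauchy_sum_eq (m : Z) : cauchy_sum m = / qpoch_inf q q.
Proof using q_nz q_lt.
  set (d := fun m => cauchy_sum m - cauchy_sum (m + 1)).
  assert (Hd : forall m, d m = - (zpow q (m + 1) * d (m + 1)%Z)).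
  { intros k; unfold d; pose proof (cauchy_sum_rec k) as H.
    replace (k + 1 + 1)%Z with (k + 2)%Z by ring.
    replace (cauchy_sum k) with (cauchy_sum k + zpow q (k + 1) * cauchy_sum (k + 1)
      - zpow q (k + 1) * cauchy_sum (k + 1)) by ring; rewrite H; ring. }
  assert (Hlim : clim (fun n => d (Z.of_nat n)) 0).
  { unfold d; set (l := / qpoch_inf q q); replace (RtoC 0) with (l + -1 * l) by ring.
    apply clim_ext with (fun n => cauchy_sum (Z.of_nat n) + -1 * cauchy_sum (Z.of_nat (n + 1))).
    - intros n; rewrite Nat2Z.inj_add; simpl Z.of_nat; ring.
    - apply clim_plus; [|apply clim_scal]; [apply clim_cauchy_sum|].
      apply (clim_subseq (fun n => cauchy_sum (Z.of_nat n)) l (fun n => n + 1)%nat);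
        [intros; lia|apply clim_cauchy_sum]. }
  assert (H0 : forall n : nat, d (Z.of_nat n) = 0).
  { intros n; apply eq_of_Cmod_small; intros eps He.
    (* At nonnegative indices the recurrence multiplies by a factor of modulus at most 1, so |d|
       cannot decrease as the index grows; since it tends to 0, it is 0 throughout. *)
    assert (Hmono : forall k : nat, (Cmod (d (Z.of_nat n)) <= Cmod (d (Z.of_nat (n + k))))%R).
    { induction k as [|k IH]; [rewrite Nat.add_0_r; lra|].
      apply Rle_trans with (1 := IH); rewrite Hd, Cmod_opp, Cmod_mult.
      replace (Z.of_nat (n + k) + 1)%Z with (Z.of_nat (n + S k)) by lia.
      rewrite zpow_nat, Cmod_pow.
      assert (Cmod q ^ (n + S k) <= 1)%R.
      { rewrite <- (pow1 (n + S k)); apply pow_incr; pose proof (Cmod_ge_0 q); lra. }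
      pose proof (Cmod_ge_0 (d (Z.of_nat (n + S k)))); nra. }
    destruct (Hlim eps He) as [N HN]; specialize (HN (n + N)%nat ltac:(lia)).
    specialize (Hmono N).
    replace (d (Z.of_nat n) - 0) with (d (Z.of_nat n)) by ring.
    replace (d (Z.of_nat (n + N)) - 0) with (d (Z.of_nat (n + N))) in HN by ring; lra. }
  (* Negative indices need no estimate: the recurrence expresses each value through the next one. *)
  assert (Hneg : forall n : nat, d (- Z.of_nat n)%Z = 0).
  { induction n as [|n IH]; [exact (H0 O)|].
    rewrite Hd; replace (- Z.of_nat (S n) + 1)%Z with (- Z.of_nat n)%Z by lia; rewrite IH; ring. }
  assert (Hall : forall m, cauchy_sum (m + 1) = cauchy_sum m).
  { intros k.
    assert (Hk : d k = 0).
    { destruct (Z_le_gt_dec 0 k).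
      - rewrite <- (Z2Nat.id k) by lia; apply H0.
      - replace k with (- Z.of_nat (Z.to_nat (- k)))%Z by lia; apply Hneg. }
    unfold d in Hk; replace (cauchy_sum (k + 1)) with
      (cauchy_sum k - (cauchy_sum k - cauchy_sum (k + 1))) by ring; rewrite Hk; ring. }
  assert (Hc : forall m, cauchy_sum m = cauchy_sum 0).
  { apply Z.bi_induction; [intros x y E; rewrite E; reflexivity|reflexivity|].
    intros k; rewrite <- Z.add_1_r, Hall; reflexivity. }
  apply clim_unique with (fun n => cauchy_sum (Z.of_nat n)); [|apply clim_cauchy_sum].
  apply clim_ext with (fun _ => cauchy_sum m); [|apply clim_const].
  intros n; rewrite Hc; symmetry; apply Hc.
Qed.

(** * Euler's product and the Jacobi triple product *)

(** In both directions |z^k| grows at most like |q|^(-K|k|), which the quadratic exponent [tri k]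
    absorbs. *)
Lemma summable_theta_coef (z : C) (c : Z -> C) (B : R) : z <> 0 ->
  (forall n, (Cmod (c n) <= B)%R) -> summable (fun k => zpow q (tri k) * (zpow z k * c k)).
Proof using q_nz q_lt.
  intros Hz Hc.
  destruct (Cmod_zpow_base_bound q z q_nz q_lt Hz) as [K [HK Hb]].
  apply summable_le with (fun k => zpow q (tri k - K * Z.abs k) * c k) 1%R; [lra| |].
  - intros k; unfold Z.sub; rewrite zpow_add, !Cmod_mult by exact q_nz.
    rewrite Rmult_1_l, Rmult_assoc; apply Rmult_le_compat_l; [apply Cmod_ge_0|].
    apply Rmult_le_compat_r; [apply Cmod_ge_0|apply Hb].
  - apply (summable_zpow1 q q_nz q_lt _ ((K + 2) * (K + 2)) _ B); [|auto].
    intros n; pose proof (tri_spec n); nia.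
Qed.

Lemma summable_theta (z : C) : z <> 0 -> summable (fun k => zpow q (tri k) * zpow z k).
Proof using q_nz q_lt.
  intros Hz; apply summable_ext with (fun k => zpow q (tri k) * (zpow z k * 1)).
  - intros k; ring.
  - apply summable_theta_coef with 1%R; auto; intros _; rewrite Cmod_1; lra.
Qed.

Definition euler_sum (z : C) : C := tsum (fun k => zpow q (tri k) * (zpow z k * ipoch q k)).

Lemma summable_euler (z : C) : z <> 0 ->
  summable (fun k => zpow q (tri k) * (zpow z k * ipoch q k)).
Proof using q_nz q_lt.
  intros Hz; destruct (ipoch_bound q q_lt) as [B HB]; apply summable_theta_coef with B; auto.
Qed.

(** Subtracting the series at zq from the one at z inserts 1 - q^k, which lowers the index of
    [ipoch]; a shift by one then extracts the factor z. *)
Lemma euler_sum_rec (z : C) : z <> 0 -> euler_sum z = (1 + z) * euler_sum (z * q).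
Proof using q_nz q_lt.
  intros Hz; assert (Hzq : z * q <> 0) by (apply Cmult_neq_0; auto).
  pose proof (summable_euler _ Hz) as S0; pose proof (summable_euler _ Hzq) as S1.
  destruct (ipoch_bound q q_lt) as [B HB].
  set (g := fun k => zpow q (tri k) * (zpow z k * ipoch q (k - 1))).
  assert (Sg : summable g) by (apply summable_theta_coef with B; auto).
  assert (Hg : tsum g = z * euler_sum (z * q)).
  { unfold euler_sum; rewrite <- tsum_scal, <- (tsum_shift g 1 Sg) by exact S1.
    apply tsum_ext; intros k; unfold g.
    rewrite zpow_mult_base, (zpow_eq (tri (k + 1)) (tri k) k), zpow_add, zpow_1_r by
      (auto; pose proof (tri_spec k); pose proof (tri_spec (k + 1)); lia).
    replace (k + 1 - 1)%Z with k by ring; ring. }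
  rewrite Cmult_plus_distr_r, <- Hg, Cmult_1_l; unfold euler_sum.
  rewrite <- tsum_plus by assumption; apply tsum_ext; intros k; unfold g.
  rewrite <- (ipoch_rec q k q_lt), zpow_mult_base by auto; ring.
Qed.

Lemma euler_sum_eq (z : C) : z <> 0 -> euler_sum z = qpoch_inf (- z) q.
Proof using q_nz q_lt.
  intros Hz; destruct (ipoch_bound q q_lt) as [B HB].
  assert (Hzn : forall n, z * q ^ n <> 0) by (intros n; apply Cmult_neq_0; auto using Cpow_nz).
  assert (HE : forall n, euler_sum z = qpoch (- z) q n * euler_sum (z * q ^ n)).
  { induction n as [|n IH].
    - simpl; rewrite Cmult_1_r; ring.
    - rewrite IH, euler_sum_rec, qpoch_S, Cpow_S by auto.
      replace (z * q ^ n * q) with (z * (q * q ^ n)) by ring; ring. }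
  assert (Hl : clim (fun n => euler_sum (z * q ^ n)) 1).
  { unfold euler_sum.
    (* Since (z/q)^k q^k = z^k, the dominating series is Euler's series at [z] itself. At z q^n its
       terms acquire q^(nk), of modulus at most |q|^n for k >= 1. *)
    apply clim_tsum_head with
      (g := fun k => zpow q (tri k) * (zpow (z / q) k * (zpow q k * ipoch q k))) (r := Cmod q).
    - pose proof (Cmod_ge_0 q); lra.
    - apply summable_ext with (fun k => zpow q (tri k) * (zpow z k * ipoch q k));
        [|apply summable_euler, Hz].
      intros k; replace z with (z / q * q) at 1 by (field; auto).
      rewrite zpow_mult_base; [ring| |exact q_nz].
      intros E; apply Hz; replace z with (z / q * q) by (field; auto); rewrite E; ring.
    - intros n k Hk; destruct (Z_lt_le_dec k 0) as [H|H].
      + rewrite (ipoch_neg q k H).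
        replace (_ * (_ * 0)) with (RtoC 0) by ring; rewrite Cmod_0.
        apply Rmult_le_pos; [apply pow_le|]; apply Cmod_ge_0.
      + replace (zpow (z / q) k * (zpow q k * ipoch q k)) with (zpow z k * ipoch q k).
        2:{ replace z with (z / q * q) at 1 by (field; auto).
          rewrite zpow_mult_base; [ring| |exact q_nz].
          intros E; apply Hz; replace z with (z / q * q) by (field; auto); rewrite E; ring. }
        rewrite zpow_mult_base, zpow_Cpow by auto using Cpow_nz.
        rewrite !Cmod_mult.
        assert (Cmod (zpow q (Z.of_nat n * k)) <= Cmod q ^ n)%R.
        { rewrite <- Cmod_pow, <- zpow_nat; apply Cmod_zpow_le; auto; nia. }
        pose proof (Cmod_ge_0 (zpow q (tri k))); pose proof (Cmod_ge_0 (zpow z k)).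
        pose proof (Cmod_ge_0 (ipoch q k)).
        assert (0 <= Cmod (zpow q (tri k)) * (Cmod (zpow z k) * Cmod (ipoch q k)))%R
          by (repeat apply Rmult_le_pos; assumption).
        nra.
    - apply clim_ext with (fun _ => 1); [|apply clim_const].
      intros n; change (tri 0) with 0%Z; rewrite !zpow_0_r, ipoch_0; ring. }
  apply clim_unique with (fun _ : nat => euler_sum z); [apply clim_const|].
  apply clim_ext with (fun n => qpoch (- z) q n * euler_sum (z * q ^ n)); [auto|].
  replace (qpoch_inf (- z) q) with (qpoch_inf (- z) q * 1) by ring.
  apply clim_mult; [apply clim_qpoch, q_lt|exact Hl].
Qed.

(** Multiply Euler's series at z and at q/z and collect the pairs of indices (j + n, j). The
    exponent splits as tri(n) + j^2 + nj, so the coefficient of z^n is q^(tri n) times Cauchy's sum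
    of order n, which does not depend on n. *)
Theorem jacobi_triple_product (z : C) : z <> 0 ->
  tsum (fun n => zpow q (tri n) * zpow z n)
  = qpoch_inf (- z) q * qpoch_inf (- (q / z)) q * qpoch_inf q q.
Proof using q_nz q_lt.
  intros Hz.
  assert (Hqz : q / z <> 0).
  { intros E; apply q_nz; replace q with (q / z * z) by (field; auto); rewrite E; ring. }
  rewrite <- !euler_sum_eq by assumption; unfold euler_sum.
  set (theta := tsum (fun n => zpow q (tri n) * zpow z n)).
  pose proof (summable_euler z Hz) as S0; pose proof (summable_euler _ Hqz) as S1.
  rewrite <- (tsum_mul _ _ S0 S1).
  set (f := fun p : Z * Z => _); assert (Sf : summable f) by exact (summable_mul _ _ S0 S1).
  set (e := fun p : Z * Z => (snd p + fst p, snd p)%Z).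
  assert (Se : summable (fun p => f (e p))).
  { apply summable_inj; auto; intros [? ?] [? ?] E; unfold e in E; simpl in E.
    injection E; intros; f_equal; lia. }
  rewrite <- (tsum_bij e (fun p => (fst p - snd p, snd p)%Z) f);
    [|intros [a b]; unfold e; simpl; f_equal; lia|intros [a b]; unfold e; simpl; f_equal; lia|exact Sf].
  rewrite tsum_fubini by exact Se.
  rewrite (tsum_ext _ (fun n => / qpoch_inf q q * (zpow q (tri n) * zpow z n))).
  - rewrite tsum_scal by (apply summable_theta, Hz); fold theta.
    field; apply qpoch_inf_nz; assumption.
  - intros n; rewrite <- (cauchy_sum_eq n), Cmult_comm; unfold cauchy_sum.
    rewrite <- tsum_scal by apply summable_cauchy.
    apply tsum_ext; intros j; unfold f, e; simpl.
    unfold Cdiv; rewrite zpow_mult_base, zpow_add by (auto; intros E; apply Hqz; unfold Cdiv; rewrite E; ring).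
    assert (Hi : zpow z j * zpow (/ z) j = 1).
    { rewrite <- zpow_mult_base by (auto; intros E; apply Hqz; unfold Cdiv; rewrite E; ring).
      replace (z * / z) with (RtoC 1) by (field; auto); apply zpow_1_l. }
    transitivity (zpow q (tri (j + n)) * zpow q (tri j) * zpow q j * (zpow z j * zpow (/ z) j)
      * zpow z n * (ipoch q j * ipoch q (j + n))); [ring|].
    rewrite Hi, <- !zpow_add by exact q_nz.
    rewrite (zpow_eq (tri (j + n) + tri j + j) (tri n) (j * j + n * j)); [ring|].
    pose proof (tri_spec n); pose proof (tri_spec j); pose proof (tri_spec (j + n)); lia.
Qed.

End Theta.

(** * Sums over residue classes, point masses and reflections *)

Lemma has_sum_support {T U : Type} (e : U -> T) (d : T -> U) (p : T -> bool) (f : T -> C) (s : C) :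
  (forall u, d (e u) = u) -> (forall u, p (e u) = true) -> (forall t, p t = true -> e (d t) = t) ->
  (forall t, p t = false -> f t = 0) ->
  has_sum (fun u => f (e u)) s -> has_sum f s.
Proof.
  intros Hd Hp He Hf H eps Heps; destruct (H eps Heps) as [F0 HF0].
  exists (map e F0); intros F HF Hi.
  assert (E : lsum f F = lsum (fun u => f (e u)) (map d (filter p F))).
  { rewrite lsum_map; clear HF Hi; induction F as [|a F IH]; simpl; [reflexivity|].
    destruct (p a) eqn:Ep; simpl.
    - rewrite IH, He by exact Ep; reflexivity.
    - rewrite IH, Hf by exact Ep; ring. }
  rewrite E; apply HF0.
  - apply NoDup_filter with (f := p) in HF; clear - HF He.
    assert (Hall : forall t, In t (filter p F) -> p t = true) by (intros t Ht; apply filter_In in Ht; tauto).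
    induction HF as [|a l Ha Hl IH]; simpl; [constructor|].
    constructor; [|apply IH; intros t Ht; apply Hall; right; exact Ht].
    intros Hin; apply in_map_iff in Hin; destruct Hin as [t [Et Ht]].
    apply Ha; rewrite <- (He a), <- Et, He; auto with datatypes.
  - intros u Hu; apply in_map_iff; exists (e u); split; [apply Hd|].
    apply filter_In; split; [apply Hi, in_map, Hu|apply Hp].
Qed.

Lemma tsum_split2 (f : Z -> C) : summable f ->
  tsum f = tsum (fun s => f (2 * s)%Z) + tsum (fun s => f (2 * s + 1)%Z).
Proof.
  intros Hf; apply tsum_eq.
  assert (H : forall r, (0 <= r < 2)%Z ->
    has_sum (fun k => if (k mod 2 =? r)%Z then f k else RtoC 0) (tsum (fun s => f (2 * s + r)%Z))).
  { intros r Hr.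
    apply has_sum_support with (fun s => 2 * s + r)%Z (fun k => k / 2)%Z (fun k => (k mod 2 =? r)%Z).
    - intros u; Z.div_mod_to_equations; lia.
    - intros u; apply Z.eqb_eq; Z.div_mod_to_equations; lia.
    - intros t Ht; apply Z.eqb_eq in Ht; Z.div_mod_to_equations; lia.
    - intros t Ht; rewrite Ht; reflexivity.
    - apply has_sum_ext with (fun s => f (2 * s + r)%Z).
      + intros s; destruct (Z.eqb_spec ((2 * s + r) mod 2) r) as [|n]; [reflexivity|].
        exfalso; apply n; Z.div_mod_to_equations; lia.
      + apply tsum_spec, (summable_inj (fun s => 2 * s + r)%Z); [intros; lia|exact Hf]. }
  rewrite (tsum_ext (fun s => f (2 * s)%Z) (fun s => f (2 * s + 0)%Z))
    by (intros s; rewrite Z.add_0_r; reflexivity).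
  apply has_sum_ext with (fun k => (if (k mod 2 =? 0)%Z then f k else RtoC 0)
    + (if (k mod 2 =? 1)%Z then f k else RtoC 0)).
  - intros k; assert (k mod 2 = 0 \/ k mod 2 = 1)%Z as [E|E] by (Z.div_mod_to_equations; lia);
      rewrite E; simpl; ring.
  - apply has_sum_plus; apply H; lia.
Qed.

Lemma tsum_split3 (f : Z -> C) : summable f ->
  tsum f = tsum (fun s => f (3 * s)%Z) + tsum (fun s => f (3 * s + 1)%Z)
           + tsum (fun s => f (3 * s + 2)%Z).
Proof.
  intros Hf; apply tsum_eq.
  assert (H : forall r, (0 <= r < 3)%Z ->
    has_sum (fun k => if (k mod 3 =? r)%Z then f k else RtoC 0) (tsum (fun s => f (3 * s + r)%Z))).
  { intros r Hr.
    apply has_sum_support with (fun s => 3 * s + r)%Z (fun k => k / 3)%Z (fun k => (k mod 3 =? r)%Z).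
    - intros u; Z.div_mod_to_equations; lia.
    - intros u; apply Z.eqb_eq; Z.div_mod_to_equations; lia.
    - intros t Ht; apply Z.eqb_eq in Ht; Z.div_mod_to_equations; lia.
    - intros t Ht; rewrite Ht; reflexivity.
    - apply has_sum_ext with (fun s => f (3 * s + r)%Z).
      + intros s; destruct (Z.eqb_spec ((3 * s + r) mod 3) r) as [|n]; [reflexivity|].
        exfalso; apply n; Z.div_mod_to_equations; lia.
      + apply tsum_spec, (summable_inj (fun s => 3 * s + r)%Z); [intros; lia|exact Hf]. }
  rewrite (tsum_ext (fun s => f (3 * s)%Z) (fun s => f (3 * s + 0)%Z))
    by (intros s; rewrite Z.add_0_r; reflexivity).
  apply has_sum_ext with (fun k => (if (k mod 3 =? 0)%Z then f k else RtoC 0)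
    + (if (k mod 3 =? 1)%Z then f k else RtoC 0) + (if (k mod 3 =? 2)%Z then f k else RtoC 0)).
  - intros k; assert (k mod 3 = 0 \/ k mod 3 = 1 \/ k mod 3 = 2)%Z as [E|[E|E]]
      by (Z.div_mod_to_equations; lia); rewrite E; simpl; ring.
  - repeat apply has_sum_plus; apply H; lia.
Qed.

Lemma tsum_0 {T : Type} (f : T -> C) : (forall t, f t = 0) -> tsum f = 0.
Proof. intros H; apply tsum_eq, has_sum_ext with (fun _ => 0); [auto|apply has_sum_0]. Qed.

Lemma tsum_delta (f : Z -> C) (t0 : Z) : (forall t, t <> t0 -> f t = 0) -> tsum f = f t0.
Proof.
  intros H; apply tsum_eq.
  apply has_sum_ext with (fun t => if (t =? t0)%Z then f t0 else RtoC 0); [|apply has_sum_delta].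
  intros t; destruct (Z.eqb_spec t t0); [subst; reflexivity|symmetry; auto].
Qed.

Lemma tsum_reflect (f : Z -> C) (a : Z) : summable f -> tsum (fun s => f (a - s)%Z) = tsum f.
Proof. apply (tsum_bij (fun s => a - s)%Z (fun s => a - s)%Z); intros; lia. Qed.

Lemma Cmult_minus_distr_l (a b c : C) : a * (b - c) = a * b - a * c.
Proof. ring. Qed.

Ltac quad j :=
  cbv beta;
  pose proof (Z.square_nonneg j); pose proof (Z.square_nonneg (j + 1));
  pose proof (Z.square_nonneg (j - 1)); pose proof (Z.square_nonneg (j + 2));
  pose proof (Z.square_nonneg (j - 2)); nia.

(** * The convolution expansion of 1/(q;q)_i *)

Section Bailey.

Variable q : C.
Hypothesis q_nz : q <> 0.
Hypothesis q_lt : (Cmod q < 1)%R.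

Notation ip := (ipoch q).
Notation zp := (zpow q).

Lemma one_sub_zpow_nz (n : Z) : (0 < n)%Z -> 1 - zp n <> 0.
Proof using q_lt.
  intros Hn E; replace n with (Z.of_nat (Z.to_nat n)) in E by lia; rewrite zpow_nat in E.
  pose proof (Cmod_Cpow_lt_1 q (Z.to_nat n) q_lt ltac:(lia)) as H.
  replace (q ^ Z.to_nat n) with (RtoC 1) in H.
  - rewrite Cmod_1 in H; lra.
  - replace (q ^ Z.to_nat n) with (1 - (1 - q ^ Z.to_nat n)) by ring; rewrite E; ring.
Qed.

(** The factor with index i - 2k is a coefficient of Euler's series for (-z;q)_inf; 1/(q^2;q^2)_k is
    the coefficient of z^(2k) in 1/(z^2;q^2)_inf. *)
Definition ipoch_conv (i : Z) : C :=
  tsum (fun k => zp (tri (i - 2 * k)) * (ip (i - 2 * k) * ipoch (q ^ 2) k)).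

Lemma sq_lt : (Cmod (q ^ 2) < 1)%R.
Proof using q_lt. apply Cmod_Cpow_lt_1; auto. Qed.

Lemma summable_ipoch_conv (i : Z) :
  summable (fun k => zp (tri (i - 2 * k)) * (ip (i - 2 * k) * ipoch (q ^ 2) k)).
Proof using q_nz q_lt.
  destruct (ipoch_bound q q_lt) as [B HB]; destruct (ipoch_bound (q ^ 2) sq_lt) as [D HD].
  apply (summable_zpow1 q q_nz q_lt _ (4 * (Z.abs i + 1) * (Z.abs i + 1)) _ (B * D)).
  - intros k; pose proof (tri_spec (i - 2 * k)); nia.
  - intros k; apply Cmod_mult_le; auto.
Qed.

(** Write 1 - q^i = (1 - q^(2k)) + q^(2k) (1 - q^(i-2k)). The first part lowers k and gives the
    value at i - 2; the second lowers i - 2k and gives the value at i - 1. Applying [ipoch_rec]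
    twice shows that 1/(q;q)_i obeys the same recurrence. *)
Lemma ipoch_conv_rec (i : Z) :
  (1 - zp i) * ipoch_conv i = zp (i - 1) * ipoch_conv (i - 1) + ipoch_conv (i - 2).
Proof using q_nz q_lt.
  unfold ipoch_conv.
  pose proof (summable_ipoch_conv i) as S0; pose proof (summable_ipoch_conv (i - 1)) as S1.
  pose proof (summable_ipoch_conv (i - 2)) as S2.
  pose proof (summable_shift _ (-1) S2) as S3.
  rewrite <- (tsum_shift _ (-1) S2), <- !tsum_scal, <- tsum_plus by auto using summable_scal.
  apply tsum_ext; intros k.
  replace (i - 2 - 2 * (k + -1))%Z with (i - 2 * k)%Z by ring.
  replace (k + -1)%Z with (k - 1)%Z by ring.
  rewrite <- (ipoch_rec (q ^ 2) k sq_lt), zpow_Cpow by exact q_nz; simpl Z.of_nat.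
  replace (i - 1 - 2 * k)%Z with ((i - 2 * k) - 1)%Z by ring.
  rewrite <- (ipoch_rec q (i - 2 * k) q_lt).
  set (m := (i - 2 * k)%Z).
  rewrite (zpow_eq q q_nz i (2 * k) m) by (unfold m; ring).
  rewrite (zpow_eq q q_nz (i - 1) (2 * k) (m - 1)) by (unfold m; ring).
  rewrite (zpow_eq q q_nz (tri m) (m - 1) (tri (m - 1)))
    by (pose proof (tri_spec m); pose proof (tri_spec (m - 1)); lia).
  ring.
Qed.

(* The coefficient of [z^i] in [1 / (z; q)_inf = (-z; q)_inf / (z^2; q^2)_inf]. *)
Lemma ipoch_conv_eq (i : Z) : ip i = ipoch_conv i.
Proof using q_nz q_lt.
  assert (Hn : forall i, (i < 0)%Z -> ipoch_conv i = 0).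
  { intros j Hj; apply tsum_0; intros k.
    destruct (Z_lt_le_dec k 0).
    - rewrite (ipoch_neg (q ^ 2) k) by assumption; ring.
    - rewrite (ipoch_neg q (j - 2 * k)) by lia; ring. }
  assert (H : forall (n : nat) i, (i < Z.of_nat n)%Z -> ip i = ipoch_conv i).
  { induction n as [|n IH]; intros j Hj.
    - rewrite Hn, ipoch_neg by lia; reflexivity.
    - destruct (Z.eq_dec j (Z.of_nat n)) as [->|]; [|apply IH; lia].
      destruct n as [|n].
      + unfold ipoch_conv; rewrite (tsum_delta _ 0).
        * simpl; change (tri 0) with 0%Z; rewrite zpow_0_r, !ipoch_0; ring.
        * intros k Hk; destruct (Z_lt_le_dec k 0).
          -- rewrite (ipoch_neg (q ^ 2) k) by assumption; ring.
          -- rewrite (ipoch_neg q (Z.of_nat 0 - 2 * k)) by lia; ring.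
      + set (j := Z.of_nat (S n)) in *.
        pose proof (one_sub_zpow_nz j ltac:(unfold j; lia)) as Hnz.
        pose proof (ipoch_conv_rec j) as Hr.
        rewrite <- (IH (j - 1)%Z), <- (IH (j - 2)%Z) in Hr by (unfold j; lia).
        pose proof (ipoch_rec q j q_lt) as R1; pose proof (ipoch_rec q (j - 1) q_lt) as R2.
        replace (j - 1 - 1)%Z with (j - 2)%Z in R2 by ring.
        rewrite <- R2, <- R1 in Hr.
        apply (f_equal (fun w => / (1 - zp j) * w)) in Hr.
        replace (/ (1 - zp j) * ((1 - zp j) * ipoch_conv j)) with (ipoch_conv j) in Hr
          by (field; exact Hnz).
        rewrite Hr; field; exact Hnz. }
  apply (H (Z.to_nat (i + 1))); lia.
Qed.

(** * Bailey pairs relative to [1 / (q; q)_(2n)] and [1 / (q; q)_(2n+1)] *)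

Lemma summable_pair_sum (e u v : Z -> Z) (K : Z) : (forall j, (Z.abs j - K <= e j)%Z) ->
  summable (fun j => zp (e j) * (ip (u j) * ip (v j))).
Proof using q_nz q_lt.
  intros He; destruct (ipoch_pair_bound q q_lt) as [B HB].
  apply (summable_zpow1 q q_nz q_lt e K _ B); auto.
Qed.

(** The q-Pascal rule, from 1 - q^N = (1 - q^u) + q^u (1 - q^v) with u + v = N. In terms of paths it
    removes the last step. *)
Lemma pair_sum_pascal (e u v : Z -> Z) (N K L : Z) :
  (forall j, (u j + v j = N)%Z) ->
  (forall j, (Z.abs j - K <= e j)%Z) -> (forall j, (Z.abs j - L <= e j + u j)%Z) ->
  (1 - zp N) * tsum (fun j => zp (e j) * (ip (u j) * ip (v j)))
  = tsum (fun j => zp (e j) * (ip (u j - 1) * ip (v j)))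
    + tsum (fun j => zp (e j + u j) * (ip (u j) * ip (v j - 1))).
Proof using q_nz q_lt.
  intros HN He Hu.
  rewrite <- tsum_scal by (apply summable_pair_sum with K, He).
  rewrite <- (tsum_plus _ _ (summable_pair_sum e (fun j => u j - 1)%Z v K He)
    (summable_pair_sum (fun j => e j + u j)%Z u (fun j => v j - 1)%Z L Hu)).
  apply tsum_ext; intros j.
  rewrite <- !(ipoch_rec q _ q_lt), zpow_add by exact q_nz.
  rewrite (zpow_eq q q_nz N (u j) (v j)) by (rewrite HN; reflexivity); ring.
Qed.

(** The q-Pascal rule produces four sums. The two carrying the extra factor q^u are exchanged by j
    -> -j and cancel in the difference: this is the reflection principle at one wall. The other two
    form the odd expression at n - 1. *)
Lemma bailey_even_step (n : Z) :
  (1 - zp (2 * n)) *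
    (tsum (fun j => zp (6*j*j + j) * (ip (n - 3*j) * ip (n + 3*j)))
     - tsum (fun j => zp (6*j*j + 5*j + 1) * (ip (n - 3*j - 1) * ip (n + 3*j + 1))))
  = tsum (fun j => zp (6*j*j + j) * (ip ((n-1) - 3*j) * ip ((n-1) + 1 + 3*j)))
    - tsum (fun j => zp (6*j*j + 5*j + 1) * (ip ((n-1) - 3*j - 1) * ip ((n-1) + 2 + 3*j))).
Proof using q_nz q_lt.
  pose proof (pair_sum_pascal (fun j => 6*j*j + j)%Z (fun j => n - 3*j)%Z (fun j => n + 3*j)%Z
    (2 * n) 20 (Z.abs n + 20) ltac:(intros; cbv beta; ring) ltac:(intros j; quad j) ltac:(intros j; quad j)) as H1.
  pose proof (pair_sum_pascal (fun j => 6*j*j + 5*j + 1)%Z (fun j => n - 3*j - 1)%Z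
    (fun j => n + 3*j + 1)%Z (2 * n) 20 (Z.abs n + 20) ltac:(intros; cbv beta; ring) ltac:(intros j; quad j)
    ltac:(intros j; quad j)) as H2.
  rewrite Cmult_minus_distr_l, H1, H2.
  rewrite <- (tsum_reflect (fun j => zp (6*j*j + j + (n - 3*j)) * (ip (n - 3*j) * ip (n + 3*j - 1))) 0)
    by (apply summable_pair_sum with (Z.abs n + 20)%Z; intros j; quad j).
  rewrite (tsum_ext (fun s => zp (6 * (0 - s) * (0 - s) + (0 - s) + (n - 3 * (0 - s))) * _)
    (fun j => zp (6*j*j + 5*j + 1 + (n - 3*j - 1)) * (ip (n - 3*j - 1) * ip (n + 3*j + 1 - 1)))).
  2:{ intros s; rewrite (Cmult_comm (ip (n - 3 * s - 1))); do 2 f_equal; [ring|f_equal; ring..]. }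
  rewrite (tsum_ext (fun j => zp (6*j*j + j) * (ip (n - 3*j - 1) * _))
    (fun j => zp (6*j*j + j) * (ip ((n-1) - 3*j) * ip ((n-1) + 1 + 3*j))))
    by (intros j; do 2 f_equal; f_equal; ring).
  rewrite (tsum_ext (fun j => zp (6*j*j + 5*j + 1) * (ip (n - 3*j - 1 - 1) * _))
    (fun j => zp (6*j*j + 5*j + 1) * (ip ((n-1) - 3*j - 1) * ip ((n-1) + 2 + 3*j))))
    by (intros j; do 2 f_equal; f_equal; ring).
  ring.
Qed.

(** Same cancellation at the other wall: [u] and [v] change roles, and the reflection becomes j ->
    -1 - j. *)
Lemma bailey_odd_step (n : Z) :
  (1 - zp (2 * n + 1)) *
    (tsum (fun j => zp (6*j*j + j) * (ip (n - 3*j) * ip (n + 1 + 3*j)))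
     - tsum (fun j => zp (6*j*j + 5*j + 1) * (ip (n - 3*j - 1) * ip (n + 2 + 3*j))))
  = tsum (fun j => zp (6*j*j + j) * (ip (n - 3*j) * ip (n + 3*j)))
     - tsum (fun j => zp (6*j*j + 5*j + 1) * (ip (n - 3*j - 1) * ip (n + 3*j + 1))).
Proof using q_nz q_lt.
  pose proof (pair_sum_pascal (fun j => 6*j*j + j)%Z (fun j => n + 1 + 3*j)%Z (fun j => n - 3*j)%Z
    (2 * n + 1) 20 (Z.abs n + 20) ltac:(intros; cbv beta; ring) ltac:(intros j; quad j) ltac:(intros j; quad j)) as H1.
  pose proof (pair_sum_pascal (fun j => 6*j*j + 5*j + 1)%Z (fun j => n + 2 + 3*j)%Z
    (fun j => n - 3*j - 1)%Z (2 * n + 1) 20 (Z.abs n + 20) ltac:(intros; cbv beta; ring) ltac:(intros j; quad j)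
    ltac:(intros j; quad j)) as H2.
  rewrite Cmult_minus_distr_l.
  rewrite (tsum_ext (fun j => zp (6*j*j + j) * (ip (n - 3*j) * ip (n + 1 + 3*j)))
    (fun j => zp (6*j*j + j) * (ip (n + 1 + 3*j) * ip (n - 3*j)))) by (intros j; ring).
  rewrite (tsum_ext (fun j => zp (6*j*j + 5*j + 1) * (ip (n - 3*j - 1) * ip (n + 2 + 3*j)))
    (fun j => zp (6*j*j + 5*j + 1) * (ip (n + 2 + 3*j) * ip (n - 3*j - 1)))) by (intros j; ring).
  rewrite H1, H2.
  rewrite <- (tsum_reflect
      (fun j => zp (6*j*j + 5*j + 1 + (n + 2 + 3*j)) * (ip (n + 2 + 3*j) * ip (n - 3*j - 1 - 1))) (-1))
    by (apply summable_pair_sum with (Z.abs n + 20)%Z; intros j; quad j).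
  rewrite (tsum_ext (fun s => zp (6 * (-1 - s) * (-1 - s) + _ + _ + _) * _)
    (fun j => zp (6*j*j + j + (n + 1 + 3*j)) * (ip (n + 1 + 3*j) * ip (n - 3*j - 1)))).
  2:{ intros s; rewrite (Cmult_comm (ip (n + 1 + 3 * s))); do 2 f_equal; [ring|f_equal; ring..]. }
  rewrite (tsum_ext (fun j => zp (6*j*j + j) * (ip (n + 1 + 3*j - 1) * _))
    (fun j => zp (6*j*j + j) * (ip (n - 3*j) * ip (n + 3*j)))).
  2:{ intros j; rewrite (Cmult_comm (ip (n - 3 * j))); do 2 f_equal; f_equal; ring. }
  rewrite (tsum_ext (fun j => zp (6*j*j + 5*j + 1) * (ip (n + 2 + 3*j - 1) * _))
    (fun j => zp (6*j*j + 5*j + 1) * (ip (n - 3*j - 1) * ip (n + 3*j + 1)))).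
  2:{ intros j; rewrite (Cmult_comm (ip (n - 3 * j - 1))); do 2 f_equal; f_equal; ring. }
  ring.
Qed.

(** For n >= 0, multiplying by (q;q)_(2n) or (q;q)_(2n+1) gives an alternating sum of q-binomial
    coefficients equal to 1: a strip of width one contains a single path of each length. The two
    parities feed each other in one induction. *)
Lemma bailey_even_odd (n : Z) :
  ip (2 * n)
    = tsum (fun j => zp (6*j*j + j) * (ip (n - 3*j) * ip (n + 3*j)))
      - tsum (fun j => zp (6*j*j + 5*j + 1) * (ip (n - 3*j - 1) * ip (n + 3*j + 1)))
  /\ ip (2 * n + 1)
    = tsum (fun j => zp (6*j*j + j) * (ip (n - 3*j) * ip (n + 1 + 3*j)))
      - tsum (fun j => zp (6*j*j + 5*j + 1) * (ip (n - 3*j - 1) * ip (n + 2 + 3*j))).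
Proof using q_nz q_lt.
  assert (Hz : forall a b : Z, (a + b < 0)%Z -> ip a * ip b = 0).
  { intros a b H; destruct (Z_lt_le_dec a 0).
    - rewrite (ipoch_neg q a) by assumption; ring.
    - rewrite (ipoch_neg q b) by lia; ring. }
  assert (Hodd : forall n, ip (2 * n)
    = tsum (fun j => zp (6*j*j + j) * (ip (n - 3*j) * ip (n + 3*j)))
      - tsum (fun j => zp (6*j*j + 5*j + 1) * (ip (n - 3*j - 1) * ip (n + 3*j + 1))) ->
    (0 <= n)%Z -> ip (2 * n + 1)
    = tsum (fun j => zp (6*j*j + j) * (ip (n - 3*j) * ip (n + 1 + 3*j)))
      - tsum (fun j => zp (6*j*j + 5*j + 1) * (ip (n - 3*j - 1) * ip (n + 2 + 3*j)))).
  { intros k Hk Hk0; pose proof (bailey_odd_step k) as H; rewrite <- Hk in H.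
    pose proof (ipoch_rec q (2 * k + 1) q_lt) as R.
    replace (2 * k + 1 - 1)%Z with (2 * k)%Z in R by ring; rewrite <- R in H.
    pose proof (one_sub_zpow_nz (2 * k + 1) ltac:(lia)) as Hnz.
    apply (f_equal (fun w => / (1 - zp (2 * k + 1)) * w)) in H.
    rewrite !Cmult_assoc, Cinv_l, !Cmult_1_l in H by exact Hnz; symmetry; exact H. }
  destruct (Z_lt_le_dec n 0) as [Hn|Hn].
  { split; rewrite ipoch_neg by lia; rewrite !tsum_0;
      first [ring | intros j; rewrite Hz by lia; ring]. }
  assert (Heven : ip (2 * n)
    = tsum (fun j => zp (6*j*j + j) * (ip (n - 3*j) * ip (n + 3*j)))
      - tsum (fun j => zp (6*j*j + 5*j + 1) * (ip (n - 3*j - 1) * ip (n + 3*j + 1)))).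
  { pattern n; apply natlike_ind; [| |exact Hn].
    (* At n = 0 the two indices of each product are opposite, so only j = 0 in the first sum
       survives. *)
    - rewrite (tsum_delta _ 0), tsum_0.
      + simpl; rewrite zpow_0_r, ipoch_0; ring.
      + intros j; destruct (Z_lt_le_dec j 0).
        * rewrite (ipoch_neg q (0 + 3 * j + 1)) by lia; ring.
        * rewrite (ipoch_neg q (0 - 3 * j - 1)) by lia; ring.
      + intros j Hj; destruct (Z_lt_le_dec j 0).
        * rewrite (ipoch_neg q (0 + 3 * j)) by lia; ring.
        * rewrite (ipoch_neg q (0 - 3 * j)) by lia; ring.
    - intros k Hk IH; apply Hodd in IH; [|exact Hk].
      pose proof (bailey_even_step (Z.succ k)) as H.
      replace (Z.succ k - 1)%Z with k in H by lia; rewrite <- IH in H.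
      pose proof (ipoch_rec q (2 * Z.succ k) q_lt) as R.
      replace (2 * Z.succ k - 1)%Z with (2 * k + 1)%Z in R by lia; rewrite <- R in H.
      pose proof (one_sub_zpow_nz (2 * Z.succ k) ltac:(lia)) as Hnz.
      apply (f_equal (fun w => / (1 - zp (2 * Z.succ k)) * w)) in H.
      rewrite !Cmult_assoc, Cinv_l, !Cmult_1_l in H by exact Hnz; symmetry; exact H. }
  split; [exact Heven|apply Hodd; assumption].
Qed.

(** Raises the parameter from p = 0 to p = 1, as the weight q^(n^2+n) requires. Rewriting one
    denominator in each sum by [ipoch_rec] leaves the same remainder [R], which cancels in the
    difference. *)
Lemma bailey_even_shift (n : Z) :
  ip (2 * n)
    = tsum (fun j => zp (6*j*j - j) * (ip (n - 3*j) * ip (n + 1 + 3*j)))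
      - tsum (fun j => zp (6*j*j + 5*j + 1) * (ip (n - 3*j) * ip (n + 1 + 3*j))).
Proof using q_nz q_lt.
  destruct (bailey_even_odd n) as [-> _].
  set (R := fun j : Z => zp (6*j*j + 2*j + n + 1) * (ip (n - 3*j) * ip (n + 1 + 3*j))).
  assert (SR : summable R) by (apply summable_pair_sum with (Z.abs n + 20)%Z; intros j; quad j).
  assert (E1 : tsum (fun j => zp (6*j*j + j) * (ip (n - 3*j) * ip (n + 3*j)))
    = tsum (fun j => zp (6*j*j - j) * (ip (n - 3*j) * ip (n + 1 + 3*j))) - tsum R).
  { rewrite <- (tsum_reflect _ 0) by (apply summable_pair_sum with 20%Z; intros j; quad j).
    unfold Cminus; replace (- tsum R) with (-1 * tsum R) by ring.
    rewrite <- tsum_scal, <- tsum_plus by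
      (try apply summable_scal; try exact SR; apply summable_pair_sum with 20%Z; intros j; quad j).
    apply tsum_ext; intros j; unfold R.
    replace (n - 3 * (0 - j))%Z with ((n + 1 + 3 * j) - 1)%Z by ring.
    rewrite <- (ipoch_rec q (n + 1 + 3 * j) q_lt).
    replace (n + 3 * (0 - j))%Z with (n - 3 * j)%Z by ring.
    replace (6 * (0 - j) * (0 - j) + (0 - j))%Z with (6 * j * j - j)%Z by ring.
    rewrite (zpow_eq q q_nz (6*j*j + 2*j + n + 1) (6*j*j - j) (n + 1 + 3*j)) by ring; ring. }
  assert (E2 : tsum (fun j => zp (6*j*j + 5*j + 1) * (ip (n - 3*j - 1) * ip (n + 3*j + 1)))
    = tsum (fun j => zp (6*j*j + 5*j + 1) * (ip (n - 3*j) * ip (n + 1 + 3*j))) - tsum R).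
  { unfold Cminus; replace (- tsum R) with (-1 * tsum R) by ring.
    rewrite <- tsum_scal, <- tsum_plus by
      (try apply summable_scal; try exact SR; apply summable_pair_sum with 20%Z; intros j; quad j).
    apply tsum_ext; intros j; unfold R.
    rewrite <- (ipoch_rec q (n - 3 * j) q_lt).
    replace (n + 3 * j + 1)%Z with (n + 1 + 3 * j)%Z by ring.
    rewrite (zpow_eq q q_nz (6*j*j + 2*j + n + 1) (6*j*j + 5*j + 1) (n - 3*j)) by ring; ring. }
  rewrite E1, E2; ring.
Qed.

(** The same device raises the parameter from p = 1 to p = 2; here the second sum is the one to be
    reflected. *)
Lemma bailey_odd_shift (n : Z) :
  ip (2 * n + 1)
    = tsum (fun j => zp (6*j*j + j) * (ip (n - 3*j) * ip (n + 2 + 3*j)))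
      - tsum (fun j => zp (6*j*j + 7*j + 2) * (ip (n - 3*j) * ip (n + 2 + 3*j))).
Proof using q_nz q_lt.
  destruct (bailey_even_odd n) as [_ ->].
  set (R := fun j : Z => zp (6*j*j + 4*j + n + 2) * (ip (n - 3*j) * ip (n + 2 + 3*j))).
  assert (SR : summable R) by (apply summable_pair_sum with (Z.abs n + 20)%Z; intros j; quad j).
  assert (E1 : tsum (fun j => zp (6*j*j + j) * (ip (n - 3*j) * ip (n + 1 + 3*j)))
    = tsum (fun j => zp (6*j*j + j) * (ip (n - 3*j) * ip (n + 2 + 3*j))) - tsum R).
  { unfold Cminus; replace (- tsum R) with (-1 * tsum R) by ring.
    rewrite <- tsum_scal, <- tsum_plus by
      (try apply summable_scal; try exact SR; apply summable_pair_sum with 20%Z; intros j; quad j).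
    apply tsum_ext; intros j; unfold R.
    replace (n + 1 + 3 * j)%Z with ((n + 2 + 3 * j) - 1)%Z by ring.
    rewrite <- (ipoch_rec q (n + 2 + 3 * j) q_lt).
    rewrite (zpow_eq q q_nz (6*j*j + 4*j + n + 2) (6*j*j + j) (n + 2 + 3*j)) by ring; ring. }
  assert (E2 : tsum (fun j => zp (6*j*j + 5*j + 1) * (ip (n - 3*j - 1) * ip (n + 2 + 3*j)))
    = tsum (fun j => zp (6*j*j + 7*j + 2) * (ip (n - 3*j) * ip (n + 2 + 3*j))) - tsum R).
  { rewrite <- (tsum_reflect _ (-1)) by (apply summable_pair_sum with 20%Z; intros j; quad j).
    unfold Cminus; replace (- tsum R) with (-1 * tsum R) by ring.
    rewrite <- tsum_scal, <- tsum_plus by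
      (try apply summable_scal; try exact SR; apply summable_pair_sum with 20%Z; intros j; quad j).
    apply tsum_ext; intros j; unfold R.
    replace (n - 3 * (-1 - j) - 1)%Z with (n + 2 + 3 * j)%Z by ring.
    replace (n + 2 + 3 * (-1 - j))%Z with (n - 3 * j - 1)%Z by ring.
    replace (6 * (-1 - j) * (-1 - j) + 5 * (-1 - j) + 1)%Z with (6*j*j + 7*j + 2)%Z by ring.
    rewrite <- (ipoch_rec q (n - 3 * j) q_lt).
    rewrite (zpow_eq q q_nz (6*j*j + 4*j + n + 2) (6*j*j + 7*j + 2) (n - 3*j)) by ring; ring. }
  rewrite E1, E2; ring.
Qed.

(** * The limiting case of Bailey's lemma *)

Lemma summable_bailey (g a : Z -> Z) (p K : Z) : (forall j, (Z.abs j - K <= g j)%Z) ->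
  summable (fun t : Z * Z => zp (fst t * fst t + p * fst t + g (snd t)) *
    (ip (fst t - a (snd t)) * ip (fst t + p + a (snd t)))).
Proof using q_nz q_lt.
  intros Hg; destruct (ipoch_pair_bound q q_lt) as [B HB].
  apply (summable_zpow2 q q_nz q_lt _ (K + (Z.abs p + 1) * (Z.abs p + 1)) _ B); [|auto].
  intros m n; simpl; specialize (Hg n); nia.
Qed.

(** After exchanging the sums and shifting n by a(j), the inner sum over n is q^(a^2+pa) times
    Cauchy's sum of order 2a + p, hence the constant 1/(q;q)_inf. *)
Lemma bailey_sum (g a : Z -> Z) (p K : Z) : (forall j, (Z.abs j - K <= g j)%Z) ->
  tsum (fun n => zp (n * n + p * n)
    * tsum (fun j => zp (g j) * (ip (n - a j) * ip (n + p + a j))))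
  = / qpoch_inf q q * tsum (fun j => zp (g j + a j * a j + p * a j)).
Proof using q_nz q_lt.
  intros Hg; pose proof (summable_bailey g a p K Hg) as Sf.
  set (f := fun t : Z * Z => _) in Sf.
  rewrite (tsum_ext _ (fun n => tsum (fun j => f (n, j)))).
  2:{ intros n; rewrite <- tsum_scal by (apply summable_pair_sum with K, Hg).
      apply tsum_ext; intros j; unfold f; simpl; rewrite (zpow_add q _ (g j)) by exact q_nz; ring. }
  rewrite tsum_swap by exact Sf.
  rewrite (tsum_ext _ (fun j => / qpoch_inf q q * zp (g j + a j * a j + p * a j))).
  - apply tsum_scal.
    apply summable_ext with (fun j => zp (g j + a j * a j + p * a j) * 1); [intros; ring|].
    apply (summable_zpow1 q q_nz q_lt _ (K + p * p) _ 1).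
    + intros j; specialize (Hg j); nia.
    + intros; rewrite Cmod_1; lra.
  - intros j; rewrite <- (cauchy_sum_eq q q_nz q_lt (2 * a j + p)), Cmult_comm.
    unfold cauchy_sum; rewrite <- tsum_scal by (apply summable_cauchy; assumption).
    assert (Sj : summable (fun n => f (n, j))).
    { apply (summable_inj (fun n : Z => (n, j))); [intros; congruence|exact Sf]. }
    rewrite <- (tsum_shift _ (a j) Sj); apply tsum_ext; intros s; unfold f; cbn [fst snd].
    replace (s + a j - a j)%Z with s by ring.
    replace (s + a j + p + a j)%Z with (s + (2 * a j + p))%Z by ring.
    rewrite (zpow_eq q q_nz ((s + a j) * (s + a j) + p * (s + a j) + g j)
      (g j + a j * a j + p * a j) (s * s + (2 * a j + p) * s)) by ring; ring.
Qed.

(** Products of two reciprocals are bounded by one constant, so the inner sum is bounded uniformly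
    in n and the weight q^(n^2+pn) alone ensures convergence. *)
Lemma summable_bailey_inner (g a : Z -> Z) (p K : Z) : (forall j, (Z.abs j - K <= g j)%Z) ->
  summable (fun n => zp (n * n + p * n)
    * tsum (fun j => zp (g j) * (ip (n - a j) * ip (n + p + a j)))).
Proof using q_nz q_lt.
  intros Hg.
  destruct (ipoch_pair_bound q q_lt) as [B HB].
  assert (S0 : summable (fun j => zp (g j) * RtoC B)).
  { apply (summable_zpow1 q q_nz q_lt g K _ (Rabs B)); auto; intros; rewrite Cmod_R; lra. }
  destruct S0 as [M HM].
  apply (summable_zpow1 q q_nz q_lt _ ((Z.abs p + 1) * (Z.abs p + 1)) _ M); [intros j; quad j|].
  intros n; apply Cmod_has_sum_le with (1 := tsum_spec _ (summable_pair_sum g _ _ K Hg)).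
  intros F HF; apply Rle_trans with (2 := HM F HF); clear HF.
  induction F as [|j F IH]; simpl; [lra|].
  apply Rplus_le_compat; [|exact IH].
  rewrite !Cmod_mult; apply Rmult_le_compat_l; [apply Cmod_ge_0|].
  rewrite <- Cmod_mult, Cmod_R; apply Rle_trans with (1 := HB _ _), Rle_abs.
Qed.

Lemma bailey_sum_sub (g h a b : Z -> Z) (p K : Z) (c : Z -> C) :
  (forall j, (Z.abs j - K <= g j)%Z) -> (forall j, (Z.abs j - K <= h j)%Z) ->
  (forall n, c n = tsum (fun j => zp (g j) * (ip (n - a j) * ip (n + p + a j)))
                   - tsum (fun j => zp (h j) * (ip (n - b j) * ip (n + p + b j)))) ->
  tsum (fun n => zp (n * n + p * n) * c n)
  = / qpoch_inf q q * (tsum (fun j => zp (g j + a j * a j + p * a j))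
                       - tsum (fun j => zp (h j + b j * b j + p * b j))).
Proof using q_nz q_lt.
  intros Hg Hh Hc; rewrite Cmult_minus_distr_l, <- !(bailey_sum _ _ _ K) by assumption.
  unfold Cminus; set (T := tsum (fun n => _ * tsum (fun j => zp (h j) * _))).
  replace (- T) with (-1 * T) by ring; unfold T.
  rewrite <- tsum_scal, <- tsum_plus by
    (try apply summable_scal; apply summable_bailey_inner with K; assumption).
  apply tsum_ext; intros n; rewrite Hc; ring.
Qed.

(* The numbers are those of Slater's list of Rogers-Ramanujan type identities. *)
Lemma slater_79_theta :
  tsum (fun n => zp (n * n) * ip (2 * n))
  = / qpoch_inf q q * (tsum (fun s => zp (15*s*s + s)) - tsum (fun s => zp (15*s*s + 11*s + 2))).
Proof using q_nz q_lt.
  rewrite (tsum_ext _ (fun n => zp (n * n + 0 * n) * ip (2 * n)))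
    by (intros n; do 2 f_equal; ring).
  rewrite (bailey_sum_sub (fun j => 6*j*j + j)%Z (fun j => 6*j*j + 5*j + 1)%Z
    (fun j => 3*j)%Z (fun j => 3*j + 1)%Z 0 20); try (intros j; quad j).
  - f_equal; f_equal; apply tsum_ext; intros j; cbv beta; f_equal; ring.
  - intros n; rewrite (proj1 (bailey_even_odd n)).
    f_equal; apply tsum_ext; intros j; cbv beta; do 2 f_equal; f_equal; ring.
Qed.

Lemma slater_94_theta :
  tsum (fun n => zp (n * n + n) * ip (2 * n + 1))
  = / qpoch_inf q q * (tsum (fun s => zp (15*s*s + 4*s)) - tsum (fun s => zp (15*s*s + 14*s + 3))).
Proof using q_nz q_lt.
  rewrite (tsum_ext _ (fun n => zp (n * n + 1 * n) * ip (2 * n + 1)))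
    by (intros n; do 2 f_equal; ring).
  rewrite (bailey_sum_sub (fun j => 6*j*j + j)%Z (fun j => 6*j*j + 5*j + 1)%Z
    (fun j => 3*j)%Z (fun j => 3*j + 1)%Z 1 20); try (intros j; quad j).
  - f_equal; f_equal; apply tsum_ext; intros j; cbv beta; f_equal; ring.
  - intros n; rewrite (proj2 (bailey_even_odd n)).
    f_equal; apply tsum_ext; intros j; cbv beta; do 2 f_equal; f_equal; ring.
Qed.

Lemma slater_99_theta :
  tsum (fun n => zp (n * n + n) * ip (2 * n))
  = / qpoch_inf q q * (tsum (fun s => zp (15*s*s + 2*s)) - tsum (fun s => zp (15*s*s + 8*s + 1))).
Proof using q_nz q_lt.
  rewrite (tsum_ext _ (fun n => zp (n * n + 1 * n) * ip (2 * n)))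
    by (intros n; do 2 f_equal; ring).
  rewrite (bailey_sum_sub (fun j => 6*j*j - j)%Z (fun j => 6*j*j + 5*j + 1)%Z
    (fun j => 3*j)%Z (fun j => 3*j)%Z 1 20); try (intros j; quad j).
  - f_equal; f_equal; apply tsum_ext; intros j; cbv beta; f_equal; ring.
  - exact bailey_even_shift.
Qed.

Lemma slater_96_theta :
  tsum (fun n => zp (n * n + 2 * n) * ip (2 * n + 1))
  = / qpoch_inf q q * (tsum (fun s => zp (15*s*s + 7*s)) - tsum (fun s => zp (15*s*s + 17*s + 4))).
Proof using q_nz q_lt.
  rewrite (bailey_sum_sub (fun j => 6*j*j + j)%Z (fun j => 6*j*j + 7*j + 2)%Z
    (fun j => 3*j)%Z (fun j => 3*j)%Z 2 20); try (intros j; quad j).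
  - f_equal; f_equal; [apply tsum_ext; intros j; f_equal; ring|].
    (* The pair yields the exponent 15j^2 + 13j + 2; the reflection j -> -1 - j brings it to the
       form given by the quintuple product at k = 4. *)
    assert (S0 : summable (fun j => zp (15*j*j + 17*j + 4) * 1)).
    { apply (summable_zpow1 q q_nz q_lt _ 20 _ 1); [intros j; quad j|intros; rewrite Cmod_1; lra]. }
    apply summable_ext with (g := fun j => zp (15*j*j + 17*j + 4)) in S0; [|intros; ring].
    rewrite <- (tsum_reflect _ (-1) S0); apply tsum_ext; intros j; cbv beta; f_equal; ring.
  - exact bailey_odd_shift.
Qed.

End Bailey.

(** * Identities between infinite products *)

Fixpoint cprod (f : nat -> C) (n : nat) : C :=
  match n with
  | O => 1
  | S m => cprod f m * f m
  end.

Lemma cprod_ext (f g : nat -> C) (n : nat) : (forall i, f i = g i) -> cprod f n = cprod g n.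
Proof. intros E; induction n as [|n IH]; simpl; [|rewrite IH, E]; reflexivity. Qed.

Lemma cprod_mult (f g : nat -> C) (n : nat) :
  cprod (fun i => f i * g i) n = cprod f n * cprod g n.
Proof. induction n as [|n IH]; simpl; [ring|rewrite IH; ring]. Qed.

Lemma clim_cprod (u : nat -> nat -> C) (l : nat -> C) (d : nat) :
  (forall i, clim (u i) (l i)) -> clim (fun n => cprod (fun i => u i n) d) (cprod l d).
Proof.
  intros H; induction d as [|d IH]; simpl; [apply clim_const|apply clim_mult; auto].
Qed.

Lemma qpoch_add (a q : C) (m n : nat) : qpoch a q (m + n) = qpoch a q m * qpoch (a * q ^ m) q n.
Proof.
  induction n as [|n IH]; [rewrite Nat.add_0_r; simpl; ring|].
  rewrite Nat.add_succ_r, !qpoch_S, IH, Cpow_add_r; ring.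
Qed.

Lemma qpoch_cprod (a q : C) (n : nat) : qpoch a q n = cprod (fun i => 1 - a * q ^ i) n.
Proof. induction n as [|n IH]; [reflexivity|rewrite qpoch_S, IH; reflexivity]. Qed.

Lemma qpoch_split (a q : C) (d n : nat) :
  qpoch a q (n * d) = cprod (fun i => qpoch (a * q ^ i) (q ^ d) n) d.
Proof.
  induction n as [|n IH].
  - simpl; induction d as [|d IH]; simpl; [|rewrite <- IH]; ring.
  - simpl Nat.mul; rewrite Nat.add_comm, qpoch_add, IH, (qpoch_cprod _ q d), <- cprod_mult.
    apply cprod_ext; intros i; rewrite qpoch_S, <- Cpow_mult_r, (Nat.mul_comm d n); ring.
Qed.

Lemma qpoch_inf_split (a q : C) (d : nat) : (Cmod q < 1)%R -> (0 < d)%nat ->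
  qpoch_inf a q = cprod (fun i => qpoch_inf (a * q ^ i) (q ^ d)) d.
Proof.
  intros Hq Hd; apply clim_unique with (fun n => qpoch a q (n * d)).
  - apply (clim_subseq (qpoch a q) _ (fun n => n * d)%nat); [intros; nia|apply clim_qpoch, Hq].
  - apply clim_ext with (fun n => cprod (fun i => qpoch (a * q ^ i) (q ^ d) n) d).
    + intros n; symmetry; apply qpoch_split.
    + apply clim_cprod; intros i; apply clim_qpoch, Cmod_Cpow_lt_1; assumption.
Qed.

Lemma qpoch_inf_split_pow (x : C) (a b d : nat) : (Cmod x < 1)%R -> (0 < b)%nat -> (0 < d)%nat ->
  qpoch_inf (x ^ a) (x ^ b) = cprod (fun i => qpoch_inf (x ^ (a + b * i)) (x ^ (b * d))) d.
Proof.
  intros Hx Hb Hd; rewrite (qpoch_inf_split _ _ d) by auto using Cmod_Cpow_lt_1.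
  apply cprod_ext; intros i; rewrite Cpow_add_r, !Cpow_mult_r; reflexivity.
Qed.

Lemma qpoch_inf_sqr (a q : C) : (Cmod q < 1)%R ->
  qpoch_inf a q * qpoch_inf (- a) q = qpoch_inf (a * a) (q ^ 2).
Proof.
  intros Hq; apply clim_unique with (fun n => qpoch a q n * qpoch (- a) q n).
  - apply clim_mult; apply clim_qpoch, Hq.
  - apply clim_ext with (qpoch (a * a) (q ^ 2)).
    + induction n as [|n IH]; [simpl; ring|].
      rewrite !qpoch_S, IH, <- Cpow_mult_r, Nat.mul_comm, Cpow_mult_r; simpl; ring.
    + apply clim_qpoch, Cmod_Cpow_lt_1; auto.
Qed.

Lemma qpoch_inf_head (a q : C) : (Cmod q < 1)%R ->
  qpoch_inf a q = (1 - a) * qpoch_inf (a * q) q.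
Proof.
  intros Hq; apply clim_unique with (fun n => qpoch a q (S n)).
  - apply (clim_subseq (qpoch a q) _ S); [intros; lia|apply clim_qpoch, Hq].
  - apply clim_ext with (fun n => (1 - a) * qpoch (a * q) q n); [|apply clim_scal, clim_qpoch, Hq].
    intros n; change (S n) with (1 + n)%nat; rewrite qpoch_add, qpoch_S; cbn [qpoch].
    replace (a * q ^ 1) with (a * q) by ring; ring.
Qed.

(** * The quintuple product *)

(** Multiplying each row sum by a unit phase [u a] makes it equal to its modulus. A finite sum of
    these moduli is then itself the value of an unconditional sum over [B], bounded by the constant
    [M] of the double family. The phase is 1 where the row sum vanishes. *)
Lemma summable_tsum {A B : Type} (f : A * B -> C) :
  summable f -> summable (fun a => tsum (fun b => f (a, b))).
Proof.
  intros Sf; pose proof Sf as [M HM]; exists M; intros F HF.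
  set (H := fun a => tsum (fun b => f (a, b))).
  set (u := fun a => if ceq_dec (H a) 0 then RtoC 1 else Cmod (H a) / H a).
  assert (Hu : forall a, (Cmod (u a) <= 1)%R).
  { intros a; unfold u; destruct (ceq_dec (H a) 0) as [E|E]; [rewrite Cmod_1; lra|].
    rewrite Cmod_div, Cmod_R, Rabs_pos_eq by auto using Cmod_ge_0.
    right; apply Rdiv_diag; intros E0; apply E, Cmod_eq_0, E0. }
  assert (HuH : forall a, u a * H a = Cmod (H a)).
  { intros a; unfold u; destruct (ceq_dec (H a) 0) as [E|E].
    - rewrite E, Cmod_0; ring.
    - field; exact E. }
  assert (Hs : has_sum (fun b => lsum (fun a => u a * f (a, b)) F) (lsum (fun a => u a * H a) F)).
  { apply (has_sum_lsum (fun a b => u a * f (a, b)) (fun a => u a * H a)).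
    intros a; apply has_sum_scal, tsum_spec, summable_pair, Sf. }
  assert (Hle : (Cmod (lsum (fun a => u a * H a)%C F) <= M)%R).
  { apply Cmod_has_sum_le with (1 := Hs); intros G HG.
    apply Rle_trans with (2 := HM _ (NoDup_list_prod F G HF HG)).
    clear -Hu; revert F; induction G as [|b G IH]; intros F; simpl; [apply asum_nonneg|].
    assert (E : asum f (list_prod F (b :: G))
      = (asum (fun a => f (a, b)) F + asum f (list_prod F G))%R).
    { induction F as [|a F IHF]; simpl; [ring|].
      rewrite !asum_app, IHF, asum_map; simpl; ring. }
    rewrite E; apply Rplus_le_compat; [|apply IH].
    apply Rle_trans with (1 := Cmod_lsum _ _); clear -Hu.
    induction F as [|a F IHF]; simpl; [lra|].
    rewrite Cmod_mult; specialize (Hu a); pose proof (Cmod_ge_0 (f (a, b))); nra. }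
  assert (EL : lsum (fun a => u a * H a) F = RtoC (asum H F)).
  { clear -HuH; induction F as [|a F IH]; simpl; [reflexivity|].
    rewrite HuH, IH; symmetry; apply RtoC_plus. }
  rewrite EL, Cmod_R, Rabs_pos_eq in Hle by apply asum_nonneg; exact Hle.
Qed.

Definition sgn (n : Z) : C := zpow (- (1)) n.

Lemma opp_1_nz : - (1) <> 0 :> C.
Proof. intros E; apply C1_nz; replace (RtoC 1) with (- - (1)) by ring; rewrite E; ring. Qed.

Lemma sgn_add (m n : Z) : sgn (m + n) = sgn m * sgn n.
Proof. apply zpow_add, opp_1_nz. Qed.

Lemma sgn_even (n : Z) : sgn (2 * n) = 1.
Proof.
  unfold sgn; rewrite <- zpow_zpow by exact opp_1_nz.
  change 2%Z with (Z.of_nat 2) at 1; rewrite zpow_nat.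
  replace ((- (1)) ^ 2) with (RtoC 1) by (simpl; ring); apply zpow_1_l.
Qed.

Lemma sgn_1 : sgn 1 = - (1).
Proof. apply zpow_1_r. Qed.

Lemma zpow_opp_base (z : C) (n : Z) : z <> 0 -> zpow (- z) n = sgn n * zpow z n.
Proof.
  intros Hz; unfold sgn; rewrite <- zpow_mult_base by (auto using opp_1_nz); f_equal; ring.
Qed.

Lemma Cmod_sgn (n : Z) : Cmod (sgn n) = 1%R.
Proof.
  destruct (Z.Even_or_Odd n) as [[k ->]|[k ->]].
  - rewrite sgn_even; apply Cmod_1.
  - rewrite sgn_add, sgn_even, sgn_1, Cmult_1_l; apply Cmod_m1.
Qed.

Lemma Copp_nz (z : C) : z <> 0 -> - z <> 0.
Proof. intros Hz E; apply Hz; replace z with (- - z) by ring; rewrite E; ring. Qed.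

Section Quintuple.

Variable q : C.
Hypothesis q_nz : q <> 0.
Hypothesis q_lt : (Cmod q < 1)%R.

Notation zp := (zpow q).

Lemma summable_sgn (e : Z -> Z) (K : Z) : (forall n, (Z.abs n - K <= e n)%Z) ->
  summable (fun n => zp (e n) * sgn n).
Proof using q_nz q_lt.
  intros He; apply (summable_zpow1 q q_nz q_lt e K _ 1); auto; intros; rewrite Cmod_sgn; lra.
Qed.

(** Euler's pentagonal number theorem in q^2: the triple product in base q^6 at -q^4 supplies the
    three residue classes of even exponents modulo 6. *)
Lemma pentagonal : tsum (fun n => zp (3 * n * n + n) * sgn n) = qpoch_inf (q ^ 2) (q ^ 2).
Proof using q_nz q_lt.
  assert (H4 : q ^ 4 <> 0) by apply Cpow_nz, q_nz.
  rewrite (tsum_ext _ (fun n => zpow (q ^ 6) (tri n) * zpow (- q ^ 4) n)).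
  - rewrite jacobi_triple_product by
      auto using Copp_nz, Cpow_nz, Cmod_Cpow_lt_1 with arith.
    rewrite (qpoch_inf_split_pow q 2 2 3) by (auto; lia); cbn [cprod Nat.mul Nat.add].
    replace (- - q ^ 4) with (q ^ 4) by ring.
    replace (- (q ^ 6 / - q ^ 4)) with (q ^ 2) by (field; auto).
    ring.
  - intros n; rewrite zpow_opp_base, !zpow_Cpow by assumption.
    rewrite (zpow_eq q q_nz (3 * n * n + n) (Z.of_nat 6 * tri n) (Z.of_nat 4 * n))
      by (pose proof (tri_spec n); lia); ring.
Qed.

(** The involution n -> 1 - n preserves the exponent and flips the sign. *)
Lemma alternating_vanish : tsum (fun n => zp (3 * n * n - 3 * n) * sgn n) = 0.
Proof using q_nz q_lt.
  set (f := fun n => zp (3 * n * n - 3 * n) * sgn n).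
  assert (Sf : summable f) by (apply summable_sgn with 20%Z; intros j; quad j).
  assert (E : tsum f = -1 * tsum f).
  { rewrite <- (tsum_reflect f 1 Sf) at 1; rewrite <- tsum_scal by exact Sf.
    apply tsum_ext; intros n; unfold f.
    replace (1 - n)%Z with (1 + (n + 2 * (- n)))%Z at 4 by ring.
    rewrite !sgn_add, sgn_even, sgn_1.
    replace (3 * (1 - n) * (1 - n) - 3 * (1 - n))%Z with (3 * n * n - 3 * n)%Z by ring; ring. }
  assert (H2 : 2 * tsum f = 0).
  { replace (2 * tsum f) with (tsum f - -1 * tsum f) by ring; rewrite <- E; ring. }
  replace (tsum f) with (/ 2 * (2 * tsum f)); [rewrite H2; ring|].
  field; intros E2; apply RtoC_inj in E2; lra.
Qed.

(* Multiplying two triple products, the coefficient of [z^k] is, after completing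
   the square, a monomial times one of three theta constants according to [k mod 3]:
   two of them are pentagonal and the third vanishes. *)
Theorem quintuple_product (z : C) : z <> 0 ->
  tsum (fun s => zp (tri s + s * s) * zpow z (3 * s))
  - tsum (fun s => zp (tri s + s * s + s) * zpow z (3 * s + 1))
  = qpoch_inf q q * qpoch_inf z q * qpoch_inf (q / z) q
    * qpoch_inf (q * (z * z)) (q ^ 2) * qpoch_inf (q / (z * z)) (q ^ 2).
Proof using q_nz q_lt.
  intros Hz.
  assert (Hmz : - z <> 0) by auto using Copp_nz.
  assert (Hzz : z * z <> 0) by auto using Cmult_neq_0.
  assert (Hqzz : q * (z * z) <> 0) by auto using Cmult_neq_0.
  assert (Hmq : - (q * (z * z)) <> 0) by auto using Copp_nz.
  assert (Hq2 : q ^ 2 <> 0) by auto using Cpow_nz.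
  assert (Hq2l : (Cmod (q ^ 2) < 1)%R) by (apply Cmod_Cpow_lt_1; auto).
  pose proof (jacobi_triple_product q q_nz q_lt (- z) Hmz) as J1.
  pose proof (jacobi_triple_product (q ^ 2) Hq2 Hq2l (- (q * (z * z))) Hmq) as J2.
  pose proof (summable_theta q q_nz q_lt (- z) Hmz) as S1.
  pose proof (summable_theta (q ^ 2) Hq2 Hq2l (- (q * (z * z))) Hmq) as S2.
  pose proof (tsum_mul _ _ S1 S2) as HP; rewrite J1, J2 in HP.
  pose proof (summable_mul _ _ S1 S2) as Sf.
  set (f := fun p : Z * Z => _) in Sf, HP.
  (* The second product contributes z^(2n), so the total power of z is k = m + 2n; (k, n) are the
     new variables. *)
  set (e := fun p : Z * Z => (fst p - 2 * snd p, snd p)%Z).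
  assert (Se : summable (fun p => f (e p))).
  { apply summable_inj; auto; intros [a b] [c d] E; unfold e in E; cbn [fst snd] in E.
    apply pair_equal_spec in E; destruct E; f_equal; lia. }
  rewrite <- (tsum_bij e (fun p => (fst p + 2 * snd p, snd p)%Z) f) in HP;
    [|intros [a b]; unfold e; cbn [fst snd]; f_equal; ring
     |intros [a b]; unfold e; cbn [fst snd]; f_equal; ring|exact Sf].
  rewrite tsum_fubini, tsum_split3 in HP by (exact Se || apply (summable_tsum _ Se)).
  assert (Hf : forall k n, f (e (k, n)) = sgn (k + n) * zpow z k * zp (tri (k - 2 * n) + n * n)).
  { intros k n; unfold f, e; cbn [fst snd].
    rewrite !zpow_opp_base, !zpow_mult_base, zpow_Cpow by assumption.
    rewrite (zpow_eq q q_nz (tri (k - 2 * n) + n * n) (tri (k - 2 * n)) (n * n)) by ring.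
    rewrite (zpow_eq q q_nz (n * n) (Z.of_nat 2 * tri n) n) by (pose proof (tri_spec n); lia).
    replace (k + n)%Z with ((k - 2 * n + n) + 2 * n)%Z by ring.
    rewrite !sgn_add, sgn_even.
    replace (zpow z k) with (zpow z (k - 2 * n) * (zpow z n * zpow z n))
      by (rewrite <- !zpow_add by exact Hz; f_equal; ring).
    ring. }
  set (R := qpoch_inf (q ^ 2) (q ^ 2)).
  (* The exponent of q is 3n^2 + (1 - 2k)n + tri(k). For k = 3s, 3s + 1, 3s + 2 it is centred by
     replacing n with n + s, s - n and n + s respectively. *)
  assert (E0 : forall s, tsum (fun n => f (e (3 * s, n)%Z)) = R * (zp (tri s + s * s) * zpow z (3 * s))).
  { intros s; unfold R; rewrite <- pentagonal, Cmult_comm, <- tsum_scal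
      by (apply summable_sgn with 20%Z; intros j; quad j).
    rewrite <- (tsum_shift (fun n => f (e (3 * s, n)%Z)) s) by apply (summable_pair _ _ Se).
    apply tsum_ext; intros n; rewrite Hf.
    replace (3 * s + (n + s))%Z with (n + 2 * (2 * s))%Z by ring.
    rewrite sgn_add, sgn_even.
    rewrite (zpow_eq q q_nz (tri (3 * s - 2 * (n + s)) + (n + s) * (n + s))
      (tri s + s * s) (3 * n * n + n)); [ring|].
    pose proof (tri_spec s); pose proof (tri_spec (3 * s - 2 * (n + s))); lia. }
  assert (E1 : forall s, tsum (fun n => f (e (3 * s + 1, n)%Z))
    = - R * (zp (tri s + s * s + s) * zpow z (3 * s + 1))).
  { intros s; unfold R.
    assert (Sp : summable (fun n => zp (3 * n * n + n) * sgn n))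
      by (apply summable_sgn with 20%Z; intros j; quad j).
    transitivity ((-1 * (zp (tri s + s * s + s) * zpow z (3 * s + 1)))
      * tsum (fun n => zp (3 * n * n + n) * sgn n)); [|rewrite pentagonal; ring].
    rewrite <- tsum_scal by exact Sp.
    rewrite <- (tsum_reflect (fun n => f (e (3 * s + 1, n)%Z)) s) by apply (summable_pair _ _ Se).
    apply tsum_ext; intros n; rewrite Hf.
    replace (3 * s + 1 + (s - n))%Z with (1 + (n + 2 * (2 * s - n)))%Z by ring.
    rewrite !sgn_add, sgn_even, sgn_1.
    rewrite (zpow_eq q q_nz (tri (3 * s + 1 - 2 * (s - n)) + (s - n) * (s - n))
      (tri s + s * s + s) (3 * n * n + n)); [ring|].
    pose proof (tri_spec s); pose proof (tri_spec (3 * s + 1 - 2 * (s - n))); lia. }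
  assert (E2 : forall s, tsum (fun n => f (e (3 * s + 2, n)%Z)) = 0).
  { intros s.
    transitivity ((zp (tri (s + 2) + s * s) * zpow z (3 * s + 2))
      * tsum (fun n => zp (3 * n * n - 3 * n) * sgn n)); [|rewrite alternating_vanish; ring].
    rewrite <- tsum_scal by (apply summable_sgn with 20%Z; intros j; quad j).
    rewrite <- (tsum_shift (fun n => f (e (3 * s + 2, n)%Z)) s) by apply (summable_pair _ _ Se).
    apply tsum_ext; intros n; rewrite Hf.
    replace (3 * s + 2 + (n + s))%Z with (n + 2 * (2 * s + 1))%Z by ring.
    rewrite sgn_add, sgn_even.
    rewrite (zpow_eq q q_nz (tri (3 * s + 2 - 2 * (n + s)) + (n + s) * (n + s))
      (tri (s + 2) + s * s) (3 * n * n - 3 * n)); [ring|].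
    pose proof (tri_spec (s + 2)); pose proof (tri_spec (3 * s + 2 - 2 * (n + s))); lia. }
  rewrite (tsum_ext _ _ E0), (tsum_ext _ _ E1), (tsum_0 _ E2) in HP.
  assert (HR : R <> 0) by (apply qpoch_inf_nz; assumption).
  (* Since [R] is nonzero, summability of the two theta series follows from that of the row sums,
     with no separate estimate. *)
  assert (Sdiv : forall g, summable (fun s : Z => R * g s) -> summable g).
  { intros g Sg; apply summable_ext with (fun s => / R * (R * g s)).
    - intros s; field; exact HR.
    - apply summable_scal, Sg. }
  pose proof (summable_tsum _ Se) as ST.
  assert (SA : summable (fun s => zp (tri s + s * s) * zpow z (3 * s))).
  { apply Sdiv; refine (summable_ext _ _ E0 (summable_inj (fun s => 3 * s)%Z _ _ ST)); intros; lia. }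
  assert (SB : summable (fun s => zp (tri s + s * s + s) * zpow z (3 * s + 1))).
  { apply Sdiv; apply summable_ext with (fun s => -1 * (- R * (zp (tri s + s * s + s) * zpow z (3 * s + 1)))).
    - intros; ring.
    - apply summable_scal.
      refine (summable_ext _ _ E1 (summable_inj (fun s => 3 * s + 1)%Z _ _ ST)); intros; lia. }
  rewrite (tsum_scal _ _ SA), (tsum_scal _ _ SB) in HP.
  replace (- - z) with z in HP by ring.
  replace (- (q / - z)) with (q / z) in HP by (field; auto).
  replace (- - (q * (z * z))) with (q * (z * z)) in HP by ring.
  replace (- (q ^ 2 / - (q * (z * z)))) with (q / (z * z)) in HP by (field; auto).
  fold R in HP.
  apply (f_equal (fun w => / R * w)) in HP; cbv beta in HP.
  match type of HP with ?l = _ => transitivity l; [field; exact HR|rewrite HP] end.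
  field; exact HR.
Qed.

End Quintuple.

(** * Rogers's identities modulo 20 *)

Section Mod20.

Variable x : C.
Hypothesis x_nz : x <> 0.
Hypothesis x_lt : (Cmod x < 1)%R.

Notation ip := (ipoch x).
Notation zp := (zpow x).

(** The quintuple product in base x^10 at z = x^k. The exponents 10 - k, 10 + 2k and 10 - 2k enter
    through equations to avoid truncated subtraction. *)
Lemma quintuple_mod_20 (k l m n : nat) : (k + l = 10)%nat -> (m = 10 + 2 * k)%nat ->
  (n + 2 * k = 10)%nat ->
  tsum (fun s => zp (15 * s * s + (3 * Z.of_nat k - 5) * s))
  - tsum (fun s => zp (15 * s * s + (3 * Z.of_nat k + 5) * s + Z.of_nat k))
  = qpoch_inf (x ^ 10) (x ^ 10) * qpoch_inf (x ^ k) (x ^ 10) * qpoch_inf (x ^ l) (x ^ 10)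
    * qpoch_inf (x ^ m) (x ^ 20) * qpoch_inf (x ^ n) (x ^ 20).
Proof using x_nz x_lt.
  intros Hl Hm Hn.
  assert (Hk : x ^ k <> 0) by auto using Cpow_nz.
  pose proof (quintuple_product (x ^ 10) (Cpow_nz _ _ x_nz)
    (Cmod_Cpow_lt_1 x 10 x_lt ltac:(lia)) (x ^ k) Hk) as H.
  replace (x ^ 10 / x ^ k) with (x ^ l) in H.
  2:{ rewrite <- Hl, Cpow_add_r; field; exact Hk. }
  replace (x ^ 10 * (x ^ k * x ^ k)) with (x ^ m) in H.
  2:{ rewrite Hm, Cpow_add_r; simpl Nat.mul; rewrite Nat.add_0_r, (Cpow_add_r x k k); reflexivity. }
  replace (x ^ 10 / (x ^ k * x ^ k)) with (x ^ n) in H.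
  2:{ rewrite <- Hn; simpl Nat.mul; rewrite Nat.add_0_r, !Cpow_add_r; field; exact Hk. }
  rewrite <- (Cpow_mult_r x 10 2) in H; change (10 * 2)%nat with 20%nat in H.
  rewrite <- H; f_equal; apply tsum_ext; intros s;
    rewrite !zpow_Cpow, <- zpow_add by exact x_nz; f_equal; pose proof (tri_spec s); lia.
Qed.

Lemma qpoch_mod_20 (a : nat) :
  qpoch_inf (x ^ a) (x ^ 10) = qpoch_inf (x ^ a) (x ^ 20) * qpoch_inf (x ^ (a + 10)) (x ^ 20).
Proof using x_lt.
  rewrite (qpoch_inf_split_pow x a 10 2) by (auto; lia); cbn [cprod Nat.mul Nat.add].
  rewrite Nat.add_0_r; ring.
Qed.

Lemma qpoch_even_mod_20 :
  qpoch_inf (x ^ 2) (x ^ 2) = cprod (fun i => qpoch_inf (x ^ (2 + 2 * i)) (x ^ 20)) 10.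
Proof using x_lt. apply (qpoch_inf_split_pow x 2 2 10); auto; lia. Qed.

Lemma qpoch_odd_even : qpoch_inf x x = qpoch_inf x (x ^ 2) * qpoch_inf (x ^ 2) (x ^ 2).
Proof using x_lt.
  rewrite (qpoch_inf_split x x 2) by (auto; lia); cbn [cprod].
  replace (x * x ^ 0) with x by (simpl; ring).
  replace (x * x ^ 1) with (x ^ 2) by (simpl; ring); ring.
Qed.

Lemma qpoch_sqr_mod_20 (a b : nat) : b = (2 * a)%nat ->
  qpoch_inf (x ^ b) (x ^ 20) = qpoch_inf (x ^ a) (x ^ 10) * qpoch_inf (- x ^ a) (x ^ 10).
Proof using x_lt.
  intros ->; rewrite qpoch_inf_sqr by (apply Cmod_Cpow_lt_1; auto; lia).
  rewrite <- (Cpow_mult_r x 10 2); simpl (10 * 2)%nat; f_equal.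
  simpl Nat.mul; rewrite Nat.add_0_r; apply Cpow_add_r.
Qed.

(** Splitting by the parity of the exponent squares the base -x^5 to x^10; this is how products in
    base -q^30 become comparable with the others. *)
Lemma qpoch_neg_base (a : C) :
  qpoch_inf a (- x ^ 5) = qpoch_inf a (x ^ 10) * qpoch_inf (- (a * x ^ 5)) (x ^ 10).
Proof using x_lt.
  rewrite (qpoch_inf_split a (- x ^ 5) 2); [|rewrite Cmod_opp; apply Cmod_Cpow_lt_1; auto; lia|lia].
  cbn [cprod].
  replace ((- x ^ 5) ^ 2) with (x ^ 10) by ring.
  replace (a * (- x ^ 5) ^ 0) with a by (simpl; ring).
  replace (a * (- x ^ 5) ^ 1) with (- (a * x ^ 5)) by ring; ring.
Qed.

(** Applied with a = (x;x^2)_inf, b = (x^2;x^2)_inf and c the theta difference: it leaves an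
    identity between products with no division. *)
Lemma quotient_eq (s a b c d e : C) :
  s = / (a * b) * c -> c * (d * e) = b -> a <> 0 -> b <> 0 -> d <> 0 -> e <> 0 ->
  s = / (a * (d * e)).
Proof.
  intros -> <- Ha Hb Hd He.
  assert (Hc : c <> 0) by (intros E; apply Hb; rewrite E; ring).
  field; auto.
Qed.

Ltac small := auto; rewrite ?Cmod_opp; first [assumption | apply Cmod_Cpow_lt_1; [assumption|lia]].
Ltac nz := apply qpoch_inf_nz; small.

Lemma slater_79_product : tsum (fun n => zp (n * n) * ip (2 * n))
  = / (qpoch_inf x (x ^ 2) * (qpoch_inf (x ^ 4) (x ^ 20) * qpoch_inf (x ^ 16) (x ^ 20))).
Proof using x_nz x_lt.
  pose proof (slater_79_theta x x_nz x_lt) as H; rewrite qpoch_odd_even in H.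
  pose proof (quintuple_mod_20 2 8 14 6 eq_refl eq_refl eq_refl) as Q.
  apply (quotient_eq _ _ _ _ _ _ H); try nz.
  etransitivity; [apply (f_equal (fun w => w * _)); etransitivity; [|exact Q]|].
  - f_equal; apply tsum_ext; intros s; f_equal; cbn [Z.of_nat Pos.of_succ_nat Pos.succ]; ring.
  - rewrite qpoch_even_mod_20, (qpoch_mod_20 10), (qpoch_mod_20 2), (qpoch_mod_20 8).
    cbn [cprod Nat.mul Nat.add]; ring.
Qed.

Lemma slater_96_product : tsum (fun n => zp (n * n + 2 * n) * ip (2 * n + 1))
  = / (qpoch_inf x (x ^ 2) * (qpoch_inf (x ^ 8) (x ^ 20) * qpoch_inf (x ^ 12) (x ^ 20))).
Proof using x_nz x_lt.
  pose proof (slater_96_theta x x_nz x_lt) as H; rewrite qpoch_odd_even in H.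
  pose proof (quintuple_mod_20 4 6 18 2 eq_refl eq_refl eq_refl) as Q.
  apply (quotient_eq _ _ _ _ _ _ H); try nz.
  etransitivity; [apply (f_equal (fun w => w * _)); etransitivity; [|exact Q]|].
  - f_equal; apply tsum_ext; intros s; f_equal; cbn [Z.of_nat Pos.of_succ_nat Pos.succ]; ring.
  - rewrite qpoch_even_mod_20, (qpoch_mod_20 10), (qpoch_mod_20 4), (qpoch_mod_20 6).
    cbn [cprod Nat.mul Nat.add]; ring.
Qed.

Lemma slater_94_product : tsum (fun n => zp (n * n + n) * ip (2 * n + 1))
  = / (qpoch_inf x (x ^ 2) * (qpoch_inf (x ^ 2) (- x ^ 5) * qpoch_inf (- x ^ 3) (- x ^ 5))).
Proof using x_nz x_lt.
  pose proof (slater_94_theta x x_nz x_lt) as H; rewrite qpoch_odd_even in H.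
  pose proof (quintuple_mod_20 3 7 16 4 eq_refl eq_refl eq_refl) as Q.
  apply (quotient_eq _ _ _ _ _ _ H); try nz.
  etransitivity; [apply (f_equal (fun w => w * _)); etransitivity; [|exact Q]|].
  - f_equal; apply tsum_ext; intros s; f_equal; cbn [Z.of_nat Pos.of_succ_nat Pos.succ]; ring.
  - rewrite qpoch_even_mod_20, !qpoch_neg_base.
    cbn [cprod Nat.mul Nat.add].
    replace (x ^ 2 * x ^ 5) with (x ^ 7) by ring.
    replace (- (- x ^ 3 * x ^ 5)) with (x ^ 8) by ring.
    (* The even factors (x^6;x^20) and (x^14;x^20) arise as (x^a;x^10)(-x^a;x^10): the first half
       comes from the quintuple product, the second from base -x^5. *)
    rewrite (qpoch_sqr_mod_20 3 6), (qpoch_sqr_mod_20 7 14) by reflexivity.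
    rewrite (qpoch_mod_20 10), (qpoch_mod_20 2), (qpoch_mod_20 8).
    cbn [Nat.add]; ring.
Qed.

Lemma slater_99_product : tsum (fun n => zp (n * n + n) * ip (2 * n))
  = / (qpoch_inf x (x ^ 2) * (qpoch_inf (- x) (- x ^ 5) * qpoch_inf (x ^ 4) (- x ^ 5))).
Proof using x_nz x_lt.
  pose proof (slater_99_theta x x_nz x_lt) as H; rewrite qpoch_odd_even in H.
  (* At k = 1 the linear coefficient 3k - 5 is -2, so the sign of the summation variable is
     reversed. *)
  rewrite <- (tsum_reflect (fun s => zp (15 * s * s + 2 * s)) 0) in H.
  2:{ apply summable_ext with (fun s => zp (15 * s * s + 2 * s) * 1); [intros; ring|].
      apply (summable_zpow1 x x_nz x_lt _ 20 _ 1); [intros j; quad j|].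
      intros; rewrite Cmod_1; lra. }
  pose proof (quintuple_mod_20 1 9 12 8 eq_refl eq_refl eq_refl) as Q.
  apply (quotient_eq _ _ _ _ _ _ H); try nz.
  etransitivity; [apply (f_equal (fun w => w * _)); etransitivity; [|exact Q]|].
  - f_equal; apply tsum_ext; intros s; f_equal; cbn [Z.of_nat Pos.of_succ_nat Pos.succ]; ring.
  - rewrite qpoch_even_mod_20, !qpoch_neg_base.
    cbn [cprod Nat.mul Nat.add].
    replace (- (- x * x ^ 5)) with (x ^ 6) by ring.
    replace (x ^ 4 * x ^ 5) with (x ^ 9) by ring.
    replace (- x) with (- x ^ 1) by ring.
    rewrite (qpoch_sqr_mod_20 1 2), (qpoch_sqr_mod_20 9 18) by reflexivity.
    rewrite (qpoch_mod_20 10), (qpoch_mod_20 6), (qpoch_mod_20 4).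
    cbn [Nat.add]; ring.
Qed.

End Mod20.

(** * Reduction of the double series *)

Lemma CSeries_tsum (f : Z -> C) : (forall n, (n < 0)%Z -> f n = 0) -> summable f ->
  CSeries (fun n => f (Z.of_nat n)) = tsum f.
Proof.
  intros H0 Sf; unfold CSeries; apply lim_clim, has_sum_lim_nat; [exact H0|apply tsum_spec, Sf].
Qed.

Lemma CSeries_ext (u v : nat -> C) : (forall n, u n = v n) -> CSeries u = CSeries v.
Proof. intros E; f_equal; apply functional_extensionality, E. Qed.

(** Identifies the iterated series with the unconditional sum; the outer series converges by
    summability of the row sums. *)
Lemma CSeries2_tsum (f : Z * Z -> C) :
  (forall i j, (i < 0)%Z \/ (j < 0)%Z -> f (i, j) = 0) -> summable f ->
  CSeries2 (fun i j => f (Z.of_nat i, Z.of_nat j)) = tsum f.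
Proof.
  intros H0 Sf; unfold CSeries2; rewrite tsum_fubini by exact Sf.
  rewrite <- CSeries_tsum.
  - apply CSeries_ext; intros i.
    apply (CSeries_tsum (fun j => f (Z.of_nat i, j))); [auto|apply summable_pair, Sf].
  - intros i Hi; apply tsum_0; auto.
  - apply summable_tsum, Sf.
Qed.

(** The slope 20 is generous on purpose: applied to suitable linear forms, it lets linear arithmetic
    absorb all linear terms of an exponent and the weight |m| + |n| + |k|. *)
Lemma square_ge_abs (a : Z) : (20 * Z.abs a - 100 <= a * a)%Z.
Proof. pose proof (Z.square_nonneg (Z.abs a - 10)); nia. Qed.

Section Reduction.

Variable q : C.
Hypothesis q_nz : q <> 0.
Hypothesis q_lt : (Cmod q < 1)%R.

Notation zp := (zpow q).
Notation ip3 := (ipoch (q ^ 3)).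
Notation ip6 := (ipoch (q ^ 6)).

Lemma cube_nz : q ^ 3 <> 0. Proof using q_nz. apply Cpow_nz, q_nz. Qed.

Lemma cube_lt : (Cmod (q ^ 3) < 1)%R.
Proof using q_lt. apply Cmod_Cpow_lt_1; auto; lia. Qed.

Lemma sixth_lt : (Cmod (q ^ 6) < 1)%R.
Proof using q_lt. apply Cmod_Cpow_lt_1; auto; lia. Qed.

Lemma summable_double (c : Z) : (0 <= c <= 2)%Z ->
  summable (fun t : Z * Z => zp (tri (fst t - snd t) + c * (fst t - snd t) + 3 * tri (snd t + 1))
    * (ip3 (fst t) * ip3 (snd t))).
Proof using q_nz q_lt.
  intros Hc; destruct (ipoch_bound (q ^ 3) cube_lt) as [B HB].
  apply (summable_zpow2 q q_nz q_lt _ 1000 _ (B * B)).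
  - intros i j; cbn [fst snd].
    pose proof (tri_spec (i - j)); pose proof (tri_spec (j + 1)).
    pose proof (square_ge_abs (i - j)); pose proof (square_ge_abs j); nia.
  - intros t; apply Cmod_mult_le; auto.
Qed.

(** The summand in the variables m = i - j - 2k, k and j, where k comes from expanding
    1/(q^3;q^3)_i. The identity tri(j+1) + tri(j+m) = tri(m) + j^2 + mj isolates Cauchy's exponent
    in base q^3. *)
Definition triple_term (c : Z) (t : Z * Z * Z) : C :=
  let m := fst (fst t) in let k := snd (fst t) in let j := snd t in
  zp (tri (m + 2 * k) + c * (m + 2 * k) + 3 * tri m + (3 * j * j + 3 * m * j))
  * (ip6 k * (ip3 j * ip3 (j + m))).

Lemma summable_triple (c : Z) : (0 <= c <= 2)%Z -> summable (triple_term c).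
Proof using q_nz q_lt.
  intros Hc; destruct (ipoch_bound (q ^ 3) cube_lt) as [B HB].
  destruct (ipoch_bound (q ^ 6) sixth_lt) as [D HD].
  apply (summable_zpow3 q q_nz q_lt (fun t => tri (fst (fst t) + 2 * snd (fst t))
    + c * (fst (fst t) + 2 * snd (fst t)) + 3 * tri (fst (fst t))
    + (3 * snd t * snd t + 3 * fst (fst t) * snd t))%Z 10000 _ (D * (B * B))).
  - intros m k j; cbn [fst snd].
    pose proof (tri_spec (m + 2 * k)); pose proof (tri_spec m).
    pose proof (square_ge_abs (2 * j + m)); pose proof (square_ge_abs (2 * k + m)).
    pose proof (square_ge_abs m).
    assert (c = 0 \/ c = 1 \/ c = 2)%Z as [->|[->| ->]] by lia; lia.
  - intros t; repeat apply Cmod_mult_le; auto.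
Qed.

Lemma summable_mk (c : Z) : (0 <= c <= 2)%Z ->
  summable (fun t : Z * Z => zp (tri (fst t + 2 * snd t) + c * (fst t + 2 * snd t) + 3 * tri (fst t))
    * ip6 (snd t)).
Proof using q_nz q_lt.
  intros Hc; destruct (ipoch_bound (q ^ 6) sixth_lt) as [D HD].
  apply (summable_zpow2 q q_nz q_lt _ 10000 _ D); auto.
  intros m k; cbn [fst snd].
  pose proof (tri_spec (m + 2 * k)); pose proof (tri_spec m).
  pose proof (square_ge_abs (2 * k + m)); pose proof (square_ge_abs m).
  assert (c = 0 \/ c = 1 \/ c = 2)%Z as [->|[->| ->]] by lia; lia.
Qed.

(* Expanding [1 / (q^3; q^3)_i] through [ipoch_conv_eq] turns the sum over [j]
   into an instance of Cauchy's identity. *)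
Lemma double_sum_mk (c : Z) : (0 <= c <= 2)%Z ->
  tsum (fun t : Z * Z => zp (tri (fst t - snd t) + c * (fst t - snd t) + 3 * tri (snd t + 1))
    * (ip3 (fst t) * ip3 (snd t)))
  = / qpoch_inf (q ^ 3) (q ^ 3)
    * tsum (fun t : Z * Z =>
        zp (tri (fst t + 2 * snd t) + c * (fst t + 2 * snd t) + 3 * tri (fst t)) * ip6 (snd t)).
Proof using q_nz q_lt.
  intros Hc; pose proof (summable_triple c Hc) as S3.
  set (e := fun t : Z * Z * Z =>
    (fst (fst t) - snd (fst t) - 2 * snd t, snd t, snd (fst t))%Z).
  set (d := fun t : Z * Z * Z =>
    (fst (fst t) + 2 * snd (fst t) + snd t, snd t, snd (fst t))%Z).
  assert (Hde : forall t, d (e t) = t)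
    by (intros [[i j] k]; unfold d, e; cbn [fst snd]; f_equal; f_equal; ring).
  assert (Hed : forall t, e (d t) = t)
    by (intros [[i j] k]; unfold d, e; cbn [fst snd]; f_equal; f_equal; ring).
  assert (Se : summable (fun t => triple_term c (e t))).
  { apply summable_inj; auto; intros u v E; rewrite <- (Hde u), <- (Hde v), E; reflexivity. }
  transitivity (tsum (triple_term c)).
  - rewrite <- (tsum_bij e d _ Hde Hed S3), (tsum_fubini _ Se).
    apply tsum_ext; intros [i j]; cbn [fst snd].
    rewrite (ipoch_conv_eq (q ^ 3) cube_nz cube_lt i); unfold ipoch_conv.
    rewrite <- Cpow_mult_r; change (3 * 2)%nat with 6%nat.
    transitivity ((zp (tri (i - j) + c * (i - j) + 3 * tri (j + 1)) * ip3 j) *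
      tsum (fun k => zpow (q ^ 3) (tri (i - 2 * k)) * (ip3 (i - 2 * k) * ip6 k))); [ring|].
    rewrite <- tsum_scal.
    + apply tsum_ext; intros k; unfold triple_term, e; cbn [fst snd].
      replace (j + (i - j - 2 * k))%Z with (i - 2 * k)%Z by ring.
      rewrite zpow_Cpow by exact q_nz.
      rewrite (zpow_eq q q_nz (tri (i - j - 2 * k + 2 * k) + c * (i - j - 2 * k + 2 * k)
          + 3 * tri (i - j - 2 * k) + (3 * j * j + 3 * (i - j - 2 * k) * j))
        (tri (i - j) + c * (i - j) + 3 * tri (j + 1)) (Z.of_nat 3 * tri (i - 2 * k))); [ring|].
      replace (i - j - 2 * k + 2 * k)%Z with (i - j)%Z by ring.
      pose proof (tri_spec (i - j - 2 * k)); pose proof (tri_spec (j + 1));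
        pose proof (tri_spec (i - 2 * k)); lia.
    + pose proof (summable_ipoch_conv (q ^ 3) cube_nz cube_lt i) as S.
      rewrite <- Cpow_mult_r in S; exact S.
  - rewrite (tsum_fubini _ S3).
    rewrite <- tsum_scal by (apply summable_mk, Hc).
    apply tsum_ext; intros [m k]; cbn [fst snd].
    rewrite <- (cauchy_sum_eq (q ^ 3) cube_nz cube_lt m), Cmult_comm; unfold cauchy_sum.
    rewrite <- tsum_scal by (apply summable_cauchy; auto using cube_nz, cube_lt).
    apply tsum_ext; intros j; unfold triple_term; cbn [fst snd].
    rewrite zpow_Cpow, (zpow_add q _ (3 * j * j + 3 * m * j)) by exact q_nz.
    replace (Z.of_nat 3 * (j * j + m * j))%Z with (3 * j * j + 3 * m * j)%Z by ring; ring.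
Qed.

(** * Factorisation into Gauss theta functions and single series *)

Lemma summable_gauss (c : Z) : (-2 <= c <= 2)%Z -> summable (fun m => zp (2 * m * m + c * m)).
Proof using q_nz q_lt.
  intros Hc; apply summable_ext with (fun m => zp (2 * m * m + c * m) * 1); [intros; ring|].
  apply (summable_zpow1 q q_nz q_lt _ 1000 _ 1).
  - intros m; pose proof (square_ge_abs m); nia.
  - intros; rewrite Cmod_1; lra.
Qed.

(** [S1] is the case c = 0 and [S2] the case c = 2. The factor q^(1+2c), due to odd k, is the source
    of q and q^5 in the theorem. *)
Lemma double_sum_factor (c : Z) : (0 <= c <= 2)%Z ->
  tsum (fun t : Z * Z => zp (tri (fst t - snd t) + c * (fst t - snd t) + 3 * tri (snd t + 1))
    * (ip3 (fst t) * ip3 (snd t)))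
  = / qpoch_inf (q ^ 3) (q ^ 3)
    * (tsum (fun m => zp (2 * m * m + (c - 2) * m)) * tsum (fun r => zp (6 * r * r + 3 * c * r) * ip6 (2 * r))
       + zp (1 + 2 * c) * (tsum (fun m => zp (2 * m * m + c * m))
           * tsum (fun r => zp (6 * r * r + 6 * r + 3 * c * r) * ip6 (2 * r + 1)))).
Proof using q_nz q_lt.
  intros Hc; rewrite (double_sum_mk c Hc); f_equal.
  pose proof (summable_mk c Hc) as S0.
  set (f := fun t : Z * Z => _) in *.
  destruct (ipoch_bound (q ^ 6) sixth_lt) as [D HD].
  assert (Sr0 : summable (fun r => zp (6 * r * r + 3 * c * r) * ip6 (2 * r))).
  { apply (summable_zpow1 q q_nz q_lt _ 1000 _ D); auto.
    intros r; pose proof (square_ge_abs r); nia. }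
  assert (Sr1 : summable (fun r => zp (6 * r * r + 6 * r + 3 * c * r) * ip6 (2 * r + 1))).
  { apply (summable_zpow1 q q_nz q_lt _ 1000 _ D); auto.
    intros r; pose proof (square_ge_abs r); nia. }
  rewrite tsum_fubini, tsum_swap by exact S0.
  assert (Sk : summable (fun k => tsum (fun m => f (m, k)))).
  { apply (summable_tsum (fun t : Z * Z => f (snd t, fst t))).
    apply (summable_inj (fun t : Z * Z => (snd t, fst t)) f); [|exact S0].
    intros [a b] [a' b'] E; apply pair_equal_spec in E; cbn [fst snd] in E.
    destruct E; f_equal; assumption. }
  assert (Sm : forall k, summable (fun m => f (m, k))).
  { intros k; apply (summable_inj (fun m : Z => (m, k)) f); [intros; congruence|exact S0]. }
  rewrite tsum_split2 by exact Sk; f_equal.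
  - rewrite <- tsum_scal by exact Sr0.
    apply tsum_ext; intros r.
    rewrite Cmult_comm, <- tsum_scal by (apply summable_gauss; lia).
    (* The shift m -> m - r removes the cross term; for k = 2r + 1 the same shift works and only
       changes the linear coefficient. *)
    rewrite <- (tsum_shift _ (- r) (Sm (2 * r)%Z)).
    apply tsum_ext; intros m; unfold f; cbn [fst snd].
    rewrite (zpow_eq q q_nz (tri (m + - r + 2 * (2 * r)) + c * (m + - r + 2 * (2 * r)) + 3 * tri (m + - r))
      (2 * m * m + (c - 2) * m) (6 * r * r + 3 * c * r)); [ring|].
    pose proof (tri_spec (m + - r + 2 * (2 * r))); pose proof (tri_spec (m + - r)); lia.
  - rewrite <- tsum_scal by exact Sr1.
    rewrite <- tsum_scal by (apply summable_scal, Sr1).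
    apply tsum_ext; intros r.
    transitivity ((zp (1 + 2 * c) * (zp (6 * r * r + 6 * r + 3 * c * r) * ip6 (2 * r + 1)))
      * tsum (fun m => zp (2 * m * m + c * m))); [|ring].
    rewrite <- tsum_scal by (apply summable_gauss; lia).
    rewrite <- (tsum_shift _ (- r) (Sm (2 * r + 1)%Z)).
    apply tsum_ext; intros m; unfold f; cbn [fst snd].
    rewrite (zpow_eq q q_nz
      (tri (m + - r + 2 * (2 * r + 1)) + c * (m + - r + 2 * (2 * r + 1)) + 3 * tri (m + - r))
      (1 + 2 * c + (6 * r * r + 6 * r + 3 * c * r)) (2 * m * m + c * m)).
    + rewrite zpow_add by exact q_nz; ring.
    + pose proof (tri_spec (m + - r + 2 * (2 * r + 1))); pose proof (tri_spec (m + - r)); lia.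
Qed.

Lemma gauss_even : tsum (fun m => zp (2 * m * m))
  = qpoch_inf (- q ^ 2) (q ^ 4) * qpoch_inf (- q ^ 2) (q ^ 4) * qpoch_inf (q ^ 4) (q ^ 4).
Proof using q_nz q_lt.
  assert (H2 : q ^ 2 <> 0) by apply Cpow_nz, q_nz.
  pose proof (jacobi_triple_product (q ^ 4) (Cpow_nz _ 4 q_nz)
    (Cmod_Cpow_lt_1 q 4 q_lt ltac:(lia)) (q ^ 2) H2) as J.
  replace (q ^ 4 / q ^ 2) with (q ^ 2) in J by (field; exact q_nz).
  rewrite <- J; apply tsum_ext; intros m.
  rewrite !zpow_Cpow, <- zpow_add by exact q_nz; f_equal; pose proof (tri_spec m); lia.
Qed.

(** The triple product at z = 1: the leading factor of (-1;q^4)_inf is the 2 that appears in the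
    theorem. *)
Lemma gauss_odd : tsum (fun m => zp (2 * m * m - 2 * m))
  = 2 * (qpoch_inf (- q ^ 4) (q ^ 4) * qpoch_inf (- q ^ 4) (q ^ 4)) * qpoch_inf (q ^ 4) (q ^ 4).
Proof using q_nz q_lt.
  assert (H4 : (Cmod (q ^ 4) < 1)%R) by (apply Cmod_Cpow_lt_1; auto; lia).
  pose proof (jacobi_triple_product (q ^ 4) (Cpow_nz _ 4 q_nz) H4 1 C1_nz) as J.
  rewrite (qpoch_inf_head (- (1))) in J by exact H4.
  replace (- (1) * q ^ 4) with (- q ^ 4) in J by ring.
  replace (- (q ^ 4 / 1)) with (- q ^ 4) in J by field.
  replace (1 - - (1)) with (RtoC 2) in J by (rewrite <- RtoC_opp, <- RtoC_minus; f_equal; ring).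
  transitivity (tsum (fun n => zpow (q ^ 4) (tri n) * zpow 1 n)); [|rewrite J; ring].
  apply tsum_ext; intros m.
  rewrite zpow_Cpow, zpow_1_l, Cmult_1_r by exact q_nz; f_equal; pose proof (tri_spec m); lia.
Qed.

Lemma gauss_odd_shift :
  tsum (fun m => zp (2 * m * m + 2 * m)) = tsum (fun m => zp (2 * m * m - 2 * m)).
Proof using q_nz q_lt.
  rewrite <- (tsum_shift _ (-1) (summable_gauss 2 ltac:(lia))).
  apply tsum_ext; intros m; f_equal; ring.
Qed.

(** * Identification of the two double series *)

Lemma S_tsum (c : Z) (e : nat -> nat -> Z) : (0 <= c <= 2)%Z ->
  (forall i j, e i j = tri (Z.of_nat i - Z.of_nat j) + c * (Z.of_nat i - Z.of_nat j)
    + 3 * tri (Z.of_nat j + 1))%Z ->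
  CSeries2 (fun i j => zp (e i j) /
    (qpoch (pow_n q 3) (pow_n q 3) i * qpoch (pow_n q 3) (pow_n q 3) j))
  = tsum (fun t : Z * Z => zp (tri (fst t - snd t) + c * (fst t - snd t) + 3 * tri (snd t + 1))
    * (ip3 (fst t) * ip3 (snd t))).
Proof using q_nz q_lt.
  intros Hc He; rewrite <- CSeries2_tsum; [|cbn [fst snd]|apply summable_double, Hc].
  - unfold CSeries2; apply CSeries_ext; intros i; apply CSeries_ext; intros j; cbn [fst snd].
    rewrite !ipoch_nat, He; change (pow_n q 3) with (q ^ 3).
    field; split; apply qpoch_nz; exact cube_lt.
  - intros i j [H|H]; rewrite (ipoch_neg _ _ H); ring.
Qed.

Lemma S1_tsum : S1 q = tsum (fun t : Z * Z =>
  zp (tri (fst t - snd t) + 0 * (fst t - snd t) + 3 * tri (snd t + 1)) * (ip3 (fst t) * ip3 (snd t))).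
Proof using q_nz q_lt.
  apply S_tsum; [lia|]; intros i j; unfold e1; cbv zeta.
  replace (Z.of_nat i * Z.of_nat i - Z.of_nat i)%Z
    with (Z.of_nat i * (Z.of_nat i - 1))%Z by ring; fold (tri (Z.of_nat i)).
  pose proof (tri_spec (Z.of_nat i)); pose proof (tri_spec (Z.of_nat i - Z.of_nat j)).
  pose proof (tri_spec (Z.of_nat j + 1)); lia.
Qed.

Lemma S2_tsum : S2 q = tsum (fun t : Z * Z =>
  zp (tri (fst t - snd t) + 2 * (fst t - snd t) + 3 * tri (snd t + 1)) * (ip3 (fst t) * ip3 (snd t))).
Proof using q_nz q_lt.
  apply S_tsum; [lia|]; intros i j; unfold e2; cbv zeta.
  replace (Z.of_nat i * Z.of_nat i + 3 * Z.of_nat i)%Z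
    with (Z.of_nat i * (Z.of_nat i - 1) + (2 * Z.of_nat i) * 2)%Z by ring.
  rewrite Z.div_add by lia; fold (tri (Z.of_nat i)).
  pose proof (tri_spec (Z.of_nat i)); pose proof (tri_spec (Z.of_nat i - Z.of_nat j)).
  pose proof (tri_spec (Z.of_nat j + 1)); lia.
Qed.

Lemma sixth_nz : q ^ 6 <> 0. Proof using q_nz. apply Cpow_nz, q_nz. Qed.

Ltac nz := apply qpoch_inf_nz; rewrite ?Cmod_opp; apply Cmod_Cpow_lt_1; auto; lia.

Lemma S1_product : S1 q =
  qpoch_inf (q ^ 4) (q ^ 4) / (qpoch_inf (q ^ 3) (q ^ 3) * qpoch_inf (q ^ 6) (q ^ 12)) *
    (2 * (qpoch_inf (- q ^ 4) (q ^ 4) * qpoch_inf (- q ^ 4) (q ^ 4)) /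
         (qpoch_inf (q ^ 24) (q ^ 120) * qpoch_inf (q ^ 96) (q ^ 120))
     + q * (qpoch_inf (- q ^ 2) (q ^ 4) * qpoch_inf (- q ^ 2) (q ^ 4)) /
         (qpoch_inf (q ^ 12) (- q ^ 30) * qpoch_inf (- q ^ 18) (- q ^ 30))).
Proof using q_nz q_lt.
  rewrite S1_tsum, double_sum_factor by lia.
  change (1 + 2 * 0)%Z with 1%Z; rewrite zpow_1_r.
  (* With x = q^6, base x^20 becomes q^120, base -x^5 becomes -q^30, and (x;x^2) becomes the common
     factor (q^6;q^12). *)
  pose proof (slater_79_product (q ^ 6) sixth_nz sixth_lt) as A.
  pose proof (slater_94_product (q ^ 6) sixth_nz sixth_lt) as B.
  repeat rewrite <- Cpow_mult_r in A; repeat rewrite <- Cpow_mult_r in B.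
  cbn [Nat.mul Nat.add] in A, B.
  rewrite (tsum_ext _ (fun m => zp (2 * m * m - 2 * m))) by (intros m; f_equal; ring).
  rewrite (tsum_ext (fun m => zp (2 * m * m + 0 * m)) (fun m => zp (2 * m * m)))
    by (intros m; f_equal; ring).
  rewrite gauss_odd, gauss_even.
  rewrite (tsum_ext (fun r => zp (6 * r * r + 3 * 0 * r) * ip6 (2 * r))
    (fun r => zpow (q ^ 6) (r * r) * ip6 (2 * r)))
    by (intros r; rewrite zpow_Cpow by exact q_nz; do 2 f_equal; ring).
  rewrite (tsum_ext (fun r => zp (6 * r * r + 6 * r + 3 * 0 * r) * ip6 (2 * r + 1))
    (fun r => zpow (q ^ 6) (r * r + r) * ip6 (2 * r + 1)))
    by (intros r; rewrite zpow_Cpow by exact q_nz; do 2 f_equal; ring).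
  rewrite A, B; field; repeat split; nz.
Qed.

Lemma S2_product : S2 q =
  qpoch_inf (q ^ 4) (q ^ 4) / (qpoch_inf (q ^ 3) (q ^ 3) * qpoch_inf (q ^ 6) (q ^ 12)) *
    ((qpoch_inf (- q ^ 2) (q ^ 4) * qpoch_inf (- q ^ 2) (q ^ 4)) /
         (qpoch_inf (- q ^ 6) (- q ^ 30) * qpoch_inf (q ^ 24) (- q ^ 30))
     + 2 * q ^ 5 * (qpoch_inf (- q ^ 4) (q ^ 4) * qpoch_inf (- q ^ 4) (q ^ 4)) /
         (qpoch_inf (q ^ 48) (q ^ 120) * qpoch_inf (q ^ 72) (q ^ 120))).
Proof using q_nz q_lt.
  rewrite S2_tsum, double_sum_factor by lia.
  change (1 + 2 * 2)%Z with (Z.of_nat 5); rewrite zpow_nat.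
  pose proof (slater_99_product (q ^ 6) sixth_nz sixth_lt) as A.
  pose proof (slater_96_product (q ^ 6) sixth_nz sixth_lt) as B.
  repeat rewrite <- Cpow_mult_r in A; repeat rewrite <- Cpow_mult_r in B.
  cbn [Nat.mul Nat.add] in A, B.
  rewrite (tsum_ext _ (fun m => zp (2 * m * m))) by (intros m; f_equal; ring).
  rewrite gauss_odd_shift, gauss_odd, gauss_even.
  rewrite (tsum_ext (fun r => zp (6 * r * r + 3 * 2 * r) * ip6 (2 * r))
    (fun r => zpow (q ^ 6) (r * r + r) * ip6 (2 * r)))
    by (intros r; rewrite zpow_Cpow by exact q_nz; do 2 f_equal; ring).
  rewrite (tsum_ext (fun r => zp (6 * r * r + 6 * r + 3 * 2 * r) * ip6 (2 * r + 1))
    (fun r => zpow (q ^ 6) (r * r + 2 * r) * ip6 (2 * r + 1)))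
    by (intros r; rewrite zpow_Cpow by exact q_nz; do 2 f_equal; ring).
  rewrite A, B; field; repeat split; nz.
Qed.

End Reduction.

(** * The case [q = 0] *)

Lemma CSeries_finite (u : nat -> C) (N : nat) : (forall n, (N < n)%nat -> u n = 0) ->
  CSeries u = sum_n u N.
Proof.
  intros H; unfold CSeries; apply lim_clim; intros eps He; exists N; intros n Hn.
  replace (sum_n u n) with (sum_n u N).
  - replace (sum_n u N - sum_n u N) with (RtoC 0) by ring; rewrite Cmod_0; exact He.
  - induction Hn as [|n Hn IH]; [reflexivity|].
    rewrite sum_Sn, <- IH, H by lia; symmetry; exact (Cplus_0_r _).
Qed.

Lemma zpow_0_l (n : Z) : (0 < n)%Z -> zpow 0 n = 0.
Proof.
  intros Hn; replace n with (Z.of_nat (S (Z.to_nat (n - 1)))) by lia.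
  rewrite zpow_nat, Cpow_S; ring.
Qed.

Lemma qpoch_0_l (q : C) (n : nat) : qpoch 0 q n = 1.
Proof. induction n as [|n IH]; [reflexivity|rewrite qpoch_S, IH; ring]. Qed.

Lemma qpoch_inf_0_l (q : C) : qpoch_inf 0 q = 1.
Proof.
  apply lim_clim, clim_ext with (fun _ => 1); [|apply clim_const].
  intros n; symmetry; apply qpoch_0_l.
Qed.

(** At q = 0 all Pochhammer denominators are 1 and positive exponents give 0, so only the pairs
    (0,0) and (1,0) can contribute. *)
Lemma CSeries2_at_0 (q : C) (e : nat -> nat -> Z) : q = 0 ->
  (forall i j, (0 < j)%nat \/ (1 < i)%nat -> (0 < e i j)%Z) ->
  CSeries2 (fun i j => zpow q (e i j) /
    (qpoch (pow_n q 3) (pow_n q 3) i * qpoch (pow_n q 3) (pow_n q 3) j))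
  = zpow 0 (e 0%nat 0%nat) + zpow 0 (e 1%nat 0%nat).
Proof.
  intros Hq He.
  assert (E : forall i j, zpow q (e i j) /
    (qpoch (pow_n q 3) (pow_n q 3) i * qpoch (pow_n q 3) (pow_n q 3) j) = zpow 0 (e i j)).
  { intros i j.
    assert (H3 : pow_n q 3 = RtoC 0 :> C) by (rewrite pow_n_Cpow, Hq; ring).
    rewrite H3, Hq, !qpoch_0_l; field. }
  unfold CSeries2.
  rewrite (CSeries_ext _ (fun i => zpow 0 (e i 0%nat))).
  - rewrite (CSeries_finite _ 1) by (intros n Hn; apply zpow_0_l, He; lia).
    rewrite sum_Sn, sum_O; reflexivity.
  - intros i; rewrite (CSeries_ext _ _ (E i)), (CSeries_finite _ 0), sum_O; [reflexivity|].
    intros j Hj; apply zpow_0_l, He; lia.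
Qed.

Theorem theorem1p3 : forall q : C, (Cmod q < 1)%R ->
  let P := qpoch_inf in
  let pre := P (pow_n q 4) (pow_n q 4) /
             (P (pow_n q 3) (pow_n q 3) * P (pow_n q 6) (pow_n q 12)) in
  S1 q = pre *
    (2 * (P (- pow_n q 4) (pow_n q 4) * P (- pow_n q 4) (pow_n q 4)) /
         (P (pow_n q 24) (pow_n q 120) * P (pow_n q 96) (pow_n q 120))
     + q * (P (- pow_n q 2) (pow_n q 4) * P (- pow_n q 2) (pow_n q 4)) /
         (P (pow_n q 12) (- pow_n q 30) * P (- pow_n q 18) (- pow_n q 30)))
  /\
  S2 q = pre *
    ((P (- pow_n q 2) (pow_n q 4) * P (- pow_n q 2) (pow_n q 4)) /
         (P (- pow_n q 6) (- pow_n q 30) * P (pow_n q 24) (- pow_n q 30))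
     + 2 * pow_n q 5 * (P (- pow_n q 4) (pow_n q 4) * P (- pow_n q 4) (pow_n q 4)) /
         (P (pow_n q 48) (pow_n q 120) * P (pow_n q 72) (pow_n q 120))).
Proof.
  intros q Hq P pre; unfold pre, P; repeat rewrite pow_n_Cpow.
  destruct (ceq_dec q 0) as [E|Hq0].
  - assert (H0 : forall n, q ^ S n = 0) by (intros n; rewrite E, Cpow_S; ring).
    assert (Hm : - RtoC 0 = 0) by ring.
    repeat rewrite H0; repeat rewrite Hm; repeat rewrite qpoch_inf_0_l.
    unfold S1, S2; rewrite (CSeries2_at_0 q e1 E), (CSeries2_at_0 q e2 E).
    (* Both exponents of [S1] vanish, while those of [S2] are 0 and 2: the two identities read 2 = 2
       and 1 = 1. *)
    + unfold e1, e2; cbn -[zpow]; rewrite zpow_0_r, zpow_0_l, E by lia.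
      split; field.
    + intros i j H; unfold e2; cbv zeta.
      replace (Z.of_nat i * Z.of_nat i + 3 * Z.of_nat i)%Z
        with (Z.of_nat i * (Z.of_nat i - 1) + (2 * Z.of_nat i) * 2)%Z by ring.
      rewrite Z.div_add by lia; fold (tri (Z.of_nat i)).
      pose proof (tri_spec (Z.of_nat i)); nia.
    + intros i j H; unfold e1; cbv zeta.
      replace (Z.of_nat i * Z.of_nat i - Z.of_nat i)%Z
        with (Z.of_nat i * (Z.of_nat i - 1))%Z by ring; fold (tri (Z.of_nat i)).
      pose proof (tri_spec (Z.of_nat i)); nia.
  - split; [apply S1_product|apply S2_product]; assumption.
Qed.
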